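(* Let $G$ be a finite group. Then $G$ is a group with SN if and only if it is of one of the following types: (i) a group with SSN; (ii) $G\cong P\rtimes H$ with $P$ an elementary abelian Sylow $p$-subgroup (for some prime $p$) and $H$ a $p'$-Hall subgroup which is Dedekind with cyclic or generalized quaternion Sylow subgroups, such that the action of $H$ on $P$ is irreducible and faithful; (iii) $G$ has a unique minimal normal subgroup $S$, $S$ is not solvable, and $G/S$ is Dedekind; (iv) $\mathbb{Q}G$ has one matrix component.
   Context: A finite group $G$ has SN if for every normal subgroup $N\unlhd G$ and every subgroup $Y\le G$ one has $N\le Y$ or $NY\unlhd G$. $G$ has SSN if every subgroup of $G$ has SN. A group is Dedekind if all its subgroups are normal. Generalized quaternion groups are non-abelian, of order $2^n\geq 8$: $Q_{2^n}=\langle a,b\mid a^{2^{n-1}}=b^4=1,\ b^2=a^{2^{n-2}},\ a^b=a^{-1}\rangle$. Let $\mathbb{Q}G\cong\bigoplus_i M_{n_i}(D_i)$ be the Wedderburn-Artin decomposition with $D_i$ division algebras. A simple component $M_{n_i}(D_i)$ is called a matrix component if $n_i\ge 2$; $\mathbb{Q}G$ has one matrix component if exactly one simple component is a matrix component. *)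

(* Defs.v *)
From mathcomp Require Import all_boot all_order all_algebra all_fingroup.
From mathcomp Require Import all_solvable all_field all_character.

Set Implicit Arguments.
Unset Strict Implicit.
Unset Printing Implicit Defensive.

Import GRing.Theory GroupScope.

Definition has_SN (gT : finGroupType) (G : {group gT}) : Prop :=
  forall N Y : {group gT},
    N <| G -> Y \subset G -> N \subset Y \/ N * Y <| G.

Definition has_SSN (gT : finGroupType) (G : {group gT}) : Prop :=
  forall H : {group gT}, H \subset G -> has_SN H.

Definition dedekind (gT : finGroupType) (G : {group gT}) : Prop :=
  forall H : {group gT}, H \subset G -> H <| G.

Definition generalized_quaternion (gT : finGroupType) (Q : {group gT}) : Prop :=
  exists2 n, 3 <= n & Q \isog 'Q_(2 ^ n).

Definition unique_minnormal (gT : finGroupType) (G S : {group gT}) : Prop :=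
  [/\ S \subset G, minnormal S G
    & forall T : {group gT}, T \subset G -> minnormal T G -> T = S].

Local Open Scope ring_scope.

Definition division_algebra (D : falgType rat) : Prop :=
  forall x : D, x != 0 -> x \is a GRing.unit.

(* [wedderburn_artin G n D f]: every n i is positive, every D i is a finite   *)
(* dimensional rational division algebra, and x |-> (f i x)_i restricts to an *)
(* isomorphism of Q-algebras from QG onto the direct sum of the               *)
(* M_(n i)(D i).  Here QG is [group_ring rat G], a subalgebra of the square   *)
(* matrices of size #|G|; the values of f outside QG are irrelevant.  The     *)
(* library's scaling on 'M[D i] is by D i, so the rational scaling is written *)
(* entrywise.                                                                 *)
Record wedderburn_artin (gT : finGroupType) (G : {group gT}) (k : nat)
    (n : 'I_k -> nat) (D : 'I_k -> falgType rat)
    (f : forall i : 'I_k, 'M[rat]_#|G| -> 'M[D i]_(n i)) : Prop :=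
  WedderburnArtin {
    wa_size_gt0 : forall i, (0 < n i)%N;
    wa_division : forall i, division_algebra (D i);
    wa_linear : forall i (a : rat) (x y : 'M[rat]_#|G|),
      (x \in group_ring rat G)%MS -> (y \in group_ring rat G)%MS ->
      f i (a *: x + y) = map_mx (fun d : D i => a *: d) (f i x) + f i y;
    wa_mul : forall i (x y : 'M[rat]_#|G|),
      (x \in group_ring rat G)%MS -> (y \in group_ring rat G)%MS ->
      f i (x *m y) = f i x *m f i y;
    wa_one : forall i, f i 1%:M = 1%:M;
    wa_inj : forall x y : 'M[rat]_#|G|,
      (x \in group_ring rat G)%MS -> (y \in group_ring rat G)%MS ->
      (forall i, f i x = f i y) -> x = y;
    wa_surj : forall z : (forall i, 'M[D i]_(n i)),
      exists2 x, (x \in group_ring rat G)%MS & forall i, f i x = z i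
  }.

(* The decomposition is unique up to reordering and isomorphism of the        *)
(* factors, so the choice of one is immaterial.                               *)
Definition one_matrix_component (gT : finGroupType) (G : {group gT}) : Prop :=
  exists (k : nat) (n : 'I_k -> nat) (D : 'I_k -> falgType rat)
         (f : forall i : 'I_k, 'M[rat]_#|G| -> 'M[D i]_(n i)),
    wedderburn_artin f /\ #|[set i | (2 <= n i)%N]| = 1%N.

(* Main.v *)
Require Import Defs.
From mathcomp Require Import all_boot all_order all_algebra all_fingroup.
From mathcomp Require Import all_solvable all_field all_character.
From Stdlib Require Classical_Prop.

Set Implicit Arguments.
Unset Strict Implicit.
Unset Printing Implicit Defensive.

Import GroupScope.

(* A nonnilpotent group G with SN has a nonnormal maximal subgroup M.  If M is
   core-free then G is primitive with a unique minimal normal subgroup S and a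
   Dedekind quotient G / S, which gives (ii) or (iii) according to whether S is
   solvable; otherwise M is cyclic and G has SSN.  A nilpotent group with SN
   that is not Dedekind is a p-group.  If its center is noncyclic, it has SSN
   or is Q8 x Q8.  If its center is cyclic, with S the subgroup of order p, then
   either G / S is Dedekind, hence abelian, or all noncyclic subgroups of G are
   normal and G has SSN.

   In the remaining cases one matrix component is obtained from a central
   idempotent e of QG such that e QG is prime and every a in QG with a^2 = 0
   lies in e QG: since QG is von Neumann regular, a decomposition of 1 into
   primitive idempotents then has only one class of size at least 2.  For
   N1, N2 central (both S, resp. the centers of the factors of Q8 x Q8) take
   e = (1 - \hat N1) (1 - \hat N2), where \hat N is the average of N.

   Conversely, if only one component is a matrix component, the projection of
   \hat N to it is 0 or 1, so \hat Y \hat N or \hat Y (1 - \hat N) is an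
   idempotent with zero matrix part, hence central, and NY is normal or
   N <= Y.  *)

(** * Nonnilpotent groups *)

(** A recurring contradiction with SN is that two normal subgroups [<a> Y] and [<b> Y] meet in [Y],
    so that [Y] is normal. It forces nonnormal cyclic subgroups to meet any central subgroup of type
    (p, p), which is why the proof divides on whether the center is cyclic.

    The idempotent e cuts off the parts of QG on which N1 or N2 acts trivially. These are Q[G / N1]
    and Q[G / N2], where each conjugate of g is g or g^-1; as with the rational quaternions, such an
    algebra has no nonzero element of square zero. For Q8 x Q8 what remains is the tensor product of
    two rational quaternion algebras, that is M_4(Q).

    No characters are used. QG is a space of rational matrices closed under transposition, and a a^T
    = 0 only for a = 0; this positivity gives both regularity and the absence of square-zero
    elements. That e QG is prime rests on the irreducibility over Q of cyclotomic polynomials of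
    prime power order. *)

Lemma normal_quo_inv (gT : finGroupType) (G N X : {group gT}) :
  N <| G -> N \subset X -> X \subset G -> X / N <| G / N -> X <| G.
Proof.
move=> nNG sNX sXG nXG.
have nNX : N <| X := normalS sNX sXG nNG.
by rewrite -(quotientGK nNX) -(quotientGK nNG) cosetpre_normal.
Qed.

Lemma dedekind_quoP (gT : finGroupType) (G N : {group gT}) : N <| G ->
  dedekind (G / N)%G <->
  (forall X : {group gT}, N \subset X -> X \subset G -> X <| G).
Proof.
move=> nNG; split=> [dG X sNX sXG | dG H sHG].
  by apply: (normal_quo_inv nNG sNX sXG); apply: (dG (X / N)%G); apply: quotientS.
case/inv_quotientS: sHG => // K defH sNK sKG.
by rewrite defH; apply: quotient_normal; apply: dG.
Qed.

(** A nontrivial [N] contains [S], hence so does [NY]. Types (ii) and (iii) give SN in this way. *)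
Lemma SN_of_unique_min (gT : finGroupType) (G S : {group gT}) :
    (forall N : {group gT}, N <| G -> N :!=: 1 -> S \subset N) ->
    (forall X : {group gT}, S \subset X -> X \subset G -> X <| G) ->
  has_SN G.
Proof.
move=> minS dG N Y nNG sYG.
have [-> | ntN] := eqVneq (N : {set gT}) 1; first by left; rewrite sub1G.
right; have nNY := subset_trans sYG (normal_norm nNG).
rewrite -norm_joinEr //; apply: dG.
  by apply: subset_trans (minS _ nNG ntN) (joing_subl _ _).
by rewrite join_subG (normal_sub nNG).
Qed.

Lemma SN_quotient (gT : finGroupType) (G N : {group gT}) :
  N <| G -> has_SN G -> has_SN (G / N)%G.
Proof.
move=> nNG SNG M Y nMG sYG.
have [K defM sNK nKG] := inv_quotientN nNG nMG.
case/inv_quotientS: sYG => // X defY sNX sXG.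
have nNK : K \subset 'N(N) := subset_trans (normal_sub nKG) (normal_norm nNG).
rewrite defM defY.
have [sKX | nKX] := SNG K X nKG sXG; first by left; apply: quotientS.
by right; rewrite -quotientMl //; apply: quotient_normal.
Qed.

Lemma dedekindS (gT : finGroupType) (G H : {group gT}) :
  H \subset G -> dedekind G -> dedekind H.
Proof.
move=> sHG dG X sXH; have sXG := subset_trans sXH sHG.
exact: normalS sXH sHG (dG X sXG).
Qed.

Lemma dedekind_SSN (gT : finGroupType) (G : {group gT}) :
  dedekind G -> has_SSN G.
Proof.
move=> dG H sHG N Y nNH sYH; right.
rewrite -norm_joinEr ?(subset_trans sYH (normal_norm nNH)) //.
by apply: (dedekindS sHG dG); rewrite join_subG (normal_sub nNH).
Qed.

Lemma cyclic_chain (gT : finGroupType) (p : nat) (C N Y : {group gT}) :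
    p.-group C -> cyclic C -> N \subset C -> Y \subset C ->
  (N \subset Y) || (Y \subset N).
Proof.
move=> pC cC sNC sYC; rewrite -(cardSg_cyclic cC sNC sYC) -(cardSg_cyclic cC sYC sNC).
have [i ->] := p_natP (pgroupS sNC pC); have [j ->] := p_natP (pgroupS sYC pC).
by have [/(dvdn_exp2l p)-> // | /ltnW/(dvdn_exp2l p)->] := leqP i j; rewrite orbT.
Qed.

(** If [NY] is not normal in [H], it is not normal in [G] either, so it is a cyclic p-group and its
    subgroups form a chain: then N <= Y, or NY = N, which is normal. *)
Lemma SSN_of_cyclic (gT : finGroupType) (p : nat) (G : {group gT}) :
    (forall X : {group gT}, X \subset G -> ~~ (X <| G) ->
       p.-group X && cyclic X) ->
  has_SSN G.
Proof.
move=> cX H sHG N Y nNH sYH.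
have nNY := subset_trans sYH (normal_norm nNH).
rewrite -norm_joinEr //; set X := (N <*> Y)%G.
have sXH : X \subset H by rewrite join_subG (normal_sub nNH).
have [nXG | nnX] := boolP (X <| G); first by right; apply: normalS sXH sHG nXG.
have /andP[pX cycX] := cX _ (subset_trans sXH sHG) nnX.
case/orP: (cyclic_chain pX cycX (joing_subl N Y) (joing_subr N Y)); first by left.
by move/joing_idPl=> defX; right; rewrite /= defX.
Qed.

(** By the Frattini argument, a maximal subgroup above the normalizer of a nonnormal Sylow subgroup
    is not normal. Without such subgroups, all Sylow subgroups are normal and the Fitting subgroup
    is everything. *)
Lemma nonnormal_maximal (gT : finGroupType) (G : {group gT}) :
  ~~ nilpotent G -> exists M : {group gT}, maximal M G /\ ~~ (M <| G).
Proof.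
move=> nnG; have [/existsP[M /andP[maxM nM]] | ] :=
  boolP [exists M : {group gT}, maximal M G && ~~ (M <| G)]; first by exists M.
rewrite negb_exists => /forallP noM; case/negP: nnG.
suffices defG : 'F(G) = G by rewrite -[X in nilpotent X]defG Fitting_nil.
apply/eqP; rewrite eqEcard Fitting_sub dvdn_leq //.
apply/dvdn_partP=> // p _; have [P sylP] := Sylow_exists p G.
have nPG : P <| G.
  rewrite /normal (pHall_sub sylP) /=; case: (boolP (G \subset 'N(P))) => // nnP.
  have prN : 'N_G(P) \proper G by rewrite properE subsetIl subsetI subxx.
  have [M maxM sNM] : {M : {group gT} | maximal M G & 'N_G(P) \subset M}.
    by apply: (@maxgroup_exists gT (fun M => M \proper G) 'N_G(P)%G).
  have := noM M; rewrite maxM /= negbK => nMG.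
  have sPM : P \subset M.
    by apply: subset_trans sNM; rewrite subsetI (pHall_sub sylP) normG.
  have := Frattini_arg nMG (pHall_subl sPM (normal_sub nMG) sylP).
  rewrite mulGSid // => defG.
  by have := maxgroupp maxM; rewrite defG properxx.
rewrite -(card_Hall sylP) cardSg // (subset_trans _ (pcore_sub p _)) //.
by rewrite p_core_Fitting pcore_max // (pHall_pgroup sylP).
Qed.

Lemma dedekind_nil (gT : finGroupType) (G : {group gT}) :
  dedekind G -> nilpotent G.
Proof.
move=> dG; case: (boolP (nilpotent G)) => // /nonnormal_maximal[M [maxM]].
by rewrite dG // proper_sub // (maxgroupp maxM).
Qed.

(** [G] embeds in (G / K) x (G / L): a late term of its lower central series lies in both [K] and
    [L]. *)
Lemma nil_quoI (gT : finGroupType) (G K L : {group gT}) :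
    K <| G -> L <| G -> K :&: L = 1 ->
  nilpotent (G / K) -> nilpotent (G / L) -> nilpotent G.
Proof.
move=> nK nL tiKL /lcnP[m Gm1] /lcnP[n Gn1].
apply/lcnP; exists (m + n)%N; apply/trivgP; rewrite -tiKL subsetI.
have lcn_quo (N : {group gT}) k l : N <| G -> 'L_k.+1(G / N) = 1 -> k <= l ->
    'L_l.+1(G) \subset N.
  move=> nN Gk1 lekl; rewrite -quotient_sub1.
    rewrite /quotient morphim_lcn ?normal_norm //.
    by rewrite -Gk1; apply: lcn_sub_leq.
  by rewrite (subset_trans (lcn_sub _ _)) ?normal_norm.
by rewrite (lcn_quo K m) ?leq_addr // (lcn_quo L n) ?leq_addl.
Qed.

(* A normal subgroup outside a core-free maximal subgroup M supplements it, so *)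
(* SN applied to the subgroups of M makes every larger subgroup normal.        *)
Lemma SN_primitive (gT : finGroupType) (G M : {group gT}) :
    has_SN G -> maximal M G -> gcore M G = 1 ->
  forall L : {group gT}, L <| G -> L :!=: 1 ->
  L * M = G /\ (forall X : {group gT}, L \subset X -> X \subset G -> X <| G).
Proof.
move=> SNG maxM coreM L nL ntL.
have sMG := proper_sub (maxgroupp maxM).
have nsLM : ~~ (L \subset M).
  by apply: contra ntL => sLM; rewrite -subG1 -coreM gcore_max // normal_norm.
have nLM := subset_trans sMG (normal_norm nL).
have defG : L * M = G.
  rewrite -norm_joinEr //; apply/eqP; rewrite eqEproper join_subG normal_sub //=.
  rewrite sMG; apply: contra nsLM => pr.
  have [_ /(_ (L <*> M)%G pr (joing_subr L M)) <-] := maxgroupP maxM.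
  exact: joing_subl.
split=> // X sLX sXG; have <- : L * (M :&: X) = X.
  by rewrite group_modl // defG; apply/setIidPr.
have sMX : M :&: X \subset G by rewrite subIset ?sMG.
case: (SNG L (M :&: X)%G nL sMX) => // sLMX.
by case/negP: nsLM; rewrite (subset_trans sLMX) ?subsetIl.
Qed.

(** Modulo a minimal normal subgroup [G] is Dedekind, hence nilpotent. Two distinct ones meet
    trivially, which would make [G] nilpotent and [M] normal. *)
Lemma SN_primitive_unique (gT : finGroupType) (G M : {group gT}) :
    has_SN G -> maximal M G -> ~~ (M <| G) -> gcore M G = 1 ->
  exists S : {group gT},
    [/\ S <| G, minnormal S G,
        forall T : {group gT}, T \subset G -> minnormal T G -> T = S
      & forall X : {group gT}, S \subset X -> X \subset G -> X <| G].
Proof.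
move=> SNG maxM nnM coreM.
have prim := SN_primitive SNG maxM coreM.
have ntG : G :!=: 1.
  apply: contraTneq (maxgroupp maxM) => ->.
  by rewrite properE sub1G andbF.
have [S minS sSG] := minnormal_exists ntG (normG G).
have [/andP[ntS nSG] minS'] := mingroupP minS.
have nS : S <| G by rewrite /normal sSG.
have [defG dS] := prim S nS ntS.
exists S; split=> // T sTG minT; have [/andP[ntT nTG] minT'] := mingroupP minT.
have nT : T <| G by rewrite /normal sTG.
have [_ dT] := prim T nT ntT.
have [tiST | ntST] := eqVneq (S :&: T) 1; last first.
  have nST : (G \subset 'N(S :&: T)) by rewrite normsI.
  have defS := minS' (S :&: T)%G; have defT := minT' (S :&: T)%G.
  apply/val_inj; rewrite /= -defS ?subsetIl ?ntST // -[LHS]defT ?subsetIr //.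
  by rewrite ntST.
have nilG : nilpotent G.
  apply: (nil_quoI nS nT tiST); apply: dedekind_nil.
    by apply/(dedekind_quoP nS).
  by apply/(dedekind_quoP nT).
have prM := maxgroupp maxM; case/negP: nnM; rewrite /normal proper_sub //=.
case: (boolP (G \subset 'N(M))) => // nnM.
have prN : 'N_G(M) \proper G by rewrite properE subsetIl subsetI subxx.
have := nilpotent_proper_norm nilG prM.
have [_ /(_ 'N_G(M)%G prN)] := maxgroupP maxM.
by rewrite subsetI normG proper_sub // => ->; rewrite ?properxx.
Qed.

(** [M] complements [S], so it is isomorphic to G / S and Dedekind. A faithful irreducible module in
    characteristic p forces O_p(M) = 1 and, by Schur, a cyclic center. In a Dedekind group elements
    of prime order are central, so a nontrivial Sylow subgroup of [M] has just one subgroup of prime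
    order. *)
Lemma SN_primitive_solvable (gT : finGroupType) (G M S : {group gT}) :
    maximal M G -> gcore M G = 1 ->
    S <| G -> minnormal S G -> S * M = G -> solvable S ->
    (forall X : {group gT}, S \subset X -> X \subset G -> X <| G) ->
  exists (p : nat),
        [/\ prime p,
            [/\ S ><| M = G, p.-Sylow(G) S, p.-abelem S & p^'.-Hall(G) M],
            dedekind M,
            (forall (q : nat) (Q : {group gT}), prime q -> q.-Sylow(M) Q ->
               cyclic Q \/ generalized_quaternion Q)
          & acts_irreducibly M S 'J /\ [faithful M, on S | 'J]].
Proof.
move=> maxM coreM nSG minS defG solS dS.
have prM := maxgroupp maxM; have sMG := proper_sub prM.
have [_ ntS /is_abelemP[p p_pr abelS]] := minnormal_solvable minS (subxx S) solS.
have cSS := abelem_abelian abelS; have pS := abelem_pgroup abelS.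
have nSM := subset_trans sMG (normal_norm nSG).
have [_ minS'] := mingroupP minS.
have nsSM : ~~ (S \subset M).
  apply: contraL prM => sSM; rewrite -(mulSGid sSM) defG.
  by rewrite properxx.
have nDG (D : {group gT}) : S \subset 'N(D) -> M \subset 'N(D) -> G \subset 'N(D).
  by move=> nDS nDM; rewrite -defG mul_subG.
have tiSM : S :&: M = 1.
  apply: contraNeq nsSM => ntI; rewrite -(minS' (S :&: M)%G) ?subsetIl ?subsetIr //.
  rewrite ntI nDG //=; last by rewrite normsI ?normG.
  by rewrite cents_norm // (subset_trans cSS) ?centS ?subsetIl.
have dM : dedekind M.
  move=> Y sYM; have nSY := subset_trans sYM nSM.
  have defY : M :&: (S <*> Y) = Y.
    by rewrite norm_joinEr // -group_modr // setIC tiSM mul1g.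
  have nSYG : S <*> Y <| G.
    apply: dS; first exact: joing_subl.
    by rewrite join_subG (normal_sub nSG) (subset_trans sYM).
  have: M :&: (S <*> Y) <| M.
    by rewrite /normal subsetIl normsI ?normG ?(subset_trans sMG) ?normal_norm.
  by rewrite defY.
(* Normalized by [M] and centralized by [S], this centralizer is normal in [G], so it lies in the
   core of [M]. *)
have CMS1 : 'C_M(S) = 1.
  apply/trivgP; rewrite -coreM gcore_max ?subsetIl // nDG //.
    by rewrite cents_norm // centsC subsetIr.
  by rewrite normsI ?normG ?norms_cent.
have irrS : acts_irreducibly M S 'J.
  apply/mingroupP; rewrite ntS astabsJ nSM; split=> // D /andP[ntD].
  rewrite astabsJ => nDM sDS; apply: minS' => //; rewrite ntD nDG //.
  by rewrite cents_norm // (subset_trans cSS) ?centS.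
have ffM : [faithful M, on S | 'J] by rewrite /faithful astabJ CMS1.
have nilM := dedekind_nil dM.
have p'M : p^'.-group M.
  have O1 := pcore_faithful_irr_act pS (subsetT _) irrS ffM.
  have := nilpotent_pcore_Hall p nilM; rewrite O1.
  by move/pHall_pgroup => _; have := nilpotent_pcoreC p nilM; rewrite O1 dprod1g
    => <-; apply: pcore_pgroup.
have coSM : coprime #|S| #|M| := pnat_coprime pS p'M.
have sdG : S ><| M = G by rewrite sdprodE.
have cardG := sdprod_card sdG.
exists p; split=> //.
  split=> //; rewrite pHallE ?(normal_sub nSG) ?sMG /= -cardG partnM ?cardG_gt0 //.
    by rewrite part_pnat_id // part_p'nat ?muln1.
  by rewrite part_p'nat ?pnatNK // part_pnat_id ?mul1n.
have minSM : minnormal S M.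
  apply/mingroupP; rewrite ntS nSM; split=> // D /andP[ntD nDM] sDS.
  apply: minS' => //; rewrite ntD nDG //.
  by rewrite cents_norm // (subset_trans cSS) ?centS.
have cycZ : cyclic 'Z(M).
  apply: (mx_faithful_irr_center_cyclic (rG := abelem_repr abelS ntS nSM)).
    exact: abelem_mx_faithful.
  exact/abelem_mx_irrP.
move=> q Q q_pr sylQ; have qQ := pHall_pgroup sylQ; have sQM := pHall_sub sylQ.
have [-> | ntQ] := eqVneq (Q : {set gT}) 1; first by left; apply: cyclic1.
have sOZ : 'Ohm_1(Q) \subset 'Z(M).
  rewrite (OhmE 1 qQ) gen_subG; apply/subsetP=> x /LdivP[Qx]; rewrite expn1 => xq.
  have [-> | ntx] := eqVneq x 1; first exact: group1.
  have ox : #[x] = q by apply: nt_prime_order.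
  have sxM : <[x]> \subset M by rewrite cycle_subG (subsetP sQM).
  have := meet_center_nil nilM (dM _ sxM); rewrite cycle_eq1 => /(_ ntx) ntI.
  rewrite -cycle_subG; apply/setIidPl.
  by apply: contraNeq ntI => nsx; rewrite prime_TIg // -?orderE ?ox //; apply: contra nsx => /setIidPl->.
have oO : #|'Ohm_1(Q)| = q.
  rewrite -Ohm_id; apply: Ohm1_cyclic_pgroup_prime.
  - exact: cyclicS sOZ cycZ.
  - exact: pgroupS (Ohm_sub _ _) qQ.
  by rewrite Ohm1_eq1.
have := introT (prime_Ohm1P qQ ntQ) oO.
case/orP=> [|/andP[_ /eqP/quaternion_classP]]; first by left.
by right.
Qed.

(** SN for the core [K] and Sylow subgroups ties the prime of [K] to those of M / K, so [M] is an
    r-group. A subgroup [P] of another prime order p gives G = PM; then [M] is cyclic, [P] is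
    normal, and nonnormal subgroups embed in the cyclic r-group G / P. *)
Lemma SN_nonprimitive_SSN (gT : finGroupType) (G M : {group gT}) :
    has_SN G -> ~~ nilpotent G -> maximal M G -> ~~ (M <| G) ->
    gcore M G != 1 ->
  has_SSN G.
Proof.
move=> SNG nnG maxM nnM; pose K := [group of gcore M G].
rewrite -[gcore M G]/(gval K) => ntK.
have prM := maxgroupp maxM; have sMG := proper_sub prM.
have nKG : K <| G by apply: gcore_normal.
have sKM : K \subset M := gcore_sub M G.
have nnK (X : {group gT}) : X \subset M -> X <| G -> X \subset K.
  by move=> sXM nXG; rewrite gcore_max ?normal_norm.
clearbody K.
have maxM' (X : {group gT}) : M \subset X -> X \subset G -> X :!=: M -> X :=: G.
  move=> sMX sXG neX; apply/eqP; rewrite eqEproper sXG; apply: contra neX => prX.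
  by have [_ /(_ X prX sMX) ->] := maxgroupP maxM.
have nKX (X : {group gT}) : X \subset G -> X \subset 'N(K).
  by move=> sXG; apply: subset_trans sXG (normal_norm nKG).
(* X = KR for a Sylow r-subgroup [R] of [X]; as [KR] is not normal, SN gives K <= R. *)
have rK (r : nat) (X : {group gT}) : prime r ->
    K \subset X -> X \subset G -> r.-group (X / K) -> ~~ (X <| G) -> r.-group K.
  move=> r_pr sKX sXG rX nnX; have [R sylR] := Sylow_exists r X.
  have sRX := pHall_sub sylR; have sRG := subset_trans sRX sXG.
  have defX : K * R = X.
    apply/eqP; rewrite eqEsubset mul_subG //= -quotientSK ?nKX //.
    have /pHall_id-> // := quotient_pHall (nKX _ sRG) sylR.
  case: (SNG K R nKG sRG) => [sKR | ].
    exact: pgroupS sKR (pHall_pgroup sylR).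
  by rewrite defX (negPf nnX).
(* A nontrivial Sylow subgroup of M / K has a nonnormal preimage, since [K] contains every normal
   subgroup of [G] inside [M]. *)
have rKM (r : nat) : prime r -> r %| #|M / K| -> r.-group K.
  move=> r_pr r_dv; have [R sylR] := Sylow_exists r (M / K).
  have [X defR sKX sXM] := inv_quotientS (normalS sKM sMG nKG) (pHall_sub sylR).
  apply: (rK r X) => //; first exact: subset_trans sXM sMG.
    by rewrite -defR (pHall_pgroup sylR).
  apply: contraL r_dv => /(nnK _ sXM) sXK; rewrite -p'natE // -partn_eq1 ?cardG_gt0 //.
  have XK1 : X / K = 1 by apply/trivgP; rewrite quotient_sub1 // nKX // (subset_trans sXM).
  by rewrite -(card_Hall sylR) defR XK1 cards1.
have ntMK : M / K != 1.
  apply: contra nnM; rewrite -subG1 quotient_sub1 ?nKX // => sMK.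
  by rewrite (_ : M :=: K) //; apply/eqP; rewrite eqEsubset sMK.
have gt1MK : 1 < #|M / K| by rewrite cardG_gt1.
have [r r_pr r_dv] := pdivP gt1MK.
have prK : r.-group K := rKM r r_pr r_dv.
have rM : r.-group M.
  rewrite -(pquotient_pgroup prK) ?nKX //; apply/pgroupP=> q q_pr q_dv.
  have qK := rKM q q_pr q_dv; case: (pgroup_pdiv prK ntK) => _ r_dvK _.
  by have := pgroupP qK r r_pr r_dvK; rewrite !inE eq_sym.
have [p /andP[p_pr p_dv] ne_pr] : exists2 p, prime p && (p %| #|G|) & p != r.
  case: (boolP (r.-group G)) => [/pgroup_nil | ]; first by rewrite (negPf nnG).
  rewrite /pgroup /pnat cardG_gt0 /= => /allPn[p]; rewrite mem_primes cardG_gt0.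
  by case/andP=> p_pr p_dv; exists p; rewrite ?p_pr.
have [P sPG oP] : exists2 P : {group gT}, P \subset G & #|P| = p.
  by have [x Gx ox] := Cauchy p_pr p_dv; exists <[x]>%G; rewrite ?cycle_subG.
have pP : p.-group P by rewrite /pgroup oP pnat_id.
have p'M : p^'.-group M by apply: sub_pgroup rM => q /eqnP->; rewrite !inE eq_sym.
have p'K : p^'.-group K := pgroupS sKM p'M.
(* Otherwise [rK] makes the p'-group [K] a p-group, hence trivial. *)
have nKPG : K * P <| G.
  case: (boolP (K * P <| G)) => //; rewrite -norm_joinEr ?nKX // => nnKP.
  have := rK p _ p_pr (joing_subl K P); rewrite join_subG normal_sub // sPG.
  rewrite quotientYidl ?nKX // quotient_pgroup // => /(_ isT isT nnKP) pK.
  case/negP: ntK; rewrite -(setIid K); apply/eqP/coprime_TIg.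
  exact: pnat_coprime pK p'K.
have tiPM : P :&: M = 1 by apply: coprime_TIg; apply: pnat_coprime pP p'M.
have nsKPM : ~~ (K <*> P \subset M).
  apply: contraL p_pr => sKPM; rewrite -oP -(setIidPl (_ : P \subset M)) ?tiPM ?cards1 //.
  by apply: subset_trans sKPM; apply: joing_subr.
have nKP := nKX P sPG.
have defKPM : K * P * M = P * M by rewrite -(normC nKP) -mulgA (mulSGid sKM).
have defG : P * M = G.
  rewrite -defKPM -norm_joinEr // in nKPG *.
  have nJM : M \subset 'N(K <*> P) := subset_trans sMG (normal_norm nKPG).
  rewrite -norm_joinEr //; apply: (maxM' ((K <*> P) <*> M)%G).
  - exact: joing_subr.
  - by rewrite join_subG sMG (normal_sub nKPG).
  by apply: contra nsKPM => /eqP <-; apply: joing_subl.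
have oG : #|G| = (p * #|M|)%N by rewrite -defG TI_cardMg // oP.
have sylP : p.-Sylow(G) P.
  rewrite pHallE sPG oG oP partnM ?cardG_gt0 ?prime_gt0 //=.
  by rewrite (part_p'nat p'M) (@part_pnat_id p p) ?pnat_id // muln1.
have nMP : M / K \subset 'N(P / K).
  rewrite -(quotientMidl K P) (subset_trans (quotientS K sMG)) //.
  by rewrite normal_norm ?quotient_normal.
(* The preimage of this centralizer is normal in [G] and contained in [M], hence in [K]. So M / K
   acts faithfully on a group of order p and is cyclic. *)
have C1 : 'C_(M / K)(P / K) = 1.
  have [X defX sKX sXM] := inv_quotientS (normalS sKM sMG nKG) (subsetIl (M / K) 'C(P / K)).
  rewrite /= defX; have sXG := subset_trans sXM sMG.
  apply/trivgP; rewrite quotient_sub1 ?nKX // nnK //.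
  apply: (normal_quo_inv nKG sKX sXG); rewrite -defX /normal defX quotientS //= -defX.
  rewrite -defG quotientMr ?nKX // mul_subG //.
    by rewrite cents_norm // centsC subsetIr.
  by rewrite normsI ?normG ?norms_cent.
have cMK : cyclic (M / K).
  have := first_isog_loc (conj_aut_morphism (P / K)) nMP.
  rewrite ker_conj_aut /= => isoM.
  have: M / K \isog M / K / 'C_(M / K)(P / K) by rewrite /= C1 quotient1_isog.
  move/isog_trans/(_ isoM)/isog_cyclic->; apply: cyclicS (Aut_conj_aut _ _) _.
  apply: Aut_prime_cyclic; rewrite -(card_isog (quotient_isog nKP _)) ?oP //.
  by apply: coprime_TIg; rewrite coprime_sym; apply: pnat_coprime pP p'K.
have [m Mm defMK] : exists2 m, m \in M & M / K = <[m]> / K.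
  have [xb defxb] := cyclicP cMK; have: xb \in M / K by rewrite defxb cycle_id.
  case/morphimP=> m Nm Mm defm; exists m => //.
  by rewrite defxb defm quotient_cycle.
have sMm : <[m]> \subset M by rewrite cycle_subG.
have defM : K * <[m]> = M.
  apply/eqP; rewrite eqEsubset mul_subG //= -quotientSK ?nKX ?(subset_trans sMm) //.
  by rewrite defMK.
(* M = K<m> is not normal, so SN leaves only K <= <m>. *)
have cycM : cyclic M.
  case: (SNG K <[m]>%G nKG (subset_trans sMm sMG)); last by rewrite defM (negPf nnM).
  by move=> sKm; rewrite -defM mulSGid // cycle_cyclic.
(* The centralizer of [K] is normal and contains the nonnormal maximal subgroup [M], so it is [G].
   Hence [P] is normal in [KP], and by Frattini in [G]. *)
have cKG : G \subset 'C(K).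
  have nCG : 'C_G(K) <| G.
    by rewrite /normal subsetIl normsI ?normG ?norms_cent ?normal_norm.
  have sMC : M \subset 'C_G(K).
    by rewrite subsetI sMG (subset_trans (cyclic_abelian cycM)) ?centS.
  have := maxM' 'C_G(K)%G sMC (normal_sub nCG).
  case: ('C_G(K) =P M :> {set gT}) nCG => [-> | _ _ <- //]; first by rewrite (negPf nnM).
  by rewrite subsetIr.
have nPG : P <| G.
  have nKP' : K \subset 'N(P) by rewrite cents_norm // centsC (subset_trans sPG).
  have sylP' : p.-Sylow(K <*> P) P.
    by rewrite (pHall_subl _ _ sylP) ?joing_subr // join_subG normal_sub.
  have := nKPG; rewrite -norm_joinEr // => nJG.
  have := Frattini_arg nJG sylP'.
  rewrite mulSGid; first by move=> defN; rewrite /normal sPG -defN subsetIr.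
  by rewrite join_subG !subsetI normG nKP' sPG normal_sub.
have quoM : M / P = G / P by rewrite -defG quotientMidl.
have cycGP : cyclic (G / P) by rewrite -quoM quotient_cyclic.
have rGP : r.-group (G / P) by rewrite -quoM quotient_pgroup.
apply: (@SSN_of_cyclic _ r) => X sXG nnX.
(* [P] has order p: a subgroup meeting it trivially embeds in G / P, any other contains [P] and with
   it the derived subgroup. *)
have [tiPX | ntPX] := eqVneq (P :&: X) 1.
  have nPX := subset_trans sXG (normal_norm nPG).
  have isoX := quotient_isog nPX tiPX.
  rewrite (isog_cyclic isoX) /pgroup (card_isog isoX) -/(pgroup _ _).
  by rewrite (pgroupS (quotientS P sXG) rGP) (cyclicS (quotientS P sXG) cycGP).
have sPX : P \subset X.
  by apply/setIidPl; apply: contraNeq ntPX => nsPX; rewrite prime_TIg ?oP //;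
     apply: contra nsPX => /setIidPl->.
case/negP: nnX; apply: sub_der1_normal sXG; apply: subset_trans sPX.
by rewrite der1_min ?normal_norm // cyclic_abelian.
Qed.

Theorem SN_nonnilpotent (gT : finGroupType) (G : {group gT}) :
    has_SN G -> ~~ nilpotent G ->
  [\/ has_SSN G,
      exists (p : nat) (P H : {group gT}),
        [/\ prime p,
            [/\ P ><| H = G, p.-Sylow(G) P, p.-abelem P & p^'.-Hall(G) H],
            dedekind H,
            (forall (q : nat) (Q : {group gT}), prime q -> q.-Sylow(H) Q ->
               cyclic Q \/ generalized_quaternion Q)
          & acts_irreducibly H P 'J /\ [faithful H, on P | 'J]]
    | exists S : {group gT},
        [/\ unique_minnormal G S, ~~ solvable S & dedekind (G / S)%G]].
Proof.
move=> SNG nnG; have [M [maxM nnM]] := nonnormal_maximal nnG.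
have [K1 | ntK] := eqVneq (gcore M G) 1; last first.
  by constructor 1; apply: SN_nonprimitive_SSN SNG nnG maxM nnM ntK.
have [S [nSG minS uniS dS]] := SN_primitive_unique SNG maxM nnM K1.
have [solS | nsolS] := boolP (solvable S).
  have [_ ntS _] := minnormal_solvable minS (subxx S) solS.
  have [defG _] := SN_primitive SNG maxM K1 nSG ntS.
  have [p Hp] := SN_primitive_solvable maxM K1 nSG minS defG solS dS.
  by constructor 2; exists p, S, M.
constructor 3; exists S; split=> //; first by split=> //; apply: normal_sub.
by apply/(dedekind_quoP nSG).
Qed.

(** * p-groups *)

Lemma normal_of_cycles (gT : finGroupType) (G X : {group gT}) :
  X \subset G -> (forall x, x \in X -> <[x]> <| G) -> X <| G.
Proof.
move=> sXG cG; apply/andP; split=> //; apply/subsetP=> g Gg; rewrite inE.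
apply/subsetP=> _ /imsetP[x Xx ->]; rewrite -cycle_subG in Xx.
by apply: (subsetP Xx); rewrite memJ_norm ?cycle_id // (subsetP (normal_norm (cG x _))) // -cycle_subG.
Qed.

Lemma nonnormal_cycle (gT : finGroupType) (G X : {group gT}) :
  X \subset G -> ~~ (X <| G) -> exists2 x, x \in X & ~~ (<[x]> <| G).
Proof.
move=> sXG nnX; have [/existsP[x /andP[Xx nx]] | ] :=
  boolP [exists x, (x \in X) && ~~ (<[x]> <| G)]; first by exists x.
rewrite negb_exists => /forallP all_n; case/negP: nnX; apply: normal_of_cycles => // x Xx.
by have := all_n x; rewrite Xx negbK.
Qed.

Lemma nonnormal_cycle_constt (gT : finGroupType) (G : {group gT}) x :
  x \in G -> ~~ (<[x]> <| G) -> exists2 p, prime p & ~~ (<[x.`_p]> <| G).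
Proof.
move=> Gx nnx; have [/existsP[p /andP[p_pr np]] | ] :=
  boolP [exists p : 'I_(#[x].+1), prime p && ~~ (<[x.`_p]> <| G)]; first by exists p.
rewrite negb_exists => /forallP all_n; case/negP: nnx.
rewrite /normal cycle_subG Gx; apply/subsetP=> g Gg; rewrite inE -cycleJ cycle_subG.
rewrite -{1}(prod_constt x) (big_morph (conjg^~ g) (fun u v => conjMg u v g) (conj1g g)).
rewrite big_mkord group_prod // => p _.
have [p_pr | np_pr] := boolP (prime p); last first.
  rewrite (_ : x.`_p = 1) ?conj1g ?group1 //.
  by apply/eqP; rewrite -order_eq1 order_constt p_part lognE (negPf np_pr).
have := all_n p; rewrite p_pr negbK => /normal_norm/subsetP/(_ g Gg).
rewrite inE -cycleJ cycle_subG => /(subsetP _)-> //.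
by rewrite cycle_subG mem_cycle.
Qed.

(** Some p-part [y] generates a nonnormal subgroup. For the p'-core [N], SN either puts [N] in the
    p-group <y>, so that N = 1, or makes N<y> normal, and with it its normal Sylow subgroup <y>. *)
Lemma SN_nilpotent_pgroup (gT : finGroupType) (G X : {group gT}) :
    has_SN G -> nilpotent G -> X \subset G -> ~~ (X <| G) ->
  exists2 p, prime p & p.-group G.
Proof.
move=> SNG nilG sXG /(nonnormal_cycle sXG)[x /(subsetP sXG) Gx].
case/(nonnormal_cycle_constt Gx)=> p p_pr; set y := x.`_p => nny.
have sYG : <[y]> \subset G by rewrite cycle_subG groupX.
have pY : p.-group <[y]> by rewrite /pgroup -orderE /order; apply: p_elt_constt.
exists p => //; pose N := 'O_p^'(G)%G; have nNG : N <| G := pcore_normal _ _.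
have p'N : p^'.-group N := pcore_pgroup _ _.
have nNY : <[y]> \subset 'N(N) := subset_trans sYG (normal_norm nNG).
case: (SNG N <[y]>%G nNG sYG) => [sNY | nNYG].
  have N1 : 'O_p^'(G) = 1.
    by rewrite -(setIidPr sNY); apply/coprime_TIg; apply: pnat_coprime pY p'N.
  by have := nilpotent_pcoreC p nilG; rewrite N1 dprodg1 => <-; apply: pcore_pgroup.
case/negP: nny; rewrite -norm_joinEr // in nNYG.
have nilNY : nilpotent (N <*> <[y]>) := nilpotentS (normal_sub nNYG) nilG.
have hallY : p.-Hall(N <*> <[y]>) <[y]>.
  rewrite /pHall joing_subr pY /= -divgS ?joing_subr //= norm_joinEr //.
  rewrite TI_cardMg ?mulnK ?cardG_gt0 //.
  by rewrite setIC; apply/coprime_TIg; apply: pnat_coprime pY p'N.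
rewrite (nilpotent_Hall_pcore nilNY hallY).
exact: char_normal_trans (pcore_char _ _) nNYG.
Qed.

(** The classical argument for Hamiltonian groups: take a noncommuting pair minimizing the product
    of the orders. Minimality gives [x, y] order p. A product y x^m, with m chosen to lower the
    order, would be a better partner of x than y unless p = 2 and both orders are 4. *)
Lemma dedekind_pgroup_Q8 (gT : finGroupType) (p : nat) (G : {group gT}) :
    prime p -> p.-group G -> dedekind G -> ~~ abelian G ->
  exists x y, [/\ x \in G, y \in G, [~ x, y] != 1, [~ x, y] ^+ 2 = 1
                & x ^+ 2 = [~ x, y] /\ y ^+ 2 = [~ x, y]].
Proof.
move=> p_pr pG dG nabG.
have inX x y : x \in G -> y \in G -> [~ x, y] \in <[x]>.
  move=> Gx Gy; have sxG : <[x]> \subset G by rewrite cycle_subG.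
  rewrite commgEl groupM ?groupV ?cycle_id //.
  by rewrite memJ_norm ?cycle_id // (subsetP (normal_norm (dG <[x]>%G sxG))).
have inY x y : x \in G -> y \in G -> [~ x, y] \in <[y]>.
  by move=> Gx Gy; rewrite -invg_comm groupV inX.
have cX x y : x \in G -> y \in G -> commute x [~ x, y].
  by move=> Gx Gy; have /cycleP[i ->] := inX x y Gx Gy; apply: commuteX.
have cY x y : x \in G -> y \in G -> commute y [~ x, y].
  by move=> Gx Gy; have /cycleP[i ->] := inY x y Gx Gy; apply: commuteX.
pose P (u : gT * gT) := [&& u.1 \in G, u.2 \in G & [~ u.1, u.2] != 1].
have [u0 Pu0] : exists u0, P u0.
  have [/existsP // | ] := boolP [exists u, P u].
  rewrite negb_exists => /forallP allP; case/negP: nabG; apply/centsP=> x Gx y Gy.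
  by have := allP (x, y); rewrite /P Gx Gy negbK => /commgP.
case: (arg_minnP (fun u => #[u.1] * #[u.2])%N Pu0) => -[x y] /and3P[/= Gx Gy ntz] minxy.
have {minxy}: forall u v, u \in G -> v \in G -> [~ u, v] != 1 ->
    #[x] * #[y] <= #[u] * #[v].
  by move=> u v Gu Gv ntuv; apply: (minxy (u, v)); apply/and3P.
have [a ox] := p_natP (mem_p_elt pG Gx); have [b oy] := p_natP (mem_p_elt pG Gy).
move=> minxy {u0 Pu0}.
wlog leba : x y a b Gx Gy ntz ox oy minxy / b <= a.
  move=> IH; case/orP: (leq_total b a) => [|leab]; first exact: (IH x y).
  apply: (IH y x b a) => //; first by rewrite commg1_sym.
  by move=> u v Gu Gv ntuv; rewrite mulnC; apply: minxy.
set z := [~ x, y] in ntz *; have p_gt1 := prime_gt1 p_pr.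
have a_gt0 : 0 < a.
  rewrite lt0n; apply: contraNneq ntz => a0; move/eqP: ox.
  by rewrite a0 expn0 order_eq1 /z => /eqP->; rewrite comm1g.
have b_gt0 : 0 < b.
  rewrite lt0n; apply: contraNneq ntz => b0; move/eqP: oy.
  by rewrite b0 expn0 order_eq1 /z => /eqP->; rewrite commg1.
have zp1 : z ^+ p = 1.
  rewrite -commXg; last exact: cX.
  apply/eqP; apply: contraT => ntzp.
  have := minxy (x ^+ p) y (groupX p Gx) Gy ntzp; rewrite leq_pmul2r ?order_gt0 //.
  by rewrite -[p in x ^+ p]expn1 (orderXexp _ ox) ox leq_exp2l // leqNgt ltn_subrL a_gt0.
have oz : #[z] = p by apply: nt_prime_order.
have cycE t c : t \in G -> #[t] = (p ^ c)%N -> 0 < c -> z \in <[t]> ->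
    <[t ^+ (p ^ c.-1)]> = <[z]>.
  move=> Gt ot c_gt0 tz; apply/eqP; rewrite (eq_subG_cyclic (cycle_cyclic t)).
  - by rewrite -!orderE oz (orderXexp _ ot) -subn1 subKn ?expn1.
  - by rewrite cycle_subG mem_cycle.
  by rewrite cycle_subG.
have cycx := cycE x a Gx ox a_gt0 (inX x y Gx Gy).
have cycy := cycE y b Gy oy b_gt0 (inY x y Gx Gy).
set i := (p ^ b.-1)%N in cycy.
have b_gt1 : 1 < b.
  rewrite ltn_neqAle b_gt0 andbT; apply: contraNneq ntz => b1.
  have: y \in <[z]> by rewrite -cycy /i -b1 expg1 cycle_id.
  case/cycleP=> j yz; apply/commgP; rewrite /commute yz.
  exact: (commuteX j (cX x y Gx Gy)).
have [k yxk] : exists k, y ^+ i * (x ^+ (p ^ a.-1)) ^+ k = 1.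
  have: (y ^+ i)^-1 \in <[x ^+ (p ^ a.-1)]> by rewrite groupV /= cycx -cycy cycle_id.
  by case/cycleP=> k yk; exists k; rewrite -yk mulgV.
(* x^(m i) = x^(k p^(a-1)) is the inverse of y^i, so that w^i reduces to its commutator part z^(m
   C(i,2)); the exponent a - b is why b <= a was arranged. *)
pose m := (k * p ^ (a - b))%N; pose w := y * x ^+ m.
have comxz := cX x y Gx Gy; have comyz := cY x y Gx Gy.
have czm : [~ x ^+ m, y] = z ^+ m by apply: commXg.
have wi : w ^+ i = z ^+ (m * 'C(i, 2)).
  rewrite expMg_Rmul ?czm; first last.
  - exact: commuteX.
  - by apply: commute_sym; apply: commuteX; apply: commute_sym; apply: commuteX.
  rewrite -expgM (_ : m * i = p ^ a.-1 * k)%N ?expgM ?yxk ?mul1g -?expgM //.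
  by rewrite /m /i -mulnA -expnD mulnC -!subn1 addnBA // subnK.
(* If p divided the exponent, [w] would have smaller order than [y] while [x, w] = z. *)
have ndv : ~~ (p %| m * 'C(i, 2)).
  apply/negP=> /dvdnP[j dvj]; have w1 : w ^+ i = 1 by rewrite wi dvj mulnC expgM zp1 expg1n.
  have xw : [~ x, w] = z.
    rewrite commgMJ -/z (_ : [~ x, x ^+ m] = 1) ?mul1g.
      by rewrite conjgE (commuteX m (commute_sym comxz)) mulKg.
    by apply/eqP/commgP; apply: commuteX.
  have := minxy x w Gx; rewrite xw groupM ?groupX // => /(_ isT ntz).
  rewrite leq_pmul2l ?order_gt0 // leqNgt => /negP[].
  apply: leq_ltn_trans (dvdn_leq _ (_ : _ %| i)) _; rewrite ?expn_gt0 ?prime_gt0 //.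
    by rewrite order_dvdn w1.
  by rewrite oy ltn_exp2l // prednK.
have iS : i = (p * p ^ b.-2)%N by rewrite /i -expnS prednK // -ltnS prednK.
(* For odd p, C(i,2) is a multiple of i; for p = 2 it is even unless i = 2, and [m] is even unless a
   = b. *)
have p2 : p = 2.
  apply/eqP; apply: contraNT ndv => np2; have odd_p: odd p by case: (even_prime p_pr) np2 => [->|].
  rewrite bin2odd; last by rewrite /i oddX odd_p orbT.
  by rewrite dvdn_mull // dvdn_mulr // iS dvdn_mulr.
have b2 : b = 2.
  apply/eqP; apply: contraNT ndv => nb2; rewrite dvdn_mull // bin2 iS p2.
  have b_gt2 : 2 < b by rewrite ltn_neqAle eq_sym nb2.
  rewrite -mulnA [(2 * _)%N in X in X./2]mul2n doubleK dvdn_mulr //.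
  rewrite -[X in X %| _]expn1 dvdn_exp2l //.
  by rewrite -subn2 subn_gt0.
have a2 : a = 2.
  have le2a : 2 <= a by rewrite -[X in X <= a]b2.
  apply/eqP; rewrite eqn_leq le2a andbT leqNgt; apply: contra ndv => a_gt2.
  rewrite dvdn_mulr // /m dvdn_mull // -[X in X %| _]expn1 dvdn_exp2l //.
  by rewrite b2 subn_gt0.
have sqE t : <[t ^+ 2]> = <[z]> -> t ^+ 2 = z.
  move=> et; have := cycle_id (t ^+ 2); rewrite et cycle2g ?oz // !inE.
  case/orP=> /eqP // t1; move: et; rewrite t1 cycle1 => /esym/eqP.
  by rewrite cycle_eq1 (negPf ntz).
exists x, y; split=> //; first by rewrite -p2.
move: cycx cycy; rewrite /i a2 b2 /= p2 expn1.
by split; apply: sqE.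
Qed.

(** * p-groups with a cyclic center *)

Definition monolith (gT : finGroupType) (p : nat) (G S : {group gT}) :=
  [/\ S <| G, #|S| = p, S \subset 'Z(G)
    & forall N : {group gT}, N <| G -> N :!=: 1 -> S \subset N].

Lemma monolith_of_cyclic_center (gT : finGroupType) (p : nat) (G : {group gT}) :
    p.-group G -> G :!=: 1 -> cyclic 'Z(G) ->
  monolith p G 'Ohm_1('Z(G))%G.
Proof.
move=> pG ntG cZ; have pZ : p.-group 'Z(G) := pgroupS (center_sub G) pG.
have ntZ : 'Z(G) != 1 by rewrite center_nil_eq1 ?(pgroup_nil pG).
split.
- exact: char_normal_trans (Ohm_char _ _) (center_normal _).
- exact: Ohm1_cyclic_pgroup_prime.
- exact: Ohm_sub.
move=> N nNG ntN; have ntI := meet_center_nil (pgroup_nil pG) nNG ntN.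
apply: subset_trans (subsetIl N 'Z(G)).
have sIZ : N :&: 'Z(G) \subset 'Z(G) := subsetIr _ _.
have pI := pgroupS sIZ pZ; have cI := cyclicS sIZ cZ.
suffices /eqP-> : 'Ohm_1('Z(G))%G == 'Ohm_1(N :&: 'Z(G))%G by apply: Ohm_sub.
rewrite -val_eqE /= (eq_subG_cyclic cZ) ?Ohm_sub ?(subset_trans (Ohm_sub _ _)) //.
by rewrite !(@Ohm1_cyclic_pgroup_prime _ p).
Qed.

Lemma cycle_cyclic_exp (gT : finGroupType) (p : nat) (Y : {group gT}) z w :
    prime p -> cyclic Y -> z \in Y -> w \in Y -> z ^+ p = 1 -> w ^+ p = 1 ->
  z != 1 -> w \in <[z]>.
Proof.
move=> p_pr cY Yz Yw zp wp ntz; have [-> | ntw] := eqVneq w 1; first exact: group1.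
have oz : #[z] = p by apply: nt_prime_order.
have ow : #[w] = p by apply: nt_prime_order.
suffices /eqP<- : <[w]>%G == <[z]>%G :> {set gT} by apply: cycle_id.
by rewrite (eq_subG_cyclic cY) ?cycle_subG //= -!orderE oz ow.
Qed.

(** * p-groups with a noncyclic center *)

Lemma normal_cycle_central (gT : finGroupType) (p : nat) (G : {group gT}) x :
    prime p -> p.-group G -> x ^+ p = 1 -> <[x]> <| G -> x \in 'Z(G).
Proof.
move=> p_pr pG xp nxG; have [-> | ntx] := eqVneq x 1; first exact: group1.
have ox : #[x] = p by apply: nt_prime_order.
have := meet_center_nil (pgroup_nil pG) nxG; rewrite cycle_eq1 => /(_ ntx) ntI.
rewrite -cycle_subG; apply/setIidPl.
apply: contraNeq ntI => nsx; rewrite prime_TIg // -?orderE ?ox //.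
by apply: contra nsx => /setIidPl->.
Qed.

Lemma central_cycle_normal (gT : finGroupType) (G : {group gT}) e :
  e \in 'Z(G) -> <[e]> <| G.
Proof. by move=> Ze; apply: sub_center_normal; rewrite cycle_subG. Qed.

(** If <y> met <e1><e2> trivially, SN would make both <e1><y> and <e2><y> normal, and these meet in
    <y>. *)
Lemma SN_central_pair (gT : finGroupType) (p : nat) (G : {group gT}) e1 e2 y :
    prime p -> has_SN G ->
    e1 \in 'Z(G) -> e2 \in 'Z(G) -> e1 ^+ p = 1 -> e2 ^+ p = 1 ->
    e1 != 1 -> e2 \notin <[e1]> -> y \in G -> ~~ (<[y]> <| G) ->
  exists w, [/\ w \in <[y]>, w \in <[e1]> * <[e2]> & w != 1].
Proof.
move=> p_pr SNG Ze1 Ze2 e1p e2p nte1 e12 Gy nny.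
have nte2 : e2 != 1 by apply: contraNneq e12 => ->; apply: group1.
have oe1 : #[e1] = p by apply: nt_prime_order.
have oe2 : #[e2] = p by apply: nt_prime_order.
have cE : <[e2]> \subset 'C(<[e1]>).
  have /setIP[Ge1 _] := Ze1; have /setIP[_ Ce2] := Ze2.
  by rewrite cycle_subG (subsetP _ _ Ce2) // centS // cycle_subG.
have nJ (e : gT) (A : {set gT}) : e \in 'Z(G) -> A \subset G -> A \subset 'N(<[e]>).
  by move=> /central_cycle_normal/normal_norm nE sAG; apply: subset_trans nE.
have syG : <[y]> \subset G by rewrite cycle_subG.
pose E := <[e1]> <*> <[e2]>.
have defE : E = <[e1]> * <[e2]> by rewrite /E cent_joinEr.
have [tiE | /trivgPn[w /setIP[yw Ew] ntw]] := eqVneq (<[y]> :&: E) 1; last first.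
  by exists w; split; rewrite -?defE.
case/negP: nny.
have nE e : e \in 'Z(G) -> e \in E -> e != 1 -> <[e]> <*> <[y]> <| G.
  move=> Ze Ee nte; have [|] := SNG <[e]>%G <[y]>%G (central_cycle_normal Ze) syG.
    rewrite /= cycle_subG => ye; case/negP: nte; rewrite -in_set1 -[[set 1]]tiE inE ye //.
  by rewrite norm_joinEr // nJ.
have Ee1 : e1 \in E by rewrite -cycle_subG joing_subl.
have Ee2 : e2 \in E by rewrite -cycle_subG joing_subr.
suffices <- : <[e2]> <*> <[y]> :&: (<[e1]> <*> <[y]>) = <[y]>.
  by apply: normalI; apply: nE.
rewrite [_ :&: (<[e1]> <*> _)]setIC.
apply/eqP; rewrite eqEsubset subsetI !joing_subr andbT.
have nJ1 := nJ e1 <[y]> Ze1 syG; have nJ2 := nJ e2 <[y]> Ze2 syG.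
rewrite setIC [X in _ :&: X]norm_joinEr // -group_modr ?joing_subr // mul_subG //.
suffices -> : <[e2]> <*> <[y]> :&: <[e1]> = 1 by apply: sub1G.
apply/trivgP; apply: subset_trans (_ : <[e2]> :&: <[e1]> \subset _).
  rewrite /= subsetI subsetIr andbT norm_joinEr //.
  apply: subset_trans (setIS _ (joing_subl <[e1]> <[e2]>)) _.
  by rewrite -group_modl ?cycle_subG // tiE mulg1.
rewrite setIC prime_TIg // -?orderE ?oe1 // cycle_subG.
apply: contra e12 => e12; rewrite -cycle_subG.
suffices /eqP-> : <[e2]>%G == <[e1]>%G :> {set gT} by [].
by rewrite eq_sym eqEcard cycle_subG e12 -!orderE oe1 oe2 leqnn.
Qed.

(** [Om] is Omega_1(G), and the last clause says that G / Om is Dedekind. *)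
Definition bicentral (gT : finGroupType) (p : nat) (G Om : {group gT}) :=
  [/\ Om \subset 'Z(G), #|Om| = (p ^ 2)%N,
      forall x, x \in G -> (x ^+ p == 1) = (x \in Om)
    & forall X : {group gT}, Om \subset X -> X \subset G -> X <| G].

(** Any elementary abelian subgroup [E] of rank two in the center serves as [Om]; by
    [SN_central_pair], nonnormal cyclic subgroups meet it. *)
Lemma SN_noncyclic_center (gT : finGroupType) (p : nat) (G X : {group gT}) :
    prime p -> p.-group G -> has_SN G -> X \subset G -> ~~ (X <| G) ->
    ~~ cyclic 'Z(G) ->
  exists Om : {group gT}, bicentral p G Om.
Proof.
move=> p_pr pG SNG sXG nnX ncZ.
have pZ : p.-group 'Z(G) := pgroupS (center_sub G) pG.
have [E] : exists E, E \in 'E_p^2('Z(G)).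
  apply/p_rank_geP; rewrite -(rank_pgroup pZ) ltnNge -abelian_rank1_cyclic //.
  exact: center_abelian.
case/pnElemP=> sEZ abelE oE; have pE := abelem_pgroup abelE.
have cardE : #|E| = (p ^ 2)%N by rewrite (card_pgroup pE) oE.
have expE x : x \in E -> x ^+ p = 1 by have [_] := abelemP p_pr abelE; apply.
have ntE : E :!=: 1 by rewrite -cardG_gt1 cardE; have := ltn_exp2l 0 2 (prime_gt1 p_pr); rewrite expn0 => ->.
have lt_pE : p < #|E| by rewrite cardE -[X in X < _]expn1 ltn_exp2l ?prime_gt1.
have outE (y : gT) : #[y] = p -> exists2 e, e \in E & e \notin <[y]>.
  move=> oy; apply/subsetPn; apply: contraL lt_pE => /subset_leq_card.
  by rewrite -orderE oy -leqNgt.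
have gens e1 e2 : e1 \in E -> e2 \in E -> e1 != 1 -> e2 \notin <[e1]> ->
    <[e1]> * <[e2]> = E.
  move=> Ee1 Ee2 nte1 e12; apply/eqP; rewrite eqEcard mul_subG ?cycle_subG //=.
  have nte2 : e2 != 1 by apply: contraNneq e12 => ->; apply: group1.
  have oe1 : #[e1] = p by apply: nt_prime_order; rewrite ?expE.
  have oe2 : #[e2] = p by apply: nt_prime_order; rewrite ?expE.
  rewrite TI_cardMg -?orderE ?oe1 ?oe2 ?cardE // setIC prime_TIg -?orderE ?oe2 //.
  by rewrite cycle_subG.
have meetE y : y \in G -> ~~ (<[y]> <| G) -> exists w, [/\ w \in <[y]>, w \in E & w != 1].
  move=> Gy nny; have /trivgPn[e1 Ee1 nte1] := ntE.
  have [|e2 Ee2 e12] := outE e1; first by apply: nt_prime_order; rewrite ?expE.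
  have := SN_central_pair p_pr SNG (subsetP sEZ _ Ee1) (subsetP sEZ _ Ee2) (expE _ Ee1)
     (expE _ Ee2) nte1 e12 Gy nny.
  by rewrite gens.
exists E; split=> //.
  move=> x Gx; apply/eqP/idP=> [xp | /expE//].
  have [nxG | nnx] := boolP (<[x]> <| G); last first.
    have [w [xw Ew ntw]] := meetE x Gx nnx.
    have: x \in <[w]> by apply: (cycle_cyclic_exp p_pr (cycle_cyclic x)); rewrite ?cycle_id // expE.
    by apply: subsetP; rewrite cycle_subG.
  have Zx := normal_cycle_central p_pr pG xp nxG.
  have [y Xy nny] := nonnormal_cycle sXG nnX.
  have Gy := subsetP sXG y Xy; have [w [yw Ew ntw]] := meetE y Gy nny.
  (* [x] is central of order p and <y> meets [E] in <w>. If [x] were outside [E], then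
     [SN_central_pair] for [e] and [x] would give v = e^i x^j in <y> of order p, so v is in <w>;
     this forces x^j = 1, then e in <w>. *)
  have [|e Ee we] := outE w; first by apply: nt_prime_order; rewrite ?expE.
  have nte : e != 1 by apply: contraNneq we => ->; apply: group1.
  apply: contraT => nEx; have ex : x \notin <[e]>.
    by apply: contra nEx; apply: subsetP; rewrite cycle_subG.
  have [v [yv exv ntv]] := SN_central_pair p_pr SNG (subsetP sEZ _ Ee) Zx (expE _ Ee) xp nte ex Gy nny.
  have /mulsgP[_ _ /cycleP[i ->] /cycleP[j ->] defv] := exv.
  have ei_p : (e ^+ i) ^+ p = 1 by rewrite -expgM mulnC expgM expE ?expg1n.
  have xj_p : (x ^+ j) ^+ p = 1 by rewrite -expgM mulnC expgM xp expg1n.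
  have vp : v ^+ p = 1.
    rewrite defv expgMn ?ei_p ?xj_p ?mulg1 //.
    by apply: commuteX; apply: commute_sym; apply: (centerC Gx); rewrite groupX ?(subsetP sEZ).
  have wv : v \in <[w]> by apply: (cycle_cyclic_exp p_pr (cycle_cyclic y)); rewrite // expE.
  have cexp (u : gT) k : u ^+ p = 1 -> u ^+ k != 1 -> u \in <[u ^+ k]>.
    move=> up ntuk; apply: (cycle_cyclic_exp p_pr (cycle_cyclic u)) => //.
    - exact: mem_cycle.
    - exact: cycle_id.
    by rewrite -expgM mulnC expgM up expg1n.
  have xj1 : x ^+ j = 1.
    apply/eqP; apply: contraR nEx => /(cexp _ _ xp); apply: subsetP.
    rewrite cycle_subG -(groupMl (x := e ^+ i)) ?groupX // -defv.
    by apply: subsetP wv; rewrite cycle_subG.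
  case/negP: we; move: wv ntv; rewrite defv xj1 mulg1 => wei /(cexp _ _ (expE _ Ee)).
  by apply: subsetP; rewrite cycle_subG.
(* It suffices that <x>E is normal for every x. If <x> is not normal, choose e in [E] outside <x>:
   SN makes <e><x> normal, hence <x>E. *)
move=> Y sEY sYG; have nEG : E <| G := sub_center_normal sEZ.
have nxE x : x \in G -> <[x]> * E <| G.
  move=> Gx; have sxG : <[x]> \subset G by rewrite cycle_subG.
  have [nxG | nnx] := boolP (<[x]> <| G); first exact: normalM.
  have [w [xw Ew ntw]] := meetE x Gx nnx.
  have [|e Ee we] := outE w; first by apply: nt_prime_order; rewrite ?expE.
  have Ze := subsetP sEZ e Ee.
  have [] := SNG <[e]>%G <[x]>%G (central_cycle_normal Ze) sxG.
    rewrite cycle_subG => xe; case/negP: we.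
    by apply: (cycle_cyclic_exp p_pr (cycle_cyclic x)); rewrite ?expE.
  move=> nex; have := normalM nex nEG; congr (_ <| G).
  have cxe : <[x]> \subset 'N(<[e]>).
    exact: subset_trans sxG (normal_norm (central_cycle_normal Ze)).
  by rewrite /= -(normC cxe) -mulgA [<[e]> * _]mulSGid ?cycle_subG.
rewrite /normal sYG; apply/subsetP=> g Gg; rewrite inE; apply/subsetP=> _ /imsetP[x Yx ->].
have Gx := subsetP sYG x Yx.
have sxY : <[x]> * E \subset Y by rewrite mul_subG ?cycle_subG.
apply: (subsetP sxY); rewrite memJ_norm ?(subsetP (normal_norm (nxE x Gx))) //.
by rewrite (subsetP (mulG_subl _ _)) ?cycle_id.
Qed.

(** * Quotients by the smallest normal subgroup *)

Lemma coset_eq (gT : finGroupType) (S : {group gT}) u v :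
  u \in 'N(S) -> v \in 'N(S) -> coset S u = coset S v ->
  exists2 s, s \in S & u = s * v.
Proof. by move=> nu nv /(rcoset_kercosetP nu nv)/rcosetP. Qed.

(** A nonabelian G / S contains Q8. Let [x] and [y] lift its generators: their commutator [z] is a
    central involution outside [S], yet <z> is normal of order 2, so it contains [S] and equals
    it. *)
Lemma monolith_dedekind_quotient (gT : finGroupType) (p : nat) (G S : {group gT}) :
  prime p -> p.-group G -> monolith p G S -> dedekind (G / S)%G -> G^`(1) \subset S.
Proof.
move=> p_pr pG [nSG oS sSZ minS] dG; have nS := normal_norm nSG.
have [abG | nabG] := boolP (abelian (G / S)); first by rewrite der1_min.
have [xb [yb [/= Gxb Gyb ntz z2 [x2 y2]]]] :=
  dedekind_pgroup_Q8 p_pr (quotient_pgroup S pG) dG nabG.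
case/morphimP: Gxb => x Nx Gx defx; case/morphimP: Gyb => y Ny Gy defy.
pose z := [~ x, y]; have Gz : z \in G by rewrite groupR.
have inN u : u \in G -> u \in 'N(S) := subsetP nS u.
have defz : coset S z = [~ xb, yb] by rewrite defx defy morphR.
have cS s u : s \in S -> u \in G -> commute s u.
  by move=> Ss Gu; apply: commute_sym; apply: (centerC Gu); apply: (subsetP sSZ).
have sqS u : u \in G -> coset S u ^+ 2 = [~ xb, yb] -> exists2 s, s \in S & u ^+ 2 = s * z.
  by move=> Gu e; apply: coset_eq; rewrite ?inN ?groupX // defz -e morphX // inN.
have [s1 Ss1 ex2] : exists2 s, s \in S & x ^+ 2 = s * z by apply: sqS; rewrite -?defx.
have [s2 Ss2 ey2] : exists2 s, s \in S & y ^+ 2 = s * z by apply: sqS; rewrite -?defy.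
have czu u s : s \in S -> u \in G -> u ^+ 2 = s * z -> commute u z.
  move=> Ss Gu e; rewrite -(mulKg s z) -e; apply: commuteM.
    by apply: commute_sym; apply: cS; rewrite ?groupV.
  exact: commuteX.
have cxz : commute x z := czu x s1 Ss1 Gx ex2.
have cyz : commute y z := czu y s2 Ss2 Gy ey2.
have zz : z ^+ 2 = 1.
  rewrite -commXg //; apply/eqP/commgP; rewrite ex2; apply: commute_sym; apply: commuteM => //.
  by apply: commute_sym; apply: cS.
have ntz' : z \notin S by apply: contra ntz => Sz; rewrite -defz coset_id.
have sub u : u \in G / S -> <[u]> \subset G / S by rewrite cycle_subG.
have nu u c : u \in G / S -> c \in G / S -> u ^ c \in <[u]>.
  move=> Gu Gc; rewrite memJ_norm ?cycle_id //.
  exact: (subsetP (normal_norm (dG <[u]>%G (sub u Gu)))).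
have Gzb : [~ xb, yb] \in G / S by rewrite -defz mem_quotient.
have oz : #[[~ xb, yb]] = 2 by apply: nt_prime_order.
have zbJ c : c \in G / S -> [~ xb, yb] ^ c = [~ xb, yb].
  move=> Gc; have := nu _ c Gzb Gc; rewrite cycle2g // !inE => /orP[|/eqP//].
  by rewrite conjg_eq1 (negPf ntz).
(* Modulo [S], [u, c] lies in <u> and squares to 1 because c fixes u^2; so it is in the subgroup of
   order 2, generated by the image of [z]. *)
have shift u c : u \in G -> c \in G -> coset S u ^+ 2 = [~ xb, yb] ->
    exists i s, s \in S /\ [~ u, c] = s * z ^+ i.
  move=> Gu Gc u2; have [Gub Gcb] := (mem_quotient S Gu, mem_quotient S Gc).
  have: [~ coset S u, coset S c] \in <[coset S u]>.
    by rewrite commgEl groupM ?groupV ?cycle_id // nu.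
  set w := [~ _, _] => uw; have /cycleP[k ew] := uw.
  have w2 : w ^+ 2 = 1.
    have cuw : commute (coset S u) w by rewrite ew; apply: commuteX.
    apply: (mulgI (coset S u ^+ 2)); rewrite mulg1 -expgMn //.
    by rewrite /w commgEl mulKVg -conjXg u2 zbJ.
  have: w \in <[[~ xb, yb]]>.
    rewrite -u2; apply: (@cycle_cyclic_exp _ 2 <[coset S u]>%G) => //;
      by rewrite ?cycle_cyclic ?mem_cycle ?u2.
  case/cycleP=> i ewi; exists i.
  have [||| s Ss es] := @coset_eq _ S [~ u, c] (z ^+ i); rewrite ?inN ?groupR ?groupX //.
    by rewrite [RHS](morphX (coset_morphism S)) ?inN //= defz -ewi [LHS]morphR ?inN.
  by exists s.
have ct s i : s \in S -> [/\ commute (s * z ^+ i) x, commute (s * z ^+ i) y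
                              & commute (s * z ^+ i) z].
  move=> Ss; split; apply: commute_sym; apply: commuteM;
    try (by apply: commute_sym; apply: cS); by apply: commuteX.
(* z^c = [x a, y b] with a, b in S<z>; these commute with x, y and each other, so the commutator is
   still z. *)
have zcent : z \in 'Z(G).
  apply/centerP; split=> // c Gc; apply/commgP/conjg_fixP.
  have [i1 [t1 [St1 e1]]] : exists i s, s \in S /\ [~ x, c] = s * z ^+ i.
    by apply: shift; rewrite -?defx.
  have [i2 [t2 [St2 e2]]] : exists i s, s \in S /\ [~ y, c] = s * z ^+ i.
    by apply: shift; rewrite -?defy.
  have [c1x c1y c1z] := ct t1 i1 St1; have [c2x c2y c2z] := ct t2 i2 St2.
  rewrite /z conjRg -[x ^ c](mulKVg x) -[y ^ c](mulKVg y) -!commgEl e1 e2 -/z.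
  set a := t1 * _ in c1x c1y c1z *; set b := t2 * _ in c2x c2y c2z *.
  have cab : commute a b.
    apply: commuteM; first by apply: commute_sym; apply: cS; rewrite ?groupM ?groupX // (subsetP (normal_sub nSG)).
    exact: commuteX.
  rewrite commMgJ commgMJ -/z.
  rewrite (_ : [~ x, b] = 1); last by apply/eqP/commgP/commute_sym.
  rewrite (_ : [~ a, y * b] = 1); last by apply/eqP/commgP; apply: commuteM.
  have za : z ^ a = z by apply/conjg_fixP/commgP/commute_sym.
  have zb : z ^ b = z by apply/conjg_fixP/commgP/commute_sym.
  by rewrite mul1g mulg1 zb za.
have nzG : <[z]> <| G := central_cycle_normal zcent.
have sSz : S \subset <[z]> by apply: minS; rewrite // cycle_eq1; apply: contra ntz' => /eqP->.
have oz' : #[z] = 2 by apply: nt_prime_order => //; apply: contraNneq ntz' => ->.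
case/negP: ntz'; suffices -> : S :=: <[z]> by apply: cycle_id.
have p2 : p = 2.
  have := cardSg sSz; rewrite oS -orderE oz'.
  by rewrite (dvdn_prime2 p_pr) // => /eqP.
by apply/eqP; rewrite eqEcard sSz oS -orderE oz' p2.
Qed.

Lemma quaternion_of_unique (gT : finGroupType) (p : nat) (U : {group gT}) s :
    prime p -> p.-group U -> ~~ cyclic U -> s \in U -> s ^+ p = 1 -> s != 1 ->
    (forall u, u \in U -> u ^+ p = 1 -> u \in <[s]>) ->
  p = 2 /\ exists n x y,
    [/\ 2 < n, #[x] = (2 ^ n.-1)%N, y \notin <[x]>, y ^+ 2 = x ^+ (2 ^ n.-2)
      & [/\ x \in U, y \in U, x ^ y = x^-1 & <[x]> * <[y]> = U]].
Proof.
move=> p_pr pU ncU Us sp nts uniq.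
have ntU : U :!=: 1 by apply: contraNneq ncU => ->; apply: cyclic1.
have os : #[s] = p by apply: nt_prime_order.
have oO : #|'Ohm_1(U)| = p.
  suffices -> : 'Ohm_1(U) = <[s]> by rewrite -orderE.
  apply/eqP; rewrite (OhmE 1 pU) eqEsubset gen_subG; apply/andP; split.
    by apply/subsetP=> u /LdivP[Uu]; rewrite expn1; apply: uniq.
  by rewrite cycle_subG mem_gen //; apply/LdivP; rewrite expn1.
have := introT (prime_Ohm1P pU ntU) oO; rewrite (negPf ncU) /=.
case/andP=> /eqP p2 /eqP/quaternion_classP[n n_gt2 isoU]; split=> //.
have [[x y] gen [oy y2 xy]] := generators_quaternion n_gt2 isoU.
have [[defU _ _] _ _ _ _] := quaternion_structure n_gt2 gen isoU.
have [_ Ux ox /setDP[Uy nxy]] := gen.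
have [_ eU _] := pprodP defU.
by exists n, x, y; split.
Qed.

Lemma Q8_relations (gT : finGroupType) (n : nat) (x y : gT) :
    2 < n -> #[x] = (2 ^ n.-1)%N -> y ^+ 2 = x ^+ (2 ^ n.-2) -> x ^ y = x^-1 ->
    x ^+ 4 = 1 ->
  [/\ y ^+ 2 = x ^+ 2, [~ x, y] = x ^+ 2, x ^+ 2 != 1 & x ^+ 4 = 1].
Proof.
move=> n_gt2 ox y2 xy x4.
have n3 : n = 3.
  have := order_dvdn x 4; rewrite x4 eqxx ox => /dvdn_leq => /(_ isT).
  rewrite -[4]/(2 ^ 2)%N leq_exp2l // => n_le.
  by apply/eqP; rewrite eqn_leq n_gt2 andbT -ltnS; case: (n) n_gt2 n_le.
move: ox y2; rewrite n3 /= => ox ->; split=> //.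
  rewrite commgEl xy; apply: (mulgI (x ^+ 2)); rewrite -expgD x4 expgS expg1 !mulgA.
  by rewrite mulgK mulgV.
by rewrite -order_dvdn ox.
Qed.

Lemma noncyclic_normal_SSN (gT : finGroupType) (p : nat) (G : {group gT}) :
    p.-group G ->
    (forall U : {group gT}, U \subset G -> ~~ cyclic U -> U <| G) ->
  has_SSN G.
Proof.
move=> pG ncn; apply: (@SSN_of_cyclic _ p) => X sXG nnX.
rewrite (pgroupS sXG pG) /=; apply: contraR nnX; exact: ncn.
Qed.

Lemma nonnormal_cycle_mul (gT : finGroupType) (G N X : {group gT}) :
    N \subset X -> X \subset G -> ~~ (X <| G) ->
  exists2 x, x \in X & ~~ (N * <[x]> <| G).
Proof.
move=> sNX sXG nnX; have [/existsP[x /andP[Xx nx]] | ] :=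
  boolP [exists x, (x \in X) && ~~ (N * <[x]> <| G)]; first by exists x.
rewrite negb_exists => /forallP all_n; case/negP: nnX.
rewrite /normal sXG; apply/subsetP=> g Gg; rewrite inE; apply/subsetP=> _ /imsetP[x Xx ->].
have := all_n x; rewrite Xx negbK => /normal_norm/subsetP/(_ g Gg) ng.
have sNxX : N * <[x]> \subset X by rewrite mul_subG ?cycle_subG.
by apply: (subsetP sNxX); rewrite memJ_norm // (subsetP (mulG_subr _ _)) ?cycle_id.
Qed.

(** SN makes S<y> normal. Conjugates of [y] are t y^i with t central and t^p = 1, so <y^p> is
    normal; as it does not contain [S], it is trivial. *)
Lemma SN_monolith_cycle (gT : finGroupType) (p : nat) (G S : {group gT}) y :
    has_SN G -> monolith p G S -> y \in G -> ~~ (S \subset <[y]>) ->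
  y ^+ p = 1 /\ S * <[y]> <| G.
Proof.
move=> SNG [nSG oS sSZ minS] Gy nSy.
have syG : <[y]> \subset G by rewrite cycle_subG.
have [sSy | nSyG] := SNG S <[y]>%G nSG syG; first by rewrite sSy in nSy.
split=> //; apply: contraNeq nSy => ntyp.
have nyp : <[y ^+ p]> <| G.
  rewrite /normal cycle_subG groupX //=; apply/subsetP=> g Gg; rewrite inE -cycleJ cycle_subG.
  have: y ^ g \in S * <[y]>.
    by rewrite memJ_norm ?(subsetP (normal_norm nSyG)) // (subsetP (mulG_subr _ _)) ?cycle_id.
  case/mulsgP=> t _ St /cycleP[i ->] e; rewrite conjXg e expgMn; last first.
    by apply: commute_sym; apply: (centerC (groupX i Gy)); apply: (subsetP sSZ).
  have -> : t ^+ p = 1 by apply/eqP; rewrite -order_dvdn -oS order_dvdG.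
  by rewrite mul1g -expgM mulnC expgM mem_cycle.
apply: subset_trans (minS _ nyp _) _; first by rewrite cycle_eq1.
by rewrite cycle_subG mem_cycle.
Qed.

(** Each u in [U] satisfies u^p = 1 with S<u> normal, and [X] supplies a nonnormal <v> containing
    [S]. SN for S<u> and <v> makes <u><v> normal for u != 1; for independent a, b in [U], the
    subgroups <a><v> and <b><v> meet in <v>. *)
Lemma SN_monolith_free_normal (gT : finGroupType) (p : nat) (G S X U : {group gT}) :
    prime p -> p.-group G -> has_SN G -> monolith p G S ->
    S \subset X -> X \subset G -> ~~ (X <| G) ->
    U \subset G -> ~~ cyclic U -> ~~ (S \subset U) -> False.
Proof.
move=> p_pr pG SNG monS sSX sXG nnX sUG ncU nSU.
have [nSG oS sSZ minS] := monS.
have [s ntsS] : exists s, S = <[s]>%G.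
  have /cyclicP[s eS] : cyclic S by rewrite prime_cyclic ?oS.
  by exists s; apply/val_inj.
have os : #[s] = p by rewrite -oS ntsS.
have sp : s ^+ p = 1 by rewrite -os expg_order.
have nts : s != 1 by rewrite -order_gt1 os prime_gt1.
have Us u : u \in U -> s \in <[u]> -> False.
  by move=> Uu us; case/negP: nSU; rewrite ntsS /= cycle_subG; apply: subsetP us; rewrite cycle_subG.
have Uexp u : u \in U -> u ^+ p = 1 /\ S * <[u]> <| G.
  move=> Uu; apply: (SN_monolith_cycle SNG monS (subsetP sUG u Uu)).
  by rewrite {1}ntsS /= cycle_subG; apply/negP=> /Us-/(_ Uu).
have [v Xv nSv] := nonnormal_cycle_mul sSX sXG nnX.
have Gv := subsetP sXG v Xv; have svG : <[v]> \subset G by rewrite cycle_subG.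
have [sSv | nSvG] := SNG S <[v]>%G nSG svG; last by rewrite nSvG in nSv.
have nnv : ~~ (<[v]> <| G) by rewrite -(mulSGid sSv).
have vs : s \in <[v]> by rewrite -cycle_subG -[<[s]>]/(gval <[s]>%G) -ntsS.
have tivU t : t \in <[v]> -> t \in U -> t = 1.
  move=> vt Ut; apply/eqP; apply: contraT => ntt; case: (Us t Ut).
  by apply: (cycle_cyclic_exp p_pr (cycle_cyclic v)) => //; case: (Uexp t Ut).
have nW e : e \in U -> e != 1 -> <[e]> * <[v]> <| G.
  move=> Ue nte; have [ep nSe] := Uexp e Ue; have Ge := subsetP sUG e Ue.
  have cSe : <[e]> \subset 'N(S) by rewrite cycle_subG (subsetP (normal_norm nSG)).
  rewrite -norm_joinEr // in nSe.
  have [sWv | ] := SNG (S <*> <[e]>)%G <[v]>%G nSe svG.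
    case/negP: nte; apply/eqP/tivU => //; apply: (subsetP sWv).
    by rewrite -cycle_subG joing_subr.
  rewrite /= norm_joinEr // -(normC cSe) -mulgA [S * _]mulSGid //.
have ntU : U :!=: 1 by apply: contraNneq ncU => ->; apply: cyclic1.
have /trivgPn[a Ua nta] := ntU.
have [b Ub nab] : exists2 b, b \in U & b \notin <[a]>.
  apply/subsetPn; apply: contra ncU => sUa.
  exact: cyclicS sUa (cycle_cyclic a).
have ntb : b != 1 by apply: contraNneq nab => ->; apply: group1.
case/negP: nnv; suffices <- : (<[a]> * <[v]>) :&: (<[b]> * <[v]>) = <[v]>.
  by apply: normalI; apply: nW.
apply/eqP; rewrite eqEsubset subsetI !mulG_subr /= andbT; apply/subsetP=> x0 /setIP[].
case/mulsgP=> _ w /cycleP[i ->] vw -> /mulsgP[_ w' /cycleP[j ->] vw' e].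
suffices ->: a ^+ i = 1 by rewrite mul1g.
have [ap _] := Uexp a Ua; have [bp _] := Uexp b Ub.
have e1 : a ^+ i = b ^+ j.
  have: (b ^+ j)^-1 * a ^+ i = 1.
    apply: tivU; last by rewrite groupM ?groupV ?groupX.
    rewrite (_ : _ * _ = w' * w^-1) ?groupM ?groupV //.
    by apply: (canRL (mulgK w)); rewrite -mulgA e mulKg.
  by move/(canRL (mulKVg _)); rewrite mulg1.
apply/eqP; apply: contraNT nab => ntai.
have: b \in <[b ^+ j]>.
  apply: (cycle_cyclic_exp p_pr (cycle_cyclic b)) => //; rewrite ?mem_cycle ?cycle_id -?e1 //.
  by rewrite e1 -expgM mulnC expgM bp expg1n.
by rewrite -e1; apply: subsetP; rewrite cycle_subG mem_cycle.
Qed.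

Lemma bicentral_uniq (gT : finGroupType) (p : nat) (G Om U : {group gT}) :
    prime p -> p.-group G -> bicentral p G Om -> U \subset G -> ~~ (Om \subset U) ->
    U :!=: 1 ->
  exists s, [/\ s \in U, s \in Om, s ^+ p = 1, s != 1
    & forall u, u \in U -> u \in Om -> u \in <[s]>].
Proof.
move=> p_pr pG [sOZ oO Oexp dO] sUG nOU ntU.
have pU := pgroupS sUG pG; have [_ p_dv _] := pgroup_pdiv pU ntU.
have [s Us os] := Cauchy p_pr p_dv; have sp : s ^+ p = 1 by rewrite -os expg_order.
have nts : s != 1 by rewrite -order_gt1 os prime_gt1.
have Os : s \in Om by rewrite -Oexp ?sp // (subsetP sUG).
exists s; split=> // u Uu Ou; apply: contraR nOU => nsu.
have up : u ^+ p = 1 by apply/eqP; rewrite Oexp // (subsetP sUG).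
have ntu : u != 1 by apply: contraNneq nsu => ->; apply: group1.
have ou : #[u] = p by apply: nt_prime_order.
suffices <- : <[s]> * <[u]> = Om by rewrite mul_subG ?cycle_subG.
apply/eqP; rewrite eqEcard mul_subG ?cycle_subG //= TI_cardMg -?orderE ?os ?ou ?oO //.
by rewrite setIC prime_TIg // -?orderE ?ou // cycle_subG.
Qed.

(* A nonnormal noncyclic U has a unique subgroup of order p, so it is quaternion; as <y> Om is *)
(* normal, [x, y] = x^-2 lies in <y>, which bounds the order of x.                            *)
Lemma bicentral_nonnormal_Q8 (gT : finGroupType) (p : nat) (G Om U : {group gT}) :
    prime p -> p.-group G -> bicentral p G Om -> U \subset G -> ~~ (U <| G) -> ~~ cyclic U ->
  p = 2 /\ exists x y,
    [/\ x \in U, y \in U, <[x]> * <[y]> = U, x ^ y = x^-1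
      & [/\ y ^+ 2 = x ^+ 2, [~ x, y] = x ^+ 2, x ^+ 2 != 1 & x ^+ 4 = 1]].
Proof.
move=> p_pr pG bOm sUG nnU ncU; have [sOZ oO Oexp dO] := bOm.
have ntU : U :!=: 1 by apply: contraNneq ncU => ->; apply: cyclic1.
have nOU : ~~ (Om \subset U) by apply: contra nnU => /dO->.
have [s [Us Os sp nts uniq]] := bicentral_uniq p_pr pG bOm sUG nOU ntU.
have pU := pgroupS sUG pG.
have uniqU u : u \in U -> u ^+ p = 1 -> u \in <[s]>.
  by move=> Uu up; apply: uniq => //; rewrite -Oexp ?up // (subsetP sUG).
have [p2 [n [x [y [n_gt2 ox nxy y2 [Ux Uy xy defU]]]]]] :=
  quaternion_of_unique p_pr pU ncU Us sp nts uniqU.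
split=> //; exists x, y; split=> //; apply: (Q8_relations n_gt2 ox y2 xy).
have n_ge2 : 0 < n.-2 by rewrite -subn2 subn_gt0.
have y4 : y ^+ 4 = 1.
  rewrite -[4]/(2 * 2)%N expgM y2 -expgM -expnSr (_ : n.-2.+1 = n.-1) -?ox ?expg_order //.
  by case: (n) n_gt2 => [|[]].
have nty2 : y ^+ 2 != 1.
  by rewrite y2 -order_dvdn ox dvdn_Pexp2l // -ltnNge; case: (n) n_gt2 => [|[]].
have ys : s \in <[y]>.
  have: s \in <[y ^+ 2]>.
    apply: (@cycle_cyclic_exp _ 2 <[s]>%G) => //; rewrite ?cycle_cyclic ?cycle_id -?p2 //.
      by apply: uniqU; rewrite ?groupX // p2 -expgM.
    by rewrite p2 -expgM.
  by apply: subsetP; rewrite cycle_subG mem_cycle.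
have yOn : <[y]> * Om <| G.
  have Gy := subsetP sUG y Uy; have syG : <[y]> \subset G by rewrite cycle_subG.
  rewrite -norm_joinEl; last by rewrite (subset_trans syG) // normal_norm // sub_center_normal.
  by apply: dO; rewrite ?joing_subr // join_subG syG (subset_trans sOZ) ?center_sub.
have: [~ y, x] \in <[y]> * Om :&: U.
  rewrite inE groupR // andbT commgEl.
  have yx : y ^ x \in <[y]> * Om.
    rewrite memJ_norm ?(subsetP (normal_norm yOn)) ?(subsetP sUG) //.
    by rewrite (subsetP (mulG_subl _ _)) ?cycle_id.
  case/mulsgP: yx => a b ya Ob ->.
  by rewrite mulgA mem_mulg // groupM ?groupV ?cycle_id.
have syU : <[y]> \subset U by rewrite cycle_subG.
rewrite -group_modl // => /mulsgP[a b ya /setIP[Ob Ub] eab].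
have yb : b \in <[y]> by apply: (subsetP _ _ (uniq b Ub Ob)); rewrite cycle_subG.
have yyx : [~ y, x] \in <[y]> by rewrite eab groupM.
have: x ^+ 2 \in <[y]>.
  suffices -> : x ^+ 2 = [~ y, x] by [].
  by rewrite -invg_comm commgEl xy invMg invgK.
(* x^2 = y^j: an odd j would put y in <x>, and an even j gives x^4 = 1 because y^4 = 1. *)
case/cycleP=> j; rewrite -(odd_double_half j) addnC expgD -mul2n expgM.
case: (odd j) => [e | ].
  have ey : y = ((y ^+ 2) ^+ j./2)^-1 * x ^+ 2 by rewrite e mulKg.
  by case/negP: nxy; rewrite ey groupM ?groupV ?mem_cycle // groupX // y2 mem_cycle.
rewrite expg0 mulg1 => e; rewrite -[4]/(2 * 2)%N expgM e -!expgM [(j./2 * 2)%N]mulnC mulnA expgM.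
by rewrite [y ^+ (2 * 2)]y4 expg1n.
Qed.

(** U / S is Q8, generated by the images of [x] and [y], and S <= <x>, so [x] should have order 8.
    But [x, y] agrees with x^2 and y^2 up to the central [S], whence [x, y]^2 = 1 and x^4 = 1. *)
Lemma SN_quotient_bicentral_absurd (gT : finGroupType) (p : nat) (G S U : {group gT})
    (Om : {group coset_of S}) :
    prime p -> p.-group G -> has_SN G -> monolith p G S ->
    S \subset U -> U \subset G -> ~~ (U <| G) -> ~~ cyclic (U / S) ->
    bicentral p (G / S)%G Om -> False.
Proof.
move=> p_pr pG SNG monS sSU sUG nnU ncUS bOm.
have [nSG oS sSZ minS] := monS.
have nnUS : ~~ (U / S <| G / S) by apply: contra nnU; apply: normal_quo_inv.
have [p2 [xb [yb [Uxb Uyb _ _ [y2 xy2 ntx2 x4]]]]] :=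
  bicentral_nonnormal_Q8 p_pr (quotient_pgroup S pG) bOm (quotientS S sUG) nnUS ncUS.
case/morphimP: Uxb => x Nx Ux defx; case/morphimP: Uyb => y Ny Uy defy.
have Gx := subsetP sUG x Ux; have Gy := subsetP sUG y Uy.
have inN u : u \in G -> u \in 'N(S) := subsetP (normal_norm nSG) u.
have cS s u : s \in S -> u \in G -> commute s u.
  by move=> Ss Gu; apply: commute_sym; apply: (centerC Gu); apply: (subsetP sSZ).
have Sp s : s \in S -> s ^+ 2 = 1.
  by move=> Ss; apply/eqP; rewrite -order_dvdn -p2 -oS order_dvdG.
have sub u : u \in G -> coset S u ^+ 2 != 1 -> S \subset <[u]>.
  move=> Gu; apply: contraR => nSu; have [] := SN_monolith_cycle SNG monS Gu nSu.
  by rewrite p2 -morphX ?inN // => -> _; rewrite morph1.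
have sSx : S \subset <[x]> by apply: sub; rewrite -?defx.
have sSy : S \subset <[y]> by apply: sub; rewrite -?defy // y2.
pose z := [~ x, y]; have Gz : z \in G by rewrite groupR.
have zE u : u \in G -> coset S u ^+ 2 = [~ xb, yb] -> exists2 s, s \in S & z = s * u ^+ 2.
  move=> Gu e; apply: coset_eq; rewrite ?inN ?groupX //.
  by rewrite [LHS]morphR -?defx -?defy ?inN // -e morphX ?inN.
have [s1 Ss1 ex] : exists2 s, s \in S & z = s * x ^+ 2 by apply: zE; rewrite -?defx ?xy2.
have [s2 Ss2 ey] : exists2 s, s \in S & z = s * y ^+ 2 by apply: zE; rewrite -?defy ?xy2.
have cxz : commute x z.
  by rewrite ex; apply: commuteM; [apply: commute_sym; apply: cS | apply: commuteX].
have cyz : commute y z.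
  by rewrite ey; apply: commuteM; [apply: commute_sym; apply: cS | apply: commuteX].
have z2 : z ^+ 2 = 1.
  rewrite -commXg // (_ : x ^+ 2 = s1^-1 * z); last by rewrite ex mulKg.
  apply/eqP/commgP; apply: commute_sym; apply: commuteM => //.
  by apply: commute_sym; apply: cS; rewrite ?groupV.
have x4' : x ^+ 4 = 1.
  move: z2; rewrite ex expgMn; last by apply: cS; rewrite ?groupX.
  by rewrite Sp // mul1g -expgM.
have /trivgPn[t St ntt] : S :!=: 1 by rewrite -cardG_gt1 oS prime_gt1.
case/negP: ntt; have /cycleP[i et] := subsetP sSx t St.
have: xb ^+ i = 1 by rewrite defx -morphX //= -et coset_id.
have oxb : #[xb] = 4.
  by apply: (@orderXprime _ 2 2) => //; apply: nt_prime_order; rewrite -?expgM.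
move/eqP; rewrite -order_dvdn oxb => /dvdnP[k ek].
by rewrite et ek mulnC expgM x4' expg1n.
Qed.

(** [U] turns out to be Q8 with center [S]. The preimage T of [Tb] has exponent 2, meets [U] in [S]
    and is not central. Some [w] moves both T and, modulo [S], an element of [U]; then the coset of
    w^2 is central and nontrivial, so T <= S<w^2>, and [w] centralizes T after all. *)
Lemma SN_quotient_monolith_absurd (gT : finGroupType) (p : nat) (G S U : {group gT})
    (Tb : {group coset_of S}) :
    prime p -> p.-group G -> has_SN G -> monolith p G S ->
    S \subset U -> U \subset G -> ~~ (U <| G) -> ~~ cyclic U ->
    monolith p (G / S)%G Tb -> (G / S)^`(1) \subset Tb -> False.
Proof.
move=> p_pr pG SNG monS sSU sUG nnU ncU monT dT.
have [nSG oS sSZ minS] := monS; have [nTG oT sTZ minT] := monT.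
have inN u : u \in G -> u \in 'N(S) := subsetP (normal_norm nSG) u.
have cS s u : s \in S -> u \in G -> commute s u.
  by move=> Ss Gu; apply: commute_sym; apply: (centerC Gu); apply: (subsetP sSZ).
(* Otherwise U / S would contain [Tb], hence the derived subgroup of G / S, and be normal. *)
have cU u : u \in U -> ~~ (Tb \subset <[coset S u]>).
  move=> Uu; apply: contra nnU => sTu; apply: (normal_quo_inv nSG sSU sUG).
  apply: sub_der1_normal (quotientS S sUG); apply: subset_trans dT _.
  by apply: subset_trans sTu _; rewrite cycle_subG mem_quotient.
have up u : u \in U -> u ^+ p \in S.
  move=> Uu; have Gu := subsetP sUG u Uu.
  have [] := SN_monolith_cycle (SN_quotient nSG SNG) monT (mem_quotient S Gu) (cU u Uu).
  by rewrite -morphX ?inN //= => e _; apply: coset_idr; rewrite ?inN ?groupX.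
have sSu u : u \in U -> u \notin S -> S \subset <[u]>.
  move=> Uu; apply: contraR => nSu; have Gu := subsetP sUG u Uu.
  have [_ nn] := SN_monolith_cycle SNG monS Gu nSu.
  apply: coset_idr; rewrite ?inN //; apply/eqP; apply: contraT => ntu.
  case/negP: (cU u Uu); apply: minT; last by rewrite cycle_eq1.
  by rewrite /= -quotient_cycle ?inN // -(quotientMidl S) quotient_normal.
have [s eS] : exists s, S = <[s]>%G.
  have /cyclicP[s eS] : cyclic S by rewrite prime_cyclic ?oS.
  by exists s; apply/val_inj.
have os : #[s] = p by rewrite -oS eS.
have sp : s ^+ p = 1 by rewrite -os expg_order.
have nts : s != 1 by rewrite -order_gt1 os prime_gt1.
have Ss : s \in S by rewrite eS cycle_id.
have Us : s \in U := subsetP sSU s Ss.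
have Gs : s \in G := subsetP sUG s Us.
have uniqU u : u \in U -> u ^+ p = 1 -> u \in <[s]>.
  move=> Uu up1; rewrite -[<[s]>]/(gval <[s]>%G) -eS; apply: contraT => nSu.
  have us : s \in <[u]> by rewrite (subsetP (sSu u Uu nSu)).
  have: u \in <[s]> by apply: (cycle_cyclic_exp p_pr (cycle_cyclic u)); rewrite ?cycle_id.
  by rewrite -[<[s]>]/(gval <[s]>%G) -eS (negPf nSu).
have [p2 [n [x [y [n_gt2 ox nxy y2 [Ux Uy xy defU]]]]]] :=
  quaternion_of_unique p_pr (pgroupS sUG pG) ncU Us sp nts uniqU.
have Sinv t : t \in S -> t = 1 \/ t = s.
  rewrite eS /= cycle2g ?os // !inE => /orP[] /eqP; by [left | right].
have s2 : s ^+ 2 = 1 by rewrite -p2.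
have S2 t : t \in S -> t ^+ 2 = 1 by case/Sinv=> ->; rewrite ?expg1n.
have x4 : x ^+ 4 = 1 by rewrite -[4]/(2 * 2)%N expgM S2 // -[X in _ ^+ X]p2 up.
have [yx2 xyx2 ntx2 _] := Q8_relations n_gt2 ox y2 xy x4.
have x2s : x ^+ 2 = s.
  by have [] // := Sinv (x ^+ 2); rewrite -?p2 ?up // p2 => e; rewrite e eqxx in ntx2.
rewrite x2s in yx2 xyx2 => {y2 n_gt2 ox n}.
have Gx := subsetP sUG x Ux; have Gy := subsetP sUG y Uy.
(* T, the preimage of [Tb], of order 4. *)
pose inT t := (t \in G) && (coset S t \in Tb).
have derT g h : g \in G -> h \in G -> inT [~ g, h].
  move=> Gg Gh; rewrite /inT groupR //= [coset S _]morphR ?inN //.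
  by rewrite (subsetP dT) // mem_commg ?mem_quotient.
have commS t g : inT t -> g \in G -> [~ t, g] \in S.
  case/andP=> Gt Tt Gg; apply: coset_idr; rewrite ?inN ?groupR //.
  rewrite [LHS]morphR ?inN //; apply/eqP/commgP; apply: commute_sym.
  by apply: (centerC (mem_quotient S Gg)); apply: (subsetP sTZ).
have T2 t : inT t -> t ^+ 2 \in S.
  case/andP=> Gt Tt; apply: coset_idr; rewrite ?inN ?groupX // morphX ?inN //.
  by apply/eqP; rewrite -order_dvdn -p2 -oT order_dvdG.
have TU t : inT t -> t \in U -> t \in S.
  case/andP=> Gt Tt Ut; apply: coset_idr; rewrite ?inN //; apply/eqP.
  apply: contraT => ntt; case/negP: (cU t Ut).
  suffices -> : Tb = <[coset S t]>%G by [].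
  have tp : coset S t ^+ p = 1 by apply/eqP; rewrite -order_dvdn -oT order_dvdG.
  apply/val_inj/eqP; rewrite eq_sym eqEcard cycle_subG Tt oT /= -orderE.
  by rewrite (nt_prime_order p_pr tp ntt).
(* For an involution w outside [S], S<w> is normal by SN, so its image, of order 2, contains [Tb]
   and equals it. *)
have invT w : w \in G -> w ^+ 2 = 1 -> inT w.
  move=> Gw w2; rewrite /inT Gw /=.
  have [Sw | nSw] := boolP (w \in S); first by rewrite coset_id.
  have ow : #[w] = 2 by apply: nt_prime_order => //; apply: contraNneq nSw => ->.
  have nSw' : ~~ (S \subset <[w]>).
    apply: contra nSw => sSw; suffices -> : S = <[w]>%G by apply: cycle_id.
    by apply/val_inj/eqP; rewrite eqEcard sSw oS p2 /= -orderE ow.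
  have [_ nn] := SN_monolith_cycle SNG monS Gw nSw'.
  have ntw : coset S w != 1 by apply: contra nSw => /eqP/coset_idr->; rewrite ?inN.
  have sTw : Tb \subset <[coset S w]>.
    apply: minT; last by rewrite cycle_eq1.
    by rewrite /= -quotient_cycle ?inN // -(quotientMidl S) quotient_normal.
  suffices <- : <[coset S w]>%G = Tb by apply: cycle_id.
  apply/val_inj/eqP; rewrite eq_sym eqEcard sTw oT p2 /= -orderE dvdn_leq // order_dvdn.
  by rewrite -morphX ?inN //= w2 morph1.
pose sq u := [/\ u \in U, u ^+ 2 = s & u \in G].
have sqT u t : sq u -> inT t -> (u * t) ^+ 2 = u ^+ 2 * t ^+ 2 * [~ t, u].
  case=> Uu u2 Gu Tt; have [Gt _] := andP Tt.
  by rewrite expMg_Rmul ?bin2 ?expg1 //; apply: commute_sym; apply: cS; rewrite ?commS.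
(* By [invT] the product u t would lie in T, so u would be in T and [U], that is in [S]; but u^2 =
   s. *)
have nutT u t : sq u -> inT t -> (u * t) ^+ 2 = 1 -> False.
  case=> Uu u2 Gu Tt e; have [Gt Ttb] := andP Tt.
  have /andP[_] := invT (u * t) (groupM Gu Gt) e.
  rewrite morphM ?inN //= groupMr // => Tub; have Tu : inT u by rewrite /inT Gu.
  by case/negP: nts; rewrite -u2 S2 // TU.
have sJ g : g \in G -> s ^ g = s by move=> Gg; apply/conjg_fixP/commgP/cS.
have sqx : sq x by [].
have sqy : sq y by [].
have sqxy : sq (x * y).
  split; rewrite ?groupM // expMg_Rmul ?bin2 ?expg1 -?(invg_comm x y) ?xyx2.
  - by rewrite x2s yx2 mulgK.
  - by apply: commute_sym; apply: cS; rewrite ?groupV.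
  by apply: commute_sym; apply: cS; rewrite ?groupV.
have ssq : s * s = 1 by rewrite -s2.
(* If t^2 = s, then (u t)^2 = [t, u] for u = x, y, xy. None of these is 1, so all three equal s,
   against [t, xy] = s^2 = 1. *)
have t2 t : inT t -> t ^+ 2 = 1.
  move=> Tt; have [// | t2s] := Sinv _ (T2 t Tt); have [Gt _] := andP Tt.
  have ts u : sq u -> [~ t, u] = s.
    move=> squ; have [Uu u2 Gu] := squ; have [e | //] := Sinv _ (commS t u Tt Gu).
    by case: (nutT u t squ Tt); rewrite sqT // e mulg1 u2 t2s.
  by case/eqP: nts; rewrite -{1}(ts _ sqxy) commgMJ !ts // sJ.
have cTu u t : sq u -> inT t -> [~ t, u] = 1.
  move=> squ Tt; have [Uu u2 Gu] := squ.
  have [// | ets] := Sinv _ (commS t u Tt Gu); case: (nutT u t squ Tt).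
  by rewrite sqT // ets u2 t2 // mulg1.
have /trivgPn[ab Tab ntab] : Tb :!=: 1 by rewrite -cardG_gt1 oT prime_gt1.
have [a [Ga Ta nSa eab]] : exists a, [/\ a \in G, inT a, a \notin S & ab = coset S a].
  have /morphimP[a Na Ga eab] := subsetP (normal_sub nTG) ab Tab.
  exists a; split=> //; first by rewrite /inT Ga -eab.
  by apply: contra ntab => Sa; rewrite eab /= coset_id.
have T_S t t' : inT t -> inT t' -> t \notin S -> t' \notin S ->
    exists2 r, r \in S & t' = r * t.
  case/andP=> Gt Tt /andP[Gt' Tt'] nSt nSt'; apply: coset_eq; rewrite ?inN //.
  have ne u : u \in G -> u \notin S -> coset S u != 1.
    by move=> Gu; apply: contra => /eqP/coset_idr->; rewrite ?inN.
  have cT : cyclic Tb by rewrite prime_cyclic ?oT.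
  have Texp u : u \in Tb -> u ^+ 2 = 1 by move=> Tu; apply/eqP; rewrite -order_dvdn -p2 -oT order_dvdG.
  have := @cycle_cyclic_exp _ 2 Tb (coset S t) (coset S t') isT cT Tt Tt' (Texp _ Tt) (Texp _ Tt') (ne _ Gt nSt).
  rewrite cycle2g; last by apply: nt_prime_order; rewrite ?Texp ?ne.
  by rewrite !inE (negPf (ne _ Gt' nSt')) => /eqP.
(* Otherwise <a>, of order 2, is central and hence normal, but differs from [S]. *)
have [w0 Gw0 aw0] : exists2 w, w \in G & [~ a, w] = s.
  have [/existsP[w /andP[Gw /eqP aw]] | ] := boolP [exists w, (w \in G) && ([~ a, w] == s)].
    by exists w.
  rewrite negb_exists => /forallP all_a; case/negP: (nSa).
  have nA : <[a]> <| G.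
    apply: central_cycle_normal; apply/centerP; split=> // w Gw; apply/commgP/eqP.
    by have [// | e] := Sinv _ (commS a w Ta Gw); have := all_a w; rewrite Gw e eqxx.
  have nta : a != 1 by apply: contraNneq nSa => ->; apply: group1.
  have sSa : S \subset <[a]> by apply: minS; rewrite // cycle_eq1.
  suffices -> : S = <[a]>%G by apply: cycle_id.
  apply/val_inj/eqP; rewrite eqEcard sSa oS p2 /= -orderE.
  by rewrite (@nt_prime_order _ 2 a) ?t2.
have [d [u [Gd squ nud]]] : exists d u, [/\ d \in G, sq u & [~ u, d] \notin S].
  have [/existsP[d /andP[Gd nd]] | ] :=
    boolP [exists d, (d \in G) && (([~ x, d] \notin S) || ([~ y, d] \notin S))].
    by case/orP: nd => nd; exists d; [exists x | exists y].
  rewrite negb_exists => /forallP all_d; case/negP: nnU.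
  rewrite /normal sUG; apply/subsetP=> d Gd; rewrite inE.
  have := all_d d; rewrite Gd negb_or !negbK => /andP[xd yd].
  rewrite -{1}defU conjsMg mul_subG // -cycleJ cycle_subG.
    by rewrite -(mulKVg x (x ^ d)) -commgEl groupM // (subsetP sSU).
  by rewrite -(mulKVg y (y ^ d)) -commgEl groupM // (subsetP sSU).
have [Uu u2 Gu] := squ.
(* If neither [d] nor [w0] will do, then [a, d] = 1 and [u, w0] is in [S], and the product satisfies
   both conditions. *)
have [w [Gw aw uw]] : exists w, [/\ w \in G, [~ a, w] = s & [~ u, w] \notin S].
  have [ed | ed] := Sinv _ (commS a d Ta Gd); last by exists d.
  have [Su | nSu] := boolP ([~ u, w0] \in S); last by exists w0.
  exists (w0 * d); rewrite groupM //; split=> //; rewrite commgMJ.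
    by rewrite ed aw0 mul1g sJ.
  by rewrite groupMr // memJ_norm ?inN.
pose a' := [~ u, w]; have Ta' : inT a' by apply: derT.
have [r Sr ea'] := T_S a a' Ta Ta' nSa uw; have Gr := subsetP (normal_sub nSG) r Sr.
have a'w : [~ a', w] = s.
  by rewrite ea' commMgJ aw (_ : [~ r, w] = 1) ?conj1g ?mul1g //; apply/eqP/commgP; apply: cS.
(* [u, w^2] = a' a'^w = a'^2 s, and T has exponent 2. *)
have uww : [~ u, w ^+ 2] = s.
  rewrite expgS expg1 commgMJ -/a' -[a' ^ w](mulKVg a') -commgEl a'w mulgA.
  by rewrite -expg2 t2 // mul1g.
have vZ : coset S (w ^+ 2) \in 'Z(G / S).
  apply/centerP; split=> [|_ /morphimP[g Ng Gg ->]]; first by rewrite mem_quotient ?groupX.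
  apply/commgP; rewrite commg1_sym morphX ?inN //.
  have gZ : [~ coset S g, coset S w] \in 'Z(G / S).
    by apply: (subsetP sTZ); apply: (subsetP dT); rewrite mem_commg ?mem_quotient.
  rewrite commgX; last by apply: (centerC (mem_quotient S Gw)).
  have := derT g w Gg Gw => /t2 e; rewrite -[[~ _, _]](morphR (coset_morphism S)) ?inN //.
  by rewrite -morphX ?inN ?groupR //= e morph1.
have nSv : w ^+ 2 \notin S.
  apply: contra nts => Sv; rewrite -uww; apply/commgP; apply: commute_sym; exact: cS.
have Gv : w ^+ 2 \in G by rewrite groupX.
have sTv : Tb \subset <[coset S (w ^+ 2)]>.
  apply: minT; first exact: central_cycle_normal.
  by rewrite cycle_eq1; apply: contra nSv => /eqP/coset_idr->; rewrite ?inN.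
have : coset S a \in <[coset S (w ^+ 2)]> by rewrite (subsetP sTv) // -eab.
case/cycleP=> i; rewrite -morphX ?inN //= => /coset_eq[|| r' Sr' ea]; rewrite ?inN ?groupX //.
case/negP: nts; rewrite -aw; apply/commgP; rewrite ea; apply: commute_sym.
apply: commuteM; first by apply: commute_sym; apply: cS.
by rewrite -expgM; apply: commuteX.
Qed.

(** Induction on the order ([n] is its bound), through G / S: a nonnormal noncyclic [U] contains
    [S], and its image is again nonnormal and noncyclic. Either G / S is one of the two absurd
    cases, or it has a nonnormal subgroup above its own smallest normal subgroup and the induction
    applies. *)
Theorem SN_monolith_noncyclic_normal (n : nat) (gT : finGroupType) (p : nat) (G S X U : {group gT}) :
    #|G| < n -> prime p -> p.-group G -> has_SN G -> monolith p G S ->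
    S \subset X -> X \subset G -> ~~ (X <| G) ->
    U \subset G -> ~~ cyclic U -> U <| G.
Proof.
elim: n gT G S X U => // n IHn gT G S X U leGn p_pr pG SNG monS sSX sXG nnX sUG ncU.
have [nSG oS sSZ minS] := monS.
have [sSU | nSU] := boolP (S \subset U); last first.
  by case: (SN_monolith_free_normal p_pr pG SNG monS sSX sXG nnX sUG ncU nSU).
apply: contraT => nnU; have SNb := SN_quotient nSG SNG; have pGb := quotient_pgroup S pG.
have nUS : ~~ (U / S <| G / S) by apply: contra nnU; apply: normal_quo_inv.
have ncUS : ~~ cyclic (U / S).
  apply/negP=> /cyclicP[xb exb]; have : xb \in U / S by rewrite exb cycle_id.
  case/morphimP=> x Nx Ux ex; have Gx := subsetP sUG x Ux.
  have defU : S * <[x]> = U.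
    apply/eqP; rewrite eqEsubset mul_subG ?cycle_subG //= -quotientSK ?(subset_trans sUG) ?normal_norm //.
    by rewrite exb ex quotient_cycle.
  have sxG : <[x]> \subset G by rewrite cycle_subG.
  have [sSx | ] := SNG S <[x]>%G nSG sxG; last by rewrite defU (negPf nnU).
  by case/negP: ncU; rewrite -defU mulSGid ?cycle_cyclic.
have ntGb : G / S != 1.
  apply: contraNneq ncUS => G1; rewrite (_ : U / S = 1) ?cyclic1 //.
  by apply/trivgP; rewrite -G1 quotientS.
have [cZ | ncZ] := boolP (cyclic 'Z(G / S)); last first.
  have [Om bOm] := SN_noncyclic_center p_pr pGb SNb (quotientS S sUG) nUS ncZ.
  by case: (SN_quotient_bicentral_absurd p_pr pG SNG monS sSU sUG nnU ncUS bOm).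
have monT := monolith_of_cyclic_center pGb ntGb cZ.
set Tb := 'Ohm_1(_)%G in monT; have [nTG _ _ _] := monT.
have [/forallP dT | ] := boolP [forall Y : {group coset_of S},
    (Tb \subset Y) && (Y \subset G / S) ==> (Y <| G / S)].
  have dGT : dedekind (G / S / Tb)%G.
    apply/dedekind_quoP => // Y sTY sYG; apply: (implyP (dT Y)); exact/andP.
  have := monolith_dedekind_quotient p_pr pGb monT dGT.
  by case/(SN_quotient_monolith_absurd p_pr pG SNG monS sSU sUG nnU ncU monT).
rewrite negb_forall => /existsP[Y]; rewrite negb_imply => /andP[/andP[sTY sYG] nnY].
case/negP: nUS; apply: (IHn _ _ Tb Y) => //; last exact: quotientS.
rewrite -ltnS; apply: leq_trans leGn; rewrite ltnS ltn_quotient ?(normal_sub nSG) //.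
by rewrite -cardG_gt1 oS prime_gt1.
Qed.

(** * The group Q8 x Q8 *)

Lemma abelem4_coord (gT : finGroupType) (Om : {group gT}) z c :
    abelian Om -> #|Om| = 4 -> (forall t, t \in Om -> t ^+ 2 = 1) ->
    z \in Om -> c \in Om -> z != 1 -> c \notin <[z]> ->
  [/\ forall t, t \in Om -> exists a b : bool, t = z ^+ a * c ^+ b,
      forall a b : bool, (z ^+ a * c ^+ b \in <[z]>) = ~~ b,
      forall a b : bool, (z ^+ a * c ^+ b \in <[c]>) = ~~ a,
      forall a b : bool, (z ^+ a * c ^+ b \in <[z * c]>) = (a == b)
    & forall a b a' b' : bool,
        (z ^+ a * c ^+ b) * (z ^+ a' * c ^+ b') = z ^+ (a (+) a') * c ^+ (b (+) b')].
Proof.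
move=> abO oO O2 Oz Oc ntz nzc.
have ntc : c != 1 by apply: contraNneq nzc => ->; apply: group1.
have ntzc : z * c != 1.
  by apply: contraNneq nzc => e; rewrite -(mulKg z c) e mulg1 groupV cycle_id.
have ezc : z != c by apply: contraNneq nzc => ->; apply: cycle_id.
have cO : {in Om &, commutative (@mulg gT)} by move=> u v Ou Ov; apply: (centsP abO).
have cyc t : t \in Om -> t != 1 -> <[t]> = [set 1; t].
  by move=> Ot ntt; rewrite cycle2g //; apply: nt_prime_order; rewrite ?O2.
have zz : z * z = 1 by rewrite -(O2 z).
have cc : c * c = 1 by rewrite -(O2 c).
have bM t (a b : bool) : t \in Om -> t ^+ a * t ^+ b = t ^+ (a (+) b).
  by move=> Ot; case: a; case: b; rewrite ?expg0 ?expg1 ?mulg1 ?mul1g // -(O2 t).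
have zne : z * c != z by rewrite -[X in _ != X]mulg1 (inj_eq (mulgI z)).
have cne : z * c != c by rewrite -[X in _ != X]mul1g (inj_eq (mulIg c)).
have all4 : Om = [set 1; z; c; z * c] :> {set gT}.
  apply/esym/eqP; rewrite eqEcard; apply/andP; split.
    by apply/subsetP=> t; rewrite !inE -!orbA => /or4P[] /eqP->; rewrite ?group1 ?groupM.
  rewrite oO -!setUA !cardsU1 cards1 !inE !negb_or.
  by rewrite !(eq_sym 1) ntz ntc ntzc ezc (eq_sym z) zne (eq_sym c) cne.
split.
- move=> t; rewrite all4 !inE -!orbA => /or4P[] /eqP->.
  + by exists false, false; rewrite mulg1.
  + by exists true, false; rewrite mulg1.
  + by exists false, true; rewrite mul1g.
  by exists true, true.
- move=> a b; rewrite cyc // !inE; case: a; case: b; rewrite ?expg0 ?expg1 ?mulg1 ?mul1g ?eqxx ?orbT //.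
    by rewrite (negPf ntzc) (negPf zne).
  by rewrite (negPf ntc) eq_sym (negPf ezc).
- move=> a b; rewrite cyc // !inE; case: a; case: b; rewrite ?expg0 ?expg1 ?mulg1 ?mul1g ?eqxx ?orbT //.
    by rewrite (negPf ntzc) (negPf cne).
  by rewrite (negPf ntz) (negPf ezc).
- move=> a b; rewrite cyc ?groupM // !inE; case: a; case: b; rewrite ?expg0 ?expg1 ?mulg1 ?mul1g ?eqxx ?orbT //.
    by rewrite (negPf ntz) eq_sym (negPf zne).
  by rewrite (negPf ntc) eq_sym (negPf cne).
move=> a b a' b'; rewrite -!bM // -!mulgA; congr (_ * _); rewrite !mulgA; congr (_ * _).
by apply: cO; rewrite groupX.
Qed.

(* These properties hold in Q8 x Q8, where <[c]> and <[z * c]> are the centers *)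
(* of the factors: modulo either of them, all conjugates of m are m or m^-1.   *)
Definition Q8Q8_like (gT : finGroupType) (G : {group gT}) z c :=
  [/\ z \in 'Z(G), c \in 'Z(G), z ^+ 2 = 1, c ^+ 2 = 1 & [/\ z != 1, c \notin <[z]>,
      forall t, t \in 'Z(G) -> exists a b : bool, t = z ^+ a * c ^+ b,
      forall m, m \in G -> m \notin 'Z(G) ->
        exists2 f, f \in G & [~ m, f] = c \/ [~ m, f] = z * c
    & [/\ forall m f, m \in G -> f \in G -> [~ m, f] \in 'Z(G),
        forall m f, m \in G -> f \in G -> [~ m, f] \in <[c]> \/ m ^+ 2 * [~ m, f] \in <[c]>
      & forall m f, m \in G -> f \in G ->
          [~ m, f] \in <[z * c]> \/ m ^+ 2 * [~ m, f] \in <[z * c]>]]].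

(** Commutators are bilinear with values in [Om], and (ab)^2 = a^2 b^2 [a, b], so this is linear
    algebra with quadratic forms over F_2. Suitable [g] and [h] complete [x] and [y] to a basis
    modulo [Om] with all squares and commutators determined. *)
Lemma Q8Q8_structure (gT : finGroupType) (G Om : {group gT}) z x y h0 g0 :
    2.-group G -> Om \subset 'Z(G) -> #|Om| = 4 ->
    (forall t, t \in G -> (t ^+ 2 == 1) = (t \in Om)) ->
    G^`(1) \subset Om -> cyclic ('Z(G) / <[z]>) -> z != 1 ->
    x \in G -> y \in G -> h0 \in G -> g0 \in G ->
    x ^+ 2 = z -> y ^+ 2 = z -> [~ x, y] = z ->
    [~ x, h0] \in <[z]> -> [~ y, h0] \notin <[z]> -> [~ x, g0] \notin <[z]> ->
  exists c, Q8Q8_like G z c.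
Proof.
move=> pG sOZ oO Oexp dO cycZ ntz Gx Gy Gh0 Gg0 x2 y2 xy xh0 yh0 xg0.
have sOG : Om \subset G := subset_trans sOZ (center_sub G).
have OG t : t \in Om -> t \in G := subsetP sOG t.
have cen t g : t \in Om -> g \in G -> commute t g.
  by move=> Ot Gg; apply: commute_sym; apply: (centerC Gg); apply: (subsetP sOZ).
have abO : abelian Om by apply/centsP=> u Ou v Ov; apply: cen; rewrite ?OG.
have O2 t : t \in Om -> t ^+ 2 = 1 by move=> Ot; apply/eqP; rewrite Oexp ?OG.
have comO a b : a \in G -> b \in G -> [~ a, b] \in Om.
  by move=> Ga Gb; rewrite (subsetP dO) ?mem_commg.
have Oinv t : t \in Om -> t^-1 = t.
  by move=> Ot; apply/eqP; rewrite eq_invg_mul -expg2 O2.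
have OJ t g : t \in Om -> g \in G -> t ^ g = t.
  by move=> Ot Gg; apply/conjg_fixP/commgP/cen.
have comC a b : a \in G -> b \in G -> [~ a, b] = [~ b, a].
  by move=> Ga Gb; rewrite -invg_comm Oinv ?comO.
have comMl a b d : a \in G -> b \in G -> d \in G -> [~ a * b, d] = [~ a, d] * [~ b, d].
  by move=> Ga Gb Gd; rewrite commMgJ OJ ?comO.
have comMr a b d : a \in G -> b \in G -> d \in G -> [~ d, a * b] = [~ d, a] * [~ d, b].
  by move=> Ga Gb Gd; rewrite comC ?groupM // comMl // !(comC d).
have com0 t g : t \in Om -> g \in G -> [~ t, g] = 1.
  by move=> Ot Gg; apply/eqP/commgP/cen.
have sqM a b : a \in G -> b \in G -> (a * b) ^+ 2 = a ^+ 2 * b ^+ 2 * [~ a, b].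
  move=> Ga Gb; rewrite expMg_Rmul ?bin2 ?expg1 1?(comC a) //.
    by apply: commute_sym; apply: cen; rewrite ?comO.
  by apply: commute_sym; apply: cen; rewrite ?comO.
have Oz : z \in Om by rewrite -xy comO.
have Gz := OG z Oz.
have zz : z * z = 1 by rewrite -(O2 z).
(* Multiplying by x, y or h changes commutators by known amounts: [h0] and [g0] are normalized to
   [x, h] = [y, g] = 1 and [y, h] = [x, g] = c. *)
have [h [Gh xh yh]] : exists h, [/\ h \in G, [~ x, h] = 1 & [~ y, h] \notin <[z]>].
  have : [~ x, h0] \in [set 1; z] by rewrite -cycle2g //; apply: nt_prime_order; rewrite ?O2.
  rewrite !inE => /orP[] /eqP e; first by exists h0.
  exists (h0 * y); rewrite groupM // !comMr // e xy zz commgg mulg1.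
  by [].
pose c := [~ y, h]; have Oc : c \in Om by rewrite comO.
have [Ocoo inz inc inzc EM] := abelem4_coord abO oO O2 Oz Oc ntz yh.
have cc : c * c = 1 by rewrite -(O2 c).
have nzc : c \notin <[z]> := yh.
have Gc := OG c Oc; have czc : z * c = c * z := cen _ _ Oz Gc.
have [g [Gg xg yg]] : exists g, [/\ g \in G, [~ x, g] = c & [~ y, g] = 1].
  have [a [b eb]] := Ocoo _ (comO _ _ Gy Gg0).
  have Ghb : h ^+ b \in G by rewrite groupX. have Gxa : x ^+ a \in G by rewrite groupX.
  have cX (u v : gT) (k : bool) : [~ u, v] ^+ k = [~ u, v ^+ k] by case: k; [rewrite !expg1 | rewrite !expg0 commg1].
  pose g1 := g0 * (x ^+ a * h ^+ b).
  have Gg1 : g1 \in G by rewrite !groupM.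
  have yg1 : [~ y, g1] = 1.
    rewrite !comMr ?groupM // eb -!cX -/c (comC y) // xy.
    by rewrite EM !addbb mulg1.
  have xg1 : [~ x, g1] = [~ x, g0].
    by rewrite !comMr ?groupM // -!cX commgg xh !expg1n !mulg1.
  clearbody g1; have [a' [b' eb']] := Ocoo _ (comO _ _ Gx Gg0).
  rewrite eb' inz negbK in xg0; rewrite xg0 expg1 in eb'.
  case: a' eb' => eb'.
    exists (g1 * y); rewrite groupM // !comMr // xg1 eb' yg1 commgg xy mulg1.
    by rewrite expg1 -/c czc -mulgA zz mulg1.
  by exists g1; rewrite xg1 eb' mul1g.
have Gxy : x * y \in G by rewrite groupM.
have ggh : g * h \in G by rewrite groupM.
have notO f u : f \in G -> u \in G -> [~ f, u] != 1 -> f \notin Om.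
  by move=> Gf Gu; apply: contra => Of; rewrite com0.
have sqn1 f u : f \in G -> u \in G -> [~ f, u] != 1 -> f ^+ 2 != 1.
  by move=> Gf Gu ntf; rewrite Oexp // (notO f u).
have nz1 t : t \notin <[z]> -> t != 1 by apply: contraNneq => ->; apply: group1.
(* If f u r1 had square 1 it would be central, so the commutators of f with x and y would be inverse
   to those of u, which lie in <z>. *)
have nfu f u r1 : f \in G -> ([~ f, x] \notin <[z]>) || ([~ f, y] \notin <[z]>) ->
    r1 \in 'Z(G) -> [~ u, x] \in <[z]> -> [~ u, y] \in <[z]> -> u \in G ->
    (f * u * r1) ^+ 2 != 1.
  move=> Gf nf Zr1 ux uy Gu; have Gr1 := subsetP (center_sub G) r1 Zr1.
  rewrite Oexp ?(groupM (groupM Gf Gu) Gr1) //; apply: contraL nf => Of; rewrite negb_or !negbK.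
  have inzf v : v \in G -> [~ u, v] \in <[z]> -> [~ f, v] \in <[z]>.
    move=> Gv uv; have := com0 _ v Of Gv.
    rewrite (comMl _ _ _ (groupM Gf Gu) Gr1 Gv) (comMl _ _ _ Gf Gu Gv).
    have -> : [~ r1, v] = 1.
      by apply/eqP/commgP; apply: commute_sym; apply: (centerC Gv).
    by rewrite mulg1 => e; rewrite -(groupMr _ uv) e group1.
  by rewrite !inzf.
have inz1 : 1 \in <[z]> := group1 _.
have xyx : [~ x * y, x] = z by rewrite comMl // commgg mul1g (comC y) // xy.
have xyy : [~ x * y, y] = z by rewrite comMl // commgg mulg1 xy.
have xy2 : (x * y) ^+ 2 = z by rewrite sqM // x2 y2 xy zz mul1g.
have usq u : u \in [:: x; y; x * y] ->
    [/\ u \in G, u ^+ 2 = z, [~ u, x] \in <[z]> & [~ u, y] \in <[z]>].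
  rewrite !inE => /or3P[] /eqP->; split;
    by rewrite ?commgg ?xyx ?xyy ?(comC y x) ?xy ?cycle_id.
have sqZ f : f \in G -> f ^+ 2 \in 'Z(G).
  move=> Gf; apply/centerP; split=> [|v Gv]; first exact: groupX.
  apply/commgP; rewrite [f ^+ 2]expgS expg1 comMl // -expg2 O2 ?comO //.
(* Otherwise the center is <z><r> with [r] of order at least 4, and the involution [io] of <r>
   completes [z] to a basis of [Om]. An [f] is found whose commutators with x, y and xy all avoid
   <io>, which is impossible as the z-coordinate is additive. *)
have ZOm : 'Z(G) = Om.
  apply/eqP; rewrite eqEsubset sOZ andbT; apply: contraT => /subsetPn[t Zt nOt].
  have nZz : 'Z(G) \subset 'N(<[z]>).
    by rewrite cents_norm // centsC cycle_subG; case/setIP: (subsetP sOZ z Oz) => _;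
       apply: subsetP; rewrite centS ?center_sub.
  have /cyclicP[rb erb] := cycZ.
  have: rb \in 'Z(G) / <[z]> by rewrite erb cycle_id.
  case/morphimP=> r Nr Zr er; have Gr := subsetP (center_sub G) r Zr.
  have Zrep v : v \in 'Z(G) -> exists k j, v = z ^+ k * r ^+ j.
    move=> Zv; have Nv := subsetP nZz v Zv.
    have: coset <[z]> v \in <[rb]> by rewrite -erb mem_quotient.
    case/cycleP=> j; rewrite er -morphX //= => /coset_eq[|| zeta /cycleP[k ->] ->] //.
      by rewrite groupX.
    by exists k, j.
  have cenZ v u : v \in 'Z(G) -> u \in G -> commute v u.
    by move=> Zv Gu; apply: commute_sym; apply: (centerC Gu).
  have nOr : r \notin Om.
    by apply: contra nOt => Or; have [k [j ->]] := Zrep t Zt; rewrite groupM ?groupX.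
  have [a oa] := p_natP (mem_p_elt pG Gr).
  have a_gt1 : 1 < a.
    rewrite ltnNge; apply: contra nOr => a_le1; rewrite -Oexp // -order_dvdn oa.
    by rewrite -[X in _ %| X]expn1 dvdn_exp2l.
  pose r0 := r ^+ (2 ^ a.-2); pose io := r0 ^+ 2.
  have Zr0 : r0 \in 'Z(G) by rewrite groupX.
  have Gr0 := subsetP (center_sub G) r0 Zr0.
  have eio : io = r ^+ (2 ^ a.-1).
    by rewrite /io /r0 -expgM -expnSr; case: (a) a_gt1 => [|[]].
  have Oio : io \in Om.
    have Gio : io \in G := groupX 2 Gr0.
    rewrite -Oexp // eio -expgM -expnSr prednK ?(ltnW a_gt1) //.
    by rewrite -oa expg_order.
  have ntio : io != 1.
    by rewrite eio -order_dvdn oa dvdn_Pexp2l // -ltnNge ltn_predL (ltnW a_gt1).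
  have nzio : io \notin <[z]>.
    rewrite cycle2g; last by apply: nt_prime_order; rewrite ?O2.
    rewrite !inE negb_or ntio; apply/eqP=> eioz.
    have: (r0 * x) ^+ 2 == 1.
      by rewrite expgMn ?x2 -/io ?eioz ?zz //; apply: cenZ.
    rewrite (Oexp _ (groupM Gr0 Gx)) => Or0x; have := com0 _ y Or0x Gy.
    rewrite comMl // xy (_ : [~ r0, y] = 1) ?mul1g; last by apply/eqP/commgP; apply: cenZ.
    by move/eqP; rewrite (negPf ntz).
  have [Oio_co _ inio _ EMio] := abelem4_coord abO oO O2 Oz Oio ntz nzio.
  (* Modulo <z>, the squares of h, g and gh are powers of [r], and one of the three exponents is
     even: [g, h] only adds a multiple of 2^(a-1), as io = r0^2. *)
  have [f [Gf nf [k [j f2]]]] : exists f, [/\ f \in G,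
      ([~ f, x] \notin <[z]>) || ([~ f, y] \notin <[z]>)
      & exists k j, f ^+ 2 = z ^+ k * (r ^+ j) ^+ 2].
    have [k1 [j1 h2]] := Zrep _ (sqZ h Gh); have [k2 [j2 g2]] := Zrep _ (sqZ g Gg).
    have even_j j : ~~ odd j -> r ^+ j = (r ^+ j./2) ^+ 2.
      by move=> ej; rewrite -expgM muln2 even_halfK.
    have [oj1 | ej1] := boolP (odd j1); last first.
      exists h; split=> //; first by rewrite [[~ h, y]]comC // yh orbT.
      by exists k1, j1./2; rewrite -even_j.
    have [oj2 | ej2] := boolP (odd j2); last first.
      exists g; split=> //; first by rewrite [[~ g, x]]comC // xg nzc.
      by exists k2, j2./2; rewrite -even_j.
    exists (g * h); split=> //; first by rewrite comMl // !(comC _ x) // xg xh mulg1 nzc.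
    have [a1 [b1 egh]] := Oio_co _ (comO g h Gg Gh).
    exists (k2 + k1 + a1)%N, ((j2 + j1)./2 + 2 ^ a.-2 * b1)%N.
    rewrite sqM // g2 h2 egh -[io ^+ b1]expgM mulnC expgM.
    have -> : r ^+ ((j2 + j1)./2 + 2 ^ a.-2 * b1) ^+ 2 = r ^+ j2 * r ^+ j1 * (r0 ^+ b1) ^+ 2.
      rewrite expgD expgM -/r0 expgMn; last by apply: commuteX2; apply: commuteX.
      by rewrite -even_j ?expgD // oddD oj1 oj2.
    have czr i1 i2 : z ^+ i1 * r ^+ i2 = r ^+ i2 * z ^+ i1.
      by apply: commuteX2; apply: cen.
    have ac (a2 b2 c2 d2 : gT) : b2 * c2 = c2 * b2 -> a2 * b2 * (c2 * d2) = a2 * c2 * (b2 * d2).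
      by move=> e; rewrite -!mulgA (mulgA b2) e !mulgA.
    have e1 : r ^+ j2 * z ^+ k1 = z ^+ k1 * r ^+ j2 := esym (czr _ _).
    have e2 : r ^+ j2 * r ^+ j1 * z ^+ a1 = z ^+ a1 * (r ^+ j2 * r ^+ j1).
      by rewrite -expgD -czr.
    by rewrite !expgD (ac _ _ _ _ e1) (ac _ _ _ _ e2).
  have Grj : r ^- j \in 'Z(G) by rewrite groupV groupX.
  have Grj' := subsetP (center_sub G) _ Grj.
  pose f' := f * r ^- j; have Gf' : f' \in G by rewrite groupM.
  have com_f' u : u \in G -> [~ f', u] = [~ f, u].
    move=> Gu; rewrite comMl // (_ : [~ r ^- j, u] = 1) ?mulg1 //.
    by apply/eqP/commgP; apply: cenZ.
  have f'2z : f' ^+ 2 = z ^+ k.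
    rewrite expgMn; last by apply: commute_sym; apply: cenZ.
    by rewrite f2 expgVn mulgK.
  have ntf' : f' ^+ 2 != 1.
    have := nfu f 1 (r ^- j) Gf nf Grj; rewrite mulg1 !comm1g; apply; exact: group1.
  have f'2 : f' ^+ 2 = z.
    have: f' ^+ 2 \in <[z]> by rewrite f'2z mem_cycle.
    rewrite cycle2g; last by apply: nt_prime_order; rewrite ?O2.
    by rewrite !inE (negPf ntf') => /eqP.
  (* (f' u r1)^2 = [f, u] r1^2 is never 1 for central r1; take r1 = 1 and r1 = [r0]. *)
  have outio u : u \in [:: x; y; x * y] -> [~ f, u] \notin <[io]>.
    move=> /usq[Gu u2 ux uy].
    have e1 r1 : r1 \in 'Z(G) -> [~ f, u] * r1 ^+ 2 != 1.
      move=> Zr1; have Gr1 := subsetP (center_sub G) _ Zr1.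
      have := nfu f u (r ^- j * r1) Gf nf (groupM Grj Zr1) ux uy Gu.
      rewrite (_ : f * u * (r ^- j * r1) = f' * u * r1); last first.
        by rewrite /f' -!mulgA (mulgA u) -(cenZ _ _ Grj Gu) !mulgA.
      rewrite expgMn; last by apply: commute_sym; apply: cenZ; rewrite ?groupM.
      by rewrite sqM // f'2 u2 zz mul1g com_f'.
    rewrite cycle2g; last by apply: nt_prime_order; rewrite ?O2.
    rewrite !inE negb_or; apply/andP; split.
      by have := e1 1 (group1 _); rewrite expg1n mulg1.
    have := e1 r0 Zr0; apply: contra => /eqP->.
    by rewrite -/io -expg2 O2.
  have [ax [bx ex]] := Oio_co _ (comO f x Gf Gx).
  have [ay [by_ ey]] := Oio_co _ (comO f y Gf Gy).
  have := outio (x * y); rewrite !inE eqxx !orbT => /(_ isT).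
  have := outio x; rewrite !inE eqxx => /(_ isT).
  have := outio y; rewrite !inE eqxx orbT => /(_ isT).
  by rewrite comMr // ex ey EMio !inio; case: (ax); case: (ay).
have sqO f : f \in G -> f ^+ 2 \in Om by move=> /sqZ; rewrite ZOm.
(* The squares of f, fu and fv are not 1, which excludes the values 1, z and zc for f^2. *)
have L f u v : f \in G -> u \in G -> v \in G -> u ^+ 2 = z -> v ^+ 2 = z -> [~ u, v] = z ->
    [~ f, u] = 1 -> [~ f, v] = c -> f ^+ 2 = c.
  move=> Gf Gu Gv u2 v2 uv fu fv.
  have nO w w' : w \in G -> w' \in G -> [~ w, w'] != 1 -> w ^+ 2 != 1.
    by move=> Gw Gw'; apply: sqn1.
  have ntc := nz1 _ nzc.
  have f1 : f ^+ 2 != 1 by apply: (nO f v); rewrite // fv.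
  have ntzc : c * z != 1.
    by apply: contraNneq nzc => e; rewrite -(mulgK z c) e mul1g groupV cycle_id.
  have f2 : (f * u) ^+ 2 != 1 by apply: (nO _ v); rewrite ?groupM // comMl // fv uv.
  have f3 : (f * v) ^+ 2 != 1.
    by apply: (nO _ u); rewrite ?groupM // comMl // fu mul1g (comC v) // uv.
  move: f1 f2 f3; rewrite !sqM // u2 v2 fu fv mulg1.
  have [[] [[]]] := Ocoo _ (sqO f Gf) => ->; rewrite ?expg0 ?expg1 ?mulg1 ?mul1g //.
  - have zczc : z * c * z * c = 1 by rewrite -mulgA; apply: (O2 (z * c) (groupM Oz Oc)).
    by rewrite zczc eqxx.
  - by rewrite zz eqxx.
  by rewrite eqxx.
have yx : [~ y, x] = z by rewrite comC.
have hx : [~ h, x] = 1 by rewrite comC.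
have hy : [~ h, y] = c by rewrite comC.
have gx : [~ g, x] = c by rewrite comC.
have gy : [~ g, y] = 1 by rewrite comC.
have h2 : h ^+ 2 = c by apply: (L h x y).
have g2 : g ^+ 2 = c by apply: (L g y x).
have ghk k : k \in G -> [~ k, x] = 1 -> [~ k, y] = 1 -> (g * h * k) ^+ 2 = c.
  move=> Gk kx ky; apply: (L _ (x * y) x); rewrite ?groupM //.
    by rewrite !comMl ?groupM // !comMr // gx gy hx hy kx ky !mulg1 mul1g cc.
  by rewrite !comMl ?groupM // gx hx kx !mulg1.
have gh : [~ g, h] = c.
  have := ghk 1 (group1 G); rewrite !comm1g mulg1 => /(_ erefl erefl).
  by rewrite sqM // g2 h2 cc mul1g.
(* The squares of hk, gk and ghk are all c; comparing them gives k^2 = 1. *)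
have K k : k \in G -> [~ k, x] = 1 -> [~ k, y] = 1 -> k \in Om.
  move=> Gk kx ky; have Ok2 := sqO k Gk.
  have hk : k ^+ 2 * [~ h, k] = 1.
    have: (h * k) ^+ 2 = c.
      by apply: (L _ x y); rewrite ?groupM // comMl // ?hx ?hy ?kx ?ky mulg1.
    by rewrite sqM // h2 -mulgA => /(canRL (mulKg _)); rewrite mulVg.
  have gk : k ^+ 2 * [~ g, k] = 1.
    have: (g * k) ^+ 2 = c.
      by apply: (L _ y x); rewrite ?groupM // comMl // ?gx ?gy ?kx ?ky mulg1.
    by rewrite sqM // g2 -mulgA => /(canRL (mulKg _)); rewrite mulVg.
  have := ghk k Gk kx ky; rewrite sqM // comMl // (sqM g h) // g2 h2 gh cc mul1g.
  rewrite -mulgA => /(canRL (mulKg _)); rewrite mulVg mulgA gk mul1g => ehk.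
  by rewrite -Oexp // -hk ehk mulg1.
have ntc := nz1 _ nzc.
(* [E a b] is z^a c^b, kept abstract so that rewriting sees only addition of coordinates. *)
have [E [Ecoo E1 Ez Ec [EmM EZ EC EZC]]] : exists E : bool -> bool -> gT,
   [/\ forall t, t \in Om -> exists a b, t = E a b, 1 = E false false, z = E true false,
       c = E false true
     & [/\ forall a b a' b', E a b * E a' b' = E (a (+) a') (b (+) b'),
           forall a b, E a b = z ^+ a * c ^+ b,
           forall a b, (E a b \in <[c]>) = ~~ a
         & forall a b, (E a b \in <[z * c]>) = (a == b)]].
  exists (fun a b => z ^+ a * c ^+ b); split=> //; try (by split);
    by rewrite ?expg0 ?expg1 ?mulg1 ?mul1g.
have tG a b a' b' : y ^+ a * g ^+ b * x ^+ a' * h ^+ b' \in G by rewrite !groupM ?groupX.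
have bM u v (a : bool) : u \in G -> v \in G -> [~ u ^+ a, v] = [~ u, v] ^+ a.
  by move=> Gu Gv; case: a; rewrite ?expg1 // !expg0 comm1g.
have comt (a b a' b' : bool) v : v \in G ->
    [~ y ^+ a * g ^+ b * x ^+ a' * h ^+ b', v] =
    [~ y, v] ^+ a * [~ g, v] ^+ b * [~ x, v] ^+ a' * [~ h, v] ^+ b'.
  by move=> Gv; rewrite !comMl ?groupM ?groupX // !bM.
have Eb a b (k : bool) : E a b ^+ k = E (a && k) (b && k).
  by case: k; rewrite ?andbT ?andbF ?expg1 // expg0.
have hg : [~ h, g] = c by rewrite comC.
have tx (a b a' b' : bool) : [~ y ^+ a * g ^+ b * x ^+ a' * h ^+ b', x] = E a b.
  by rewrite comt // yx gx commgg hx E1 Ez Ec !Eb !EmM; case: (a); case: (b); case: (a'); case: (b').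
have ty (a b a' b' : bool) : [~ y ^+ a * g ^+ b * x ^+ a' * h ^+ b', y] = E a' b'.
  by rewrite comt // xy gy commgg hy E1 Ez Ec !Eb !EmM; case: (a); case: (b); case: (a'); case: (b').
have tg (a b a' b' : bool) : [~ y ^+ a * g ^+ b * x ^+ a' * h ^+ b', g] = E false (a' (+) b').
  by rewrite comt // yg xg commgg hg E1 Ec !Eb !EmM; case: (a); case: (b); case: (a'); case: (b').
have th (a b a' b' : bool) : [~ y ^+ a * g ^+ b * x ^+ a' * h ^+ b', h] = E false (a (+) b).
  by rewrite comt // -/c gh xh commgg E1 Ec !Eb !EmM; case: (a); case: (b); case: (a'); case: (b').
have bsq (u : gT) (a : bool) : (u ^+ a) ^+ 2 = (u ^+ 2) ^+ a.
  by rewrite -!expgM mulnC.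
have bMr u v (a : bool) : u \in G -> v \in G -> [~ u, v ^+ a] = [~ u, v] ^+ a.
  by move=> Gu Gv; case: a; rewrite ?expg1 // !expg0 commg1.
have t2 (a b a' b' : bool) : (y ^+ a * g ^+ b * x ^+ a' * h ^+ b') ^+ 2 =
    E (a (+) a' (+) (a && a')) (b (+) b' (+) (b && a') (+) ((a (+) b) && b')).
  rewrite !sqM ?groupM ?groupX // !bsq y2 g2 x2 h2 !comMl ?groupM ?groupX //.
  rewrite !bMr ?groupX // !bM // -/c gh xh yx gx yg E1 Ez Ec !Eb !EmM.
  by case: (a); case: (b); case: (a'); case: (b').
(* The exponents are read off [m, x] and [m, y]; the remaining factor commutes with x and y, so it
   is in [Om] by [K]. *)
have rep m : m \in G -> exists (a b a' b' : bool) w, w \in Om /\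
    m = w * (y ^+ a * g ^+ b * x ^+ a' * h ^+ b').
  move=> Gm; have [a [b eab]] := Ecoo _ (comO m x Gm Gx).
  have [a' [b' eab']] := Ecoo _ (comO m y Gm Gy).
  exists a, b, a', b'; set t := _ * h ^+ b'; have Gt : t \in G := tG _ _ _ _.
  have tV v : v \in G -> [~ t^-1, v] = [~ t, v].
    move=> Gv; have := comMl t t^-1 v Gt (groupVr Gt) Gv.
    rewrite mulgV comm1g => /esym/eqP; rewrite -eq_invg_mul => /eqP <-.
    by rewrite Oinv ?comO.
  exists (m * t^-1); split; last by rewrite mulgKV.
  apply: K; rewrite ?groupM ?groupV // comMl ?groupV // tV // ?eab ?eab'.
    by rewrite tx EmM !addbb -E1.
  by rewrite ty EmM !addbb -E1.
have sqm w t : w \in Om -> t \in G -> (w * t) ^+ 2 = t ^+ 2.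
  by move=> Ow Gt; rewrite (sqM _ _ (OG _ Ow) Gt) O2 // com0 // mulg1 mul1g.
have comm_m w t v : w \in Om -> t \in G -> v \in G -> [~ w * t, v] = [~ t, v].
  by move=> Ow Gt Gv; rewrite (comMl _ _ _ (OG _ Ow) Gt Gv) com0 // mul1g.
have comN m f (N : {group gT}) : m \in G -> f \in G -> [~ m, x] \in N -> [~ m, y] \in N ->
    [~ m, g] \in N -> [~ m, h] \in N -> [~ m, f] \in N.
  move=> Gm Gf mx my mg mh; have [a [b [a' [b' [w [Ow ->]]]]]] := rep f Gf.
  rewrite (comMr _ _ _ (OG _ Ow) (tG _ _ _ _) Gm) (comC m) ?(OG _ Ow) // com0 // mul1g.
  rewrite (_ : [~ m, _] = [~ m, y] ^+ a * [~ m, g] ^+ b * [~ m, x] ^+ a' * [~ m, h] ^+ b').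
    by rewrite !groupM // groupX.
  by rewrite !comMr ?groupM ?groupX // !bMr.
(* [P] describes [N] in coordinates, and [P2] says that its index in [Om] is at most 2. If m^2 is in
   [N], so are all commutators of m; if neither m^2 nor [m, f] is, their product is. *)
have main m f (N : {group gT}) (P : bool -> bool -> bool) : m \in G -> f \in G ->
    (forall a b, (E a b \in N) = P a b) ->
    (forall a b a' b', ~~ P a b -> ~~ P a' b' -> P (a (+) a') (b (+) b')) ->
    (forall (a b a' b' : bool), P (a (+) a' (+) (a && a'))
         (b (+) b' (+) (b && a') (+) ((a (+) b) && b')) ->
       [/\ P a b, P a' b', P false (a' (+) b') & P false (a (+) b)]) ->
    [~ m, f] \in N \/ m ^+ 2 * [~ m, f] \in N.
  move=> Gm Gf NP P2 Psq; have [e | ] := boolP (m ^+ 2 \in N).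
    left; have [a [b [a' [b' [w [Ow em]]]]]] := rep m Gm.
    move: e; rewrite em sqm // t2 NP => /Psq[P1 P3 P4 P5].
    by apply: comN; rewrite ?(groupM (OG _ Ow) (tG _ _ _ _)) // comm_m // ?tx ?ty ?tg ?th NP.
  have [a1 [b1 ->]] := Ecoo _ (sqO m Gm); have [a3 [b3 ->]] := Ecoo _ (comO m f Gm Gf).
  rewrite !NP EmM NP => n1; have [| n2] := boolP (P a3 b3); first by left.
  by right; apply: P2.
exists c; rewrite /Q8Q8_like ZOm; split; try (by [] || exact: O2).
split=> //.
- move=> m Gm nOm; have [a [b [a' [b' [w [Ow em]]]]]] := rep m Gm.
  have ct v : v \in G -> [~ m, v] = [~ y ^+ a * g ^+ b * x ^+ a' * h ^+ b', v].
    by move=> Gv; rewrite em comm_m.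
  have zcE : z * c = E true true by rewrite EZ.
  have fin v k : v \in G -> [~ m, v] = E k true ->
      exists2 f, f \in G & [~ m, f] = c \/ [~ m, f] = z * c.
    by move=> Gv e; exists v; rewrite // e zcE Ec; case: (k); [right | left].
  case: b em ct => em ct; first by apply: (fin x a); rewrite // ct // tx.
  case: b' em ct => em ct; first by apply: (fin y a'); rewrite // ct // ty.
  case: a' em ct => em ct; first by apply: (fin g false); rewrite // ct // tg.
  case: a em ct => em ct; first by apply: (fin h false); rewrite // ct // th.
  by case/negP: nOm; rewrite em !expg0 !mulg1.
split=> // m f Gm Gf.
- apply: (main m f <[c]>%G (fun a _ => ~~ a)) => //; first by do 4!case.
  by do 4!case.
apply: (main m f <[z * c]>%G (fun a b => a == b)) => //; first by do 4!case.
by do 4!case.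
Qed.

Lemma not_SSN_witness (gT : finGroupType) (G : {group gT}) :
  has_SSN G \/ exists H N Y : {group gT},
    [/\ H \subset G, N <| H, Y \subset H, ~~ (N \subset Y) & ~~ (N <*> Y <| H)].
Proof.
have [/existsP[H /existsP[N /existsP[Y /and5P[]]]] | ] := boolP
   [exists H : {group gT}, exists N : {group gT}, exists Y : {group gT},
     [&& H \subset G, N <| H, Y \subset H, ~~ (N \subset Y) & ~~ (N <*> Y <| H)]].
  by right; exists H, N, Y.
move=> noH; left=> H sHG N Y nNH sYH.
have [sNY | nNY] := boolP (N \subset Y); [by left | right].
rewrite -norm_joinEr ?(subset_trans sYH (normal_norm nNH)) //.
apply: contraR noH => nn; apply/existsP; exists H; apply/existsP; exists N.
by apply/existsP; exists Y; apply/and5P.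
Qed.

(** If SSN fails, some nonnormal U = NY is noncyclic, hence Q8, and meets [Om] in its center <z>. An
    x in [N] outside [Y] and a y in [Y] start the configuration of [Q8Q8_structure]. *)
Lemma bicentral_SN (gT : finGroupType) (p : nat) (G Om : {group gT}) :
    prime p -> p.-group G -> has_SN G -> bicentral p G Om ->
  has_SSN G \/ (p = 2 /\ exists z c, Q8Q8_like G z c).
Proof.
move=> p_pr pG SNG bOm; have [sOZ oO Oexp dO] := bOm.
have [| [H [N [Y [sHG nNH sYH nNY nnU]]]]] := not_SSN_witness G; first by left.
right; set U := (N <*> Y)%G in nnU.
have sUH : U \subset H by rewrite join_subG normal_sub.
have sUG := subset_trans sUH sHG.
have pU := pgroupS sUG pG.
have ncU : ~~ cyclic U.
  apply/negP=> cU.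
  case/orP: (cyclic_chain pU cU (joing_subl N Y) (joing_subr N Y)); first by rewrite (negPf nNY).
  by move/joing_idPl=> e; case/negP: nnU; rewrite /= e.
have nnUG : ~~ (U <| G) by apply: contra nnU; apply: normalS.
have [p2 [x0 [y0 [Ux0 Uy0 defU xy0 [y02 c0 ntz z2]]]]] :=
  bicentral_nonnormal_Q8 p_pr pG bOm sUG nnUG ncU.
split=> //; set z := x0 ^+ 2 in y02 c0 ntz.
rewrite p2 in pG Oexp oO.
have zz : z * z = 1 by rewrite /z -expgD.
have oz : #[z] = 2 by apply: nt_prime_order; rewrite // expgS expg1.
have Uz : z \in U by rewrite groupX.
have Gz : z \in G := subsetP sUG z Uz.
have Oz : z \in Om by rewrite -Oexp // expgS expg1 zz.
have Zz : z \in 'Z(G) := subsetP sOZ z Oz.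
have nzG : <[z]> <| G := central_cycle_normal Zz.
have inN u : u \in G -> u \in 'N(<[z]>) := subsetP (normal_norm nzG) u.
have [Gx0 Gy0] := (subsetP sUG x0 Ux0, subsetP sUG y0 Uy0).
pose K := coset <[z]>.
have Kz : K z = 1 by apply: coset_id; rewrite cycle_id.
have Kxy : commute (K x0) (K y0).
  by apply/commgP; rewrite -[[~ _, _]](morphR (coset_morphism <[z]>)) ?inN //= c0 -/z [coset _ _]Kz.
have Kx : K x0 ^+ 2 = 1 by rewrite -morphX ?inN //; apply: Kz.
have Ky : K y0 ^+ 2 = 1 by rewrite -morphX ?inN //= y02; apply: Kz.
have KU u : u \in U -> exists i j, K u = K x0 ^+ i * K y0 ^+ j.
  rewrite -defU => /mulsgP[_ _ /cycleP[i ->] /cycleP[j ->] ->]; exists i, j.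
  by rewrite /K morphM ?inN ?groupX // !morphX ?inN.
have Usq u : u \in U -> u ^+ 2 \in <[z]>.
  move=> Uu; have Gu := subsetP sUG u Uu; apply: coset_idr; rewrite ?inN ?groupX //.
  rewrite morphX ?inN //=; have [i [j]] := KU u Uu; rewrite /K => ->.
  rewrite expgMn; last by apply: commuteX2.
  by rewrite -!expgM mulnC expgM [_ ^+ 2]Kx expg1n mul1g mulnC expgM [_ ^+ 2]Ky expg1n.
have Ucom u v : u \in U -> v \in U -> [~ u, v] \in <[z]>.
  move=> Uu Uv; have [Gu Gv] := (subsetP sUG u Uu, subsetP sUG v Uv).
  apply: coset_idr; rewrite ?inN ?groupR // morphR ?inN //=; apply/eqP/commgP.
  have [i [j]] := KU u Uu; have [k [l]] := KU v Uv; rewrite /K => -> ->.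
  by apply: commuteM; apply: commute_sym; apply: commuteM; apply: commuteX2.
have uz u : u \in U -> u ^+ 2 = 1 -> u \in <[z]>.
  move=> Uu u2; have Gu := subsetP sUG u Uu.
  have nOU : ~~ (Om \subset U) by apply: contra nnUG => /dO->.
  have bOm2 : bicentral 2 G Om by rewrite -p2.
  have ntU : U :!=: 1 by apply: contraNneq ncU => ->; apply: cyclic1.
  have [s [Us Os s2 nts uniq]] := bicentral_uniq (isT : prime 2) pG bOm2 sUG nOU ntU.
  have zs : z \in <[s]> := uniq z Uz Oz.
  have: s \in <[z]> by apply: (@cycle_cyclic_exp _ 2 <[s]>%G) => //; rewrite ?cycle_cyclic ?cycle_id // expgS expg1.
  rewrite -cycle_subG => /subsetP; apply; apply: uniq => //; by rewrite -Oexp // u2.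
have zE : <[z]> = [set 1; z] by rewrite cycle2g.
have UO t : t \in U -> t \in Om -> t \in <[z]>.
  by move=> Ut Ot; apply: uz => //; apply/eqP; rewrite Oexp // (subsetP sUG).
have sq u : u \in U -> u \notin <[z]> -> u ^+ 2 = z.
  move=> Uu nzu; have := Usq u Uu; rewrite zE !inE => /orP[] /eqP // u2.
  by case/negP: nzu; apply: uz.
have sNU : N \subset U := joing_subl N Y.
have sYU : Y \subset U := joing_subr N Y.
have ntY : Y :!=: 1.
  by apply: contraNneq nnU => Y1; rewrite /= Y1 joingG1.
have sub_z (A : {group gT}) : A \subset U -> A :!=: 1 -> z \in A.
  move=> sAU ntA; have [_ p_dv _] := pgroup_pdiv (pgroupS sAU pU) ntA; rewrite p2 in p_dv.
  have [t At ot] := Cauchy (isT : prime 2) p_dv.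
  have: t \in <[z]> by apply: uz; rewrite ?(subsetP sAU) // -ot expg_order.
  rewrite zE !inE => /orP[] /eqP et; last by rewrite -et.
  by move: ot; rewrite et order1.
have Yz : z \in Y := sub_z Y sYU ntY.
have [x Nx nYx] := subsetPn nNY.
have Ux := subsetP sNU x Nx; have Gx := subsetP sUG x Ux; have Hx := subsetP sUH x Ux.
have nzx : x \notin <[z]> by apply: contra nYx; apply: subsetP; rewrite cycle_subG.
have x2 := sq x Ux nzx.
have SNb := SN_quotient nzG SNG.
have pGb : 2.-group (G / <[z]>) := quotient_pgroup _ pG.
have GKG t : t \in G -> K t \in G / <[z]> by move=> Gt; apply: mem_quotient.
have szU : <[z]> \subset U by rewrite cycle_subG.
have nnUb : ~~ (U / <[z]> <| G / <[z]>) by apply: contra nnUG; apply: normal_quo_inv.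
have O2 t : t \in Om -> t ^+ 2 = 1.
  by move=> Ot; apply/eqP; rewrite Oexp // (subsetP (center_sub G)) // (subsetP sOZ).
have OG t : t \in Om -> t \in G by move=> Ot; rewrite (subsetP (center_sub G)) // (subsetP sOZ).
have [c Oc nzc] : exists2 c, c \in Om & c \notin <[z]>.
  by apply/subsetPn/negP=> /subset_leq_card; rewrite oO -orderE oz.
have KM t u : t \in G -> u \in G -> K (t * u) = K t * K u by move=> Gt Gu; rewrite /K morphM ?inN.
have K1 t : t \in G -> K t = 1 -> t \in <[z]>.
  by move=> Gt; apply: coset_idr; rewrite inN.
(* Otherwise G / <z> is bicentral, and its Omega_1, of order 4, must be U / <z>. It contains the
   image of [c], so [c] would lie in [U], against [UO]. *)
have cZb : cyclic 'Z(G / <[z]>).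
  apply: contraT => ncZ; have [Ob bOb] := SN_noncyclic_center (isT : prime 2) pGb SNb (quotientS _ sUG) nnUb ncZ.
  have [sObZ oOb Obexp _] := bOb.
  have KO t : t \in G -> t ^+ 2 \in <[z]> -> K t \in Ob.
    by move=> Gt t2; rewrite -Obexp ?GKG // -morphX ?inN //= coset_id.
  have Ox0 : K x0 \in Ob by apply: KO => //; rewrite cycle_id.
  have Oy0 : K y0 \in Ob by apply: KO => //; rewrite y02 cycle_id.
  have OcK : K c \in Ob by apply: KO; rewrite ?OG // O2.
  suffices sOU : Ob \subset U / <[z]>.
    have /morphimP[v Nv Uv ecv] := subsetP sOU _ OcK.
    have Gv := subsetP sUG v Uv.
    have [t zt ect] := coset_eq (inN _ (OG c Oc)) Nv ecv.
    by case/negP: nzc; apply: UO; rewrite // ect groupM // (subsetP szU).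
  suffices <- : U / <[z]> = Ob by [].
  apply/eqP; rewrite eqEcard; apply/andP; split.
    apply/subsetP=> _ /morphimP[v Nv Uv ->]; apply: KO; rewrite ?Usq ?(subsetP sUG) //.
  rewrite oOb leqNgt; apply: contra ntz => lt4; rewrite -c0; apply/commgP.
  suffices abU : abelian U by apply: (centsP abU).
  have szZU : <[z]> \subset 'Z(U).
    rewrite cycle_subG; apply/centerP; split=> // v Uv; apply: commute_sym.
    exact: (centerC (subsetP sUG v Uv)).
  apply: (cyclic_factor_abelian szZU); have [k ek] := p_natP (quotient_pgroup <[z]> pU).
  rewrite p2 in ek; move: lt4; rewrite ek ltn_exp2l // => k_lt2.
  have [k0 | k_neq0] := eqVneq k 0%N.
    by rewrite (card1_trivg (_ : #|U / <[z]>| = 1%N)) ?cyclic1 // ek k0.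
  by apply: prime_cyclic; rewrite ek (_ : k = 1%N) //; case: (k) k_lt2 k_neq0 => [|[]].
have ntGb : G / <[z]> != 1.
  by apply/trivgPn; exists (K c); [apply: GKG; rewrite OG | apply: contra nzc => /eqP/K1->; rewrite ?OG].
have [nSb oSb sSZb minSb] := monolith_of_cyclic_center pGb ntGb cZb.
set Sb := 'Ohm_1(_)%G in nSb oSb sSZb minSb.
have nOG : Om <| G := sub_center_normal sOZ.
have eSb : Om / <[z]> = Sb.
  apply/esym/eqP; rewrite eqEcard minSb ?quotient_normal //=.
    rewrite oSb card_quotient ?(subset_trans (normal_sub nOG)) ?normal_norm //.
    by rewrite -divgS ?cycle_subG // oO -orderE oz.
  by apply/trivgPn; exists (K c); [apply: mem_quotient | apply: contra nzc => /eqP/K1->; rewrite ?OG].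
have szO : <[z]> \subset Om by rewrite cycle_subG.
(* Om / <z> is the smallest normal subgroup of G / <z>, and the quotient by it is Dedekind since all
   subgroups above [Om] are normal. *)
have dO' : G^`(1) \subset Om.
  have dGb : dedekind (G / <[z]> / Sb)%G.
    apply/(dedekind_quoP nSb) => Xb sSX sXG.
    have [X eX szX sXG'] := inv_quotientS nzG sXG.
    rewrite eX; apply: quotient_normal; apply: dO => //.
    by rewrite -(quotientSGK _ szX) ?(subset_trans (normal_sub nOG)) ?normal_norm // -eX /= eSb.
  have := monolith_dedekind_quotient (isT : prime 2) pGb (And4 nSb oSb sSZb minSb) dGb.
  rewrite -eSb -quotient_der ?normal_norm // quotientSGK //.
  by rewrite (subset_trans (der_sub 1 G)) ?normal_norm.
have comO a b : a \in G -> b \in G -> [~ a, b] \in Om.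
  by move=> Ga Gb; rewrite (subsetP dO') ?mem_commg.
have nN h : h \in H -> [~ x, h] \in <[z]>.
  move=> Hh; apply: UO; rewrite ?comO ?(subsetP sHG) //; apply: (subsetP sNU).
  by rewrite commgEl groupM ?groupV // memJ_norm // (subsetP (normal_norm nNH)).
have [y [h [Yy Hh yh]]] : exists y h, [/\ y \in Y, h \in H & [~ y, h] \notin <[z]>].
  have [/existsP[y /existsP[h /and3P[]]] | ] :=
    boolP [exists y, exists h, [&& y \in Y, h \in H & [~ y, h] \notin <[z]>]].
    by exists y, h.
  move=> noy; case/negP: nnU; rewrite /normal sUH; apply/normsP=> h Hh.
  apply/eqP; rewrite eqEcard cardJg leqnn andbT conjYg.
  have -> : N :^ h = N by apply: (normP (subsetP (normal_norm nNH) h Hh)).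
  rewrite join_subG joing_subl /=; apply/subsetP=> _ /imsetP[y Yy ->].
  rewrite -(mulKVg y (y ^ h)) -commgEl groupM //; first by rewrite (subsetP sYU).
  have: [~ y, h] \in <[z]>.
    apply: contraR noy => nyh; apply/existsP; exists y; apply/existsP; exists h.
    by rewrite Yy Hh.
  by apply: subsetP; rewrite (subset_trans szU).
have Uy := subsetP sYU y Yy; have Gy := subsetP sUG y Uy; have Gh := subsetP sHG h Hh.
have nzy : y \notin <[z]>.
  apply: contra yh => zy; rewrite (_ : [~ y, h] = 1) ?group1 //; apply/eqP/commgP.
  apply: commute_sym; apply: (centerC Gh); apply: (subsetP _ y zy).
  by rewrite cycle_subG.
have y2 := sq y Uy nzy.
(* If x and y commuted, (xy)^2 = z^2 = 1 would put xy in <z> <= Y, hence x in [Y]. *)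
have xy : [~ x, y] = z.
  have := Ucom x y Ux Uy; rewrite zE !inE => /orP[] /eqP // xy1.
  have cxy : commute x y by apply/commgP; rewrite xy1.
  have xy_z : x * y \in <[z]>.
    by apply: uz; rewrite ?groupM // expgMn // x2 y2.
  case/negP: nYx; rewrite -(groupMr _ Yy); apply: (subsetP _ _ xy_z).
  by rewrite cycle_subG.
(* Otherwise <x> is normal, and SN makes <x><y> normal; then [y, h] lies in both [U] and [Om], hence
   in <z>. *)
have [g Gg xg] : exists2 g, g \in G & [~ x, g] \notin <[z]>.
  have [/existsP[g /andP[]] | ] := boolP [exists g, (g \in G) && ([~ x, g] \notin <[z]>)].
    by exists g.
  rewrite negb_exists => /forallP allg.
  have nx : <[x]> <| G.
    rewrite /normal cycle_subG Gx; apply/subsetP=> g Gg; rewrite inE -cycleJ cycle_subG.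
    rewrite -(mulKVg x (x ^ g)) -commgEl groupM ?cycle_id //.
    have := allg g; rewrite Gg negbK; apply: subsetP.
    by rewrite cycle_subG -x2 mem_cycle.
  have syG : <[y]> \subset G by rewrite cycle_subG.
  have [] := SNG <[x]>%G <[y]>%G nx syG.
    rewrite cycle_subG => /cycleP[i ex]; case/eqP: ntz; rewrite -xy ex.
    by apply/eqP/commgP; apply: commute_sym; apply: commuteX.
  move=> nxy; have sxyU : <[x]> * <[y]> \subset U by rewrite mul_subG ?cycle_subG.
  rewrite /= -norm_joinEr in nxy sxyU; last first.
    exact: subset_trans syG (normal_norm nx).
  case/negP: yh; apply: UO; last exact: comO.
  have yJ : y \in <[x]> <*> <[y]> by rewrite -cycle_subG joing_subr.
  apply: (subsetP sxyU); rewrite commgEl groupM ?groupV // memJ_norm //.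
  by rewrite (subsetP (normal_norm nxy)).
have cycZq : cyclic ('Z(G) / <[z]>).
  apply: cyclicS cZb; exact: morphim_center.
have [c1 Hc1] := Q8Q8_structure pG sOZ oO (fun t Gt => Oexp t Gt) dO' cycZq ntz Gx Gy Gh Gg
  x2 y2 xy (nN h Hh) yh xg.
by exists z, c1.
Qed.

Theorem SN_pgroup (gT : finGroupType) (p : nat) (G X : {group gT}) :
    prime p -> p.-group G -> has_SN G -> X \subset G -> ~~ (X <| G) ->
  [\/ has_SSN G,
      exists S : {group gT}, [/\ monolith p G S, G^`(1) \subset S & cyclic 'Z(G)]
    | exists z c, p = 2 /\ Q8Q8_like G z c].
Proof.
move=> p_pr pG SNG sXG nnX.
have [cZ | ncZ] := boolP (cyclic 'Z(G)); last first.
  have [Om bOm] := SN_noncyclic_center p_pr pG SNG sXG nnX ncZ.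
  have [ssn | [p2 [z [c zc]]]] := bicentral_SN p_pr pG SNG bOm; first by constructor 1.
  by constructor 3; exists z, c.
have ntG : G :!=: 1.
  apply: contraNneq nnX => G1; rewrite (_ : X = G) ?normal_refl //.
  by apply/val_inj/eqP; rewrite eqEsubset sXG /= G1 sub1G.
have monS := monolith_of_cyclic_center pG ntG cZ.
set S := 'Ohm_1(_)%G in monS; have [nSG _ _ _] := monS.
have [/forallP dS | ] := boolP [forall Y : {group gT}, (S \subset Y) && (Y \subset G) ==> (Y <| G)].
  constructor 2; exists S; split=> //.
  apply: (monolith_dedekind_quotient p_pr pG monS); apply/(dedekind_quoP nSG) => Y sSY sYG.
  by apply: (implyP (dS Y)); apply/andP.
rewrite negb_forall => /existsP[Y]; rewrite negb_imply => /andP[/andP[sSY sYG] nnY].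
constructor 1; apply: (noncyclic_normal_SSN pG) => U sUG ncU.
exact: (SN_monolith_noncyclic_normal (ltnSn _) p_pr pG SNG monS sSY sYG nnY).
Qed.

(** * Rational group rings *)

Import GRing.Theory.
Local Open Scope ring_scope.

(** * Primitive idempotents and the Wedderburn decomposition *)

Lemma corner_exists (F : fieldType) (A : falgType F) (e : A) :
  e * e = e -> e != 0 ->
  exists C : {aspace A}, (forall x, (x \in C) = (e * x * e == x)) /\ algid C = e.
Proof.
move=> ee nz_e; pose U := limg (amulr e \o amull e)%VF.
have memU x : (x \in U) = (e * x * e == x).
  apply/memv_imgP/eqP=> [[y _ ->] | <-].
    by rewrite comp_lfunE !lfunE /= !mulrA ee -!mulrA ee.
  by exists x; rewrite ?memvf // comp_lfunE !lfunE.
have Ue : e \in U by rewrite memU ee ee.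
have Uid x : x \in U -> e * x = x /\ x * e = x.
  by rewrite memU => /eqP <-; rewrite !mulrA ee -!mulrA ee.
have aU : is_aspace U.
  apply/andP; split; first by apply/has_algidP; exists e; split.
  apply/prodvP=> x y /Uid[ex _] /Uid[_ ye].
  by rewrite memU mulrA ex -mulrA ye.
exists (ASpace aU); split=> //.
by rewrite -[LHS](Uid _ (memv_algid U)).1 (algidr (A := ASpace aU)).
Qed.

Definition von_neumann_regular (R : pzRingType) := forall a : R, exists x, a * x * a = a.

Definition primitive_idem (R : pzRingType) (e : R) :=
  [/\ e != 0, e * e = e & forall f, f * f = f -> e * f * e = f -> f = 0 \/ f = e].

Definition orth_idem (R : pzRingType) (s : seq R) :=
  uniq s /\ {in s &, forall e f, e != f -> e * f = 0}.

(** Induction on the dimension of the corner e A e: a nonprimitive e splits as f + (e - f), with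
    smaller corners. Primitivity quantifies over the whole algebra, hence the classical case
    distinction. *)
Lemma primitive_idem_sum (F : fieldType) (A : falgType F) (e : A) :
  e * e = e -> exists s : seq A, [/\ orth_idem s, \sum_(f <- s) f = e &
    forall f, f \in s -> primitive_idem f /\ e * f * e = f].
Proof.
pose U (e : A) := limg (amulr e \o amull e)%VF.
have memU e1 x : e1 * e1 = e1 -> (x \in U e1) = (e1 * x * e1 == x).
  move=> ee; apply/memv_imgP/eqP=> [[y _ ->] | <-].
    by rewrite comp_lfunE !lfunE /= !mulrA ee -!mulrA ee.
  by exists x; rewrite ?memvf // comp_lfunE !lfunE.
have [n] := ubnP (\dim (U e)); elim: n e => // n IHn e le_n ee.
have [-> | nz_e] := eqVneq e 0.
  by exists [::]; rewrite big_nil; split=> //; split.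
have [prim | nprim] := Classical_Prop.classic (primitive_idem e).
  exists [:: e]; rewrite big_seq1; split=> //.
    by split=> // x y; rewrite !inE => /eqP-> /eqP->; rewrite eqxx.
  by move=> x; rewrite inE => /eqP->; rewrite !ee.
have [f [ff efe nz_f ne_f]] : exists f, [/\ f * f = f, e * f * e = f, f != 0 & f != e].
  apply: Classical_Prop.NNPP => nof; apply: nprim; split=> // f ff efe.
  have [-> | nzf] := eqVneq f 0; [by left | right].
  by apply/eqP; apply: contraT => ne; case: nof; exists f.
have ef : e * f = f by rewrite -efe !mulrA ee.
have fe : f * e = f by rewrite -efe -!mulrA ee.
pose g := e - f.
have gg : g * g = g by rewrite /g mulrBl !mulrBr ee ef fe ff subrr subr0.
have fg : f * g = 0 by rewrite /g mulrBr fe ff subrr.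
have gf : g * f = 0 by rewrite /g mulrBl ef ff subrr.
have eg : e * g = g by rewrite /g mulrBr ee ef.
have ge : g * e = g by rewrite /g mulrBl ee fe.
have sub e1 : e1 * e1 = e1 -> e * e1 = e1 -> e1 * e = e1 -> e1 != e -> (\dim (U e1) < n)%N.
  move=> e11 ee1 e1e ne; rewrite ltnS in le_n; apply: leq_trans le_n.
  rewrite (ltn_leqif (dimv_leqif_sup _)).
    apply/negP=> /subvP/(_ e); rewrite !memU // !ee eqxx => /(_ isT).
    by rewrite e1e e11 (negPf ne).
  by apply/subvP=> x; rewrite !memU // => /eqP <-; rewrite !mulrA ee1 -!mulrA e1e.
have [|s1 [[u1 o1] S1 p1]] := IHn f _ ff; first exact: sub.
have [|s2 [[u2 o2] S2 p2]] := IHn g _ gg.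
  by apply: sub => //; apply: contra nz_f => /eqP eg'; rewrite -ef -eg' gf.
exists (s1 ++ s2); rewrite big_cat /= S1 S2 addrC subrK.
have o12 x y : x \in s1 -> y \in s2 -> x * y = 0 /\ y * x = 0.
  move=> /p1[_ <-] /p2[_ <-]; rewrite -!mulrA (mulrA f g) fg (mulrA g f) gf.
  by rewrite !(mul0r, mulr0).
split=> //.
  split.
    rewrite cat_uniq u1 u2 andbT; apply/hasPn=> x s2x; apply/negP=> /= s1x.
    have [[nzx xx _] _] := p1 x s1x; case/eqP: nzx; rewrite -xx.
    by case: (o12 x x s1x s2x).
  move=> x y; rewrite !mem_cat => /orP[] sx /orP[] sy ne.
  - exact: o1.
  - by case: (o12 x y sx sy).
  - by case: (o12 y x sy sx).
  exact: o2.
move=> x; rewrite mem_cat => /orP[/p1 | /p2] [px ex]; split=> //; rewrite -ex.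
  by rewrite !mulrA ef -!mulrA fe.
by rewrite !mulrA eg -!mulrA ge.
Qed.

(** Write 1 as a sum of orthogonal primitive idempotents [eps i]. By regularity a nonzero u in eps_i
    A eps_j has a v with u v = eps_i and v u = eps_j, so the existence of such a u is an equivalence
    relation on indices. Its classes give the blocks, and corners eps_i A eps_i the division
    algebras. *)
Lemma artin_wedderburn (F : fieldType) (A : falgType F) : von_neumann_regular A ->
  exists (k : nat) (n : 'I_k -> nat) (D : 'I_k -> falgType F)
         (f : forall i : 'I_k, A -> 'M[D i]_(n i)),
  [/\ forall i, (0 < n i)%N,
      forall i (d : D i), d != 0 -> d \is a GRing.unit,
      forall i (a : F) x y, f i (a *: x + y) = map_mx (fun d : D i => a *: d) (f i x) + f i y,
      forall i x y, f i (x * y) = f i x *m f i y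
    & [/\ forall i, f i 1 = 1%:M,
          forall x y, (forall i, f i x = f i y) -> x = y
        & forall z : (forall i, 'M[D i]_(n i)), exists x, forall i, f i x = z i]].
Proof.
move=> regA.
have [s [[us os] sum1 prim_s]] := primitive_idem_sum (mulr1 (1 : A)).
pose m := size s; pose eps (i : 'I_m) := s`_i.
have seps i : eps i \in s by apply: mem_nth.
have prim i : primitive_idem (eps i) by case: (prim_s _ (seps i)).
have nz i : eps i != 0 by case: (prim i).
have idem i : eps i * eps i = eps i by case: (prim i).
have orth i j : i != j -> eps i * eps j = 0.
  by move=> ne; apply: os; rewrite ?seps // nth_uniq.
have sum_eps : \sum_i eps i = 1 by rewrite -sum1 (big_nth 0) big_mkord.
pose lin i j := (amulr (eps j) \o amull (eps i))%VF.
have linE i j x : lin i j x = eps i * x * eps j by rewrite comp_lfunE !lfunE.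
pose R i j := lin i j != 0.
have RP i j : reflect (exists x, eps i * x * eps j != 0) (R i j).
  apply: (iffP idP) => [Rij | [x nzx]]; last first.
    by apply: contraNneq nzx => l0; rewrite -linE l0 lfunE.
  apply: Classical_Prop.NNPP => nox; case/eqP: Rij; apply/lfunP=> x; rewrite linE lfunE /=.
  by apply/eqP; apply: contraT => nzx; case: nox; exists x.
have R0 i j x : ~~ R i j -> eps i * x * eps j = 0.
  by move=> nR; apply/eqP; apply: contraR nR => nzx; apply/RP; exists x.
(* u x u = u makes u v and v u nonzero idempotents in the corners of eps_i and eps_j; primitivity
   identifies them. *)
have Runits i j : R i j -> exists uv : A * A, [/\ eps i * uv.1 * eps j = uv.1,
    eps j * uv.2 * eps i = uv.2, uv.1 * uv.2 = eps i & uv.2 * uv.1 = eps j].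
  case/RP=> x0; set u := _ * _ * _ => nzu.
  have ue : eps i * u * eps j = u by rewrite /u !mulrA idem -!mulrA idem.
  clearbody u; have eu : eps i * u = u by rewrite -ue !mulrA idem.
  have ue' : u * eps j = u by rewrite -ue -!mulrA idem.
  have [x uxu] := regA u; pose v := eps j * x * eps i.
  have uv : u * v = u * x * eps i by rewrite /v !mulrA ue'.
  have vu : v * u = eps j * x * u by rewrite /v -!mulrA eu.
  have uvu : u * v * u = u by rewrite uv -!mulrA eu mulrA uxu.
  exists (u, v); split=> //=.
  - by rewrite /v !mulrA idem -!mulrA idem.
  - have [_ _ /(_ (u * v))[]] // := prim i.
    + by rewrite mulrA uvu.
    + by rewrite uv !mulrA eu -!mulrA idem.
    by move=> uv0; case/eqP: nzu; rewrite -uvu uv0 mul0r.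
  have [_ _ /(_ (v * u))[]] // := prim j.
  + by rewrite -mulrA (mulrA u) uvu.
  + by rewrite vu !mulrA idem -!mulrA ue'.
  by move=> vu0; case/eqP: nzu; rewrite -uvu -mulrA vu0 mulr0.
have Rrefl i : R i i by apply/RP; exists 1; rewrite mulr1 idem.
have Rsym i j : R i j -> R j i.
  case/Runits=> -[u v] /= [eu ev uv vu]; apply/RP; exists v; rewrite ev.
  by apply: contraNneq (nz i) => v0; rewrite -uv v0 mulr0.
have Rtrans i j k : R i j -> R j k -> R i k.
  move=> /Runits[[u v] /= [eu ev uv vu]] /Runits[[u' v'] /= [eu' ev' uv' vu']].
  apply/RP; exists (u * u').
  have -> : eps i * (u * u') * eps k = u * u' by rewrite -eu -eu' !mulrA idem -!mulrA idem.
  apply: contraNneq (nz i) => uu0.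
  have : u * u' * v' * v = eps i by rewrite -(mulrA u) uv' -{1}eu -!mulrA (mulrA (eps j)) idem mulrA !mulrA eu uv.
  by rewrite uu0 !mul0r => <-.
(* A representative of the class of i; the default is never reached because [R] is reflexive. *)
pose rep i := odflt i [pick j | R i j].
have Rrep i : R i (rep i) by rewrite /rep; case: pickP => [j // | /(_ i)]; rewrite Rrefl.
have repE i j : R i j -> rep i = rep j.
  move=> Rij; rewrite /rep (eq_pick (_ : R i =1 R j)); last first.
    by move=> k; apply/idP/idP; [apply: Rtrans; apply: Rsym | apply: Rtrans].
  by case: pickP => [// | /(_ j)]; rewrite Rrefl.
have rep_id i : rep (rep i) = rep i by rewrite -(repE _ _ (Rrep i)).
pose reps := [set i | rep i == i]; pose k := #|reps|.
pose r (a : 'I_k) : 'I_m := enum_val a.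
have rrep a : rep (r a) = r a by have := enum_valP a; rewrite inE => /eqP.
have r_inj : injective r by apply: enum_val_inj.
pose cls (a : 'I_k) := [set i | rep i == r a].
pose n a := #|cls a|; pose g a (p : 'I_(n a)) : 'I_m := enum_val p.
have rg a (p : 'I_(n a)) : rep (g a p) = r a by have := enum_valP p; rewrite inE => /eqP.
have g_inj a : injective (g a) by apply: enum_val_inj.
have [C HC] : exists C : 'I_k -> {aspace A}, forall a,
   (forall x, (x \in C a) = (eps (r a) * x * eps (r a) == x)) /\ algid (C a) = eps (r a).
  by apply: (fin_all_exists (P := fun a (Ca : {aspace A}) => (forall x, (x \in Ca) = (eps (r a) * x * eps (r a) == x)) /\ algid Ca = eps (r a))) => a; apply: corner_exists.
(* These pairs transport between the corner of i and that of its representative, as matrix units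
   would. *)
have [UV HUV] : exists UV : 'I_m -> A * A, forall i,
  [/\ eps i * (UV i).1 * eps (rep i) = (UV i).1, eps (rep i) * (UV i).2 * eps i = (UV i).2,
      (UV i).1 * (UV i).2 = eps i & (UV i).2 * (UV i).1 = eps (rep i)].
  by apply: (fin_all_exists (P := fun i (UVi : A * A) =>   [/\ eps i * UVi.1 * eps (rep i) = UVi.1, eps (rep i) * UVi.2 * eps i = UVi.2,
      UVi.1 * UVi.2 = eps i & UVi.2 * UVi.1 = eps (rep i)])) => i; apply: Runits.
pose U i := (UV i).1; pose V i := (UV i).2.
have eU i : eps i * U i = U i by rewrite /U; have [<- _ _ _] := HUV i; rewrite !mulrA idem.
have Ue i : U i * eps (rep i) = U i by rewrite /U; have [<- _ _ _] := HUV i; rewrite -!mulrA idem.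
have eV i : eps (rep i) * V i = V i by rewrite /V; have [_ <- _ _] := HUV i; rewrite !mulrA idem.
have Ve i : V i * eps i = V i by rewrite /V; have [_ <- _ _] := HUV i; rewrite -!mulrA idem.
have UVe i : U i * V i = eps i by have [] := HUV i.
have VUe i : V i * U i = eps (rep i) by have [] := HUV i.
have VU0 i j : i != j -> V i * U j = 0.
  by move=> ne; rewrite -Ve -eU -mulrA (mulrA (eps i)) orth // mul0r mulr0.
clearbody U V => {HUV}.
pose f (a : 'I_k) (x : A) : 'M[subvs_of (C a)]_(n a) :=
  \matrix_(p, q) vsproj (C a) (V (g a p) * x * U (g a q)).
have eVg a p : eps (r a) * V (g a p) = V (g a p) by rewrite -(rg a p) eV.
have Ueg a q : U (g a q) * eps (r a) = U (g a q) by rewrite -(rg a q) Ue.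
have memf a p q x : V (g a p) * x * U (g a q) \in C a.
  by rewrite (HC a).1 !mulrA eVg -!mulrA Ueg.
have fE a x p q : vsval (f a x p q) = V (g a p) * x * U (g a q).
  by rewrite mxE vsprojK.
have val1 a : vsval (1 : subvs_of (C a)) = eps (r a) by rewrite -(HC a).2.
have dif i j : rep i != rep j -> ~~ R i j by apply: contra => /repE->.
exists k, n, (fun a => subvs_of (C a)), f; split.
- move=> a; rewrite card_gt0; apply/set0Pn; exists (r a); by rewrite inE rrep.
- move=> a d nzd; have := subvsP d; rewrite (HC a).1 => /eqP ed.
  have [x dxd] := regA (vsval d).
  pose y0 := eps (r a) * x * eps (r a); have Cy0 : y0 \in C a.
    by rewrite (HC a).1 /y0 !mulrA idem -!mulrA idem.
  have ed1 : eps (r a) * vsval d = vsval d by rewrite -ed !mulrA idem.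
  have ed2 : vsval d * eps (r a) = vsval d by rewrite -ed -!mulrA idem.
  have nzv : vsval d != 0 by apply: contraNneq nzd => d0; apply/eqP/val_inj.
  have dyd : vsval d * y0 * vsval d = vsval d.
    by rewrite /y0 !mulrA ed2 -!mulrA ed1 !mulrA dxd.
  have ey1 : eps (r a) * y0 = y0 by rewrite /y0 !mulrA idem.
  have ey2 : y0 * eps (r a) = y0 by rewrite /y0 -!mulrA idem.
  clearbody y0.
  have dy : vsval d * y0 = eps (r a).
    have [_ _ /(_ (vsval d * y0))[]] // := prim (r a).
    + by rewrite mulrA dyd.
    + by rewrite !mulrA ed1 -!mulrA ey2.
    by move=> e0; case/eqP: nzv; rewrite -dyd e0 mul0r.
  have yd : y0 * vsval d = eps (r a).
    have [_ _ /(_ (y0 * vsval d))[]] // := prim (r a).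
    + by rewrite -mulrA (mulrA (vsval d)) dyd.
    + by rewrite !mulrA ey1 -!mulrA ed2.
    by move=> e0; case/eqP: nzv; rewrite -dyd -mulrA e0 mulr0.
  apply/unitrP; exists (Subvs Cy0); split; apply: val_inj; rewrite /= ?yd ?dy;
    by rewrite -val1.
- move=> a c x y; apply/matrixP=> p q; rewrite !mxE; apply: val_inj.
  by rewrite mulrDr mulrDl -scalerAr -scalerAl linearP.
- move=> a x y; apply/matrixP=> p q; apply: val_inj.
  rewrite [LHS]fE mxE raddf_sum /=.
  rewrite (eq_bigr (fun j => V (g a p) * x * eps (g a j) * (y * U (g a q)))); last first.
    by move=> j _; rewrite !fE -UVe !mulrA.
  rewrite -mulr_suml -mulr_sumr.
  have -> : V (g a p) * x * \sum_j eps (g a j) = V (g a p) * x.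
    rewrite -[RHS]mulr1 -sum_eps !mulr_sumr (bigID (mem (cls a))) /=.
    rewrite [X in _ = _ + X]big1 ?addr0.
      by rewrite [RHS]big_enum_val.
    move=> i; rewrite inE => ni; rewrite -(eVg a p) -(mulrA (eps (r a)) _ x) R0 //.
    by rewrite dif // rrep eq_sym.
  by rewrite !mulrA.
split.
- move=> a; apply/matrixP=> p q; apply: val_inj; rewrite [LHS]fE mulr1 !mxE.
  have [-> | ne] := eqVneq p q; first by rewrite VUe rg ?eqxx mulr1n -val1.
  by rewrite VU0 ?(inj_eq (@g_inj a)) // ?(negPf ne) mulr0n.
- move=> x y exy; apply/eqP; rewrite -subr_eq0; set z := x - y.
  have z0 i j : eps i * z * eps j = 0.
    have [Rij | ] := boolP (R i j); last exact: R0.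
    have rij := repE _ _ Rij.
    have ra : rep i \in reps by rewrite inE rep_id.
    pose a := enum_rank_in ra (rep i); have era : r a = rep i by rewrite /r enum_rankK_in.
    have ci : i \in cls a by rewrite inE era.
    have cj : j \in cls a by rewrite inE era rij.
    pose p := enum_rank_in ci i; pose q := enum_rank_in cj j.
    have ep : g a p = i by rewrite /g enum_rankK_in.
    have eq : g a q = j by rewrite /g enum_rankK_in.
    have := congr1 (fun M : 'M_(n a) => vsval (M p q)) (exy a).
    rewrite !fE ep eq => /eqP; rewrite -subr_eq0 -mulrBl -mulrBr -/z => /eqP vzu.
    by rewrite -UVe -[X in _ * X]UVe -!mulrA (mulrA z) (mulrA (V i)) (mulrA (V i)) vzu mul0r mulr0.
  rewrite -[z]mulr1 -[z]mul1r -sum_eps mulr_suml mulr_suml big1 // => i _.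
  by rewrite mulr_sumr big1.
move=> z; exists (\sum_a \sum_p \sum_q U (g a p) * vsval (z a p q) * V (g a q)).
move=> b; apply/matrixP=> p q; apply: val_inj; rewrite [LHS]fE.
rewrite mulr_sumr mulr_suml (bigD1 b) //= [X in _ + X]big1 ?addr0; last first.
  move=> a nab; rewrite mulr_sumr mulr_suml big1 // => p' _.
  rewrite mulr_sumr mulr_suml big1 // => q' _; rewrite !mulrA VU0 ?mul0r //.
  by apply: contraNneq nab => e; rewrite -(inj_eq r_inj) -(rg a p') -(rg b p) e.
rewrite mulr_sumr mulr_suml (bigD1 p) //= [X in _ + X]big1 ?addr0; last first.
  move=> p' nep; rewrite mulr_sumr mulr_suml big1 // => q' _; rewrite !mulrA VU0 ?mul0r //.
  by rewrite (inj_eq (@g_inj b)) eq_sym.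
rewrite mulr_sumr mulr_suml (bigD1 q) //= [X in _ + X]big1 ?addr0; last first.
  move=> q' neq; rewrite -!mulrA VU0 ?mulr0 //.
  by rewrite (inj_eq (@g_inj b)).
have := subvsP (z b p q); rewrite (HC b).1 => /eqP ez.
by rewrite !mulrA VUe -!mulrA VUe !rg !mulrA ez.
Qed.

(** A block of size at least 2 contains a matrix unit of square zero, which lies in A E; two of them
    in different blocks would contradict primeness. Such a block exists, because [a0] cannot vanish
    in all components and a 1 x 1 block over a division algebra has no nonzero element of square
    zero. *)
Lemma one_matrix_count (A : pzRingType) (k : nat) (n : 'I_k -> nat) (D : 'I_k -> unitRingType)
    (f : forall i, A -> 'M[D i]_(n i)) (E : A) :
    (forall i, (0 < n i)%N) -> (forall i (d : D i), d != 0 -> d \is a GRing.unit) ->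
    (forall i, f i 0 = 0) ->
    (forall i x y, f i (x * y) = f i x *m f i y) ->
    (forall x y, (forall i, f i x = f i y) -> x = y) ->
    (forall z : (forall i, 'M[D i]_(n i)), exists x, forall i, f i x = z i) ->
    (forall a, a * a = 0 -> a * E = a) ->
    (forall a b, a * E = a -> b * E = b -> a != 0 -> b != 0 -> exists x, a * x * b != 0) ->
    (exists2 a : A, a != 0 & a * a = 0) ->
  #|[set i | (2 <= n i)%N]| = 1%N.
Proof.
move=> n0 divD f0 fM finj fsurj redE primeE [a0 nza0 a02].
have f1 (D' : unitRingType) m (M : 'M[D']_m) : (forall d : D', d != 0 -> d \is a GRing.unit) ->
    m = 1%N -> M *m M = 0 -> M = 0.
  move=> div m1; move: M; rewrite m1 => M /matrixP/(_ 0 0).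
  rewrite !mxE big_ord1 => MM; apply/matrixP=> p q; rewrite !ord1 mxE.
  have [// | nz] := eqVneq (M 0 0) 0.
  by apply: (mulrI (div _ nz)); rewrite MM mulr0.
have [i0 i0_2] : exists i, (2 <= n i)%N.
  have [/existsP // | ] := boolP [exists i, (2 <= n i)%N].
  rewrite negb_exists => /forallP all1; case/eqP: nza0; apply: finj => i; rewrite f0.
  apply: f1; first exact: divD.
    by apply/eqP; rewrite eqn_leq n0 andbT -ltnS ltnNge all1.
  by rewrite -fM a02 f0.
(* [u i] is the matrix unit of row 0 and column 1 in block i and 0 elsewhere; it is 0 altogether
   when n i = 1. *)
have [u Hu] : exists u : forall i : 'I_k, A, forall i j, f j (u i) =
    \matrix_(p < n j, q < n j) (if [&& j == i, p == 0%N :> nat & q == 1%N :> nat] then 1 else 0).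
  suff: forall i, exists u, forall j, f j u =
    \matrix_(p, q) (if [&& j == i, p == 0%N :> nat & q == 1%N :> nat] then 1 else 0).
    by move/fin_all_exists.
  move=> i; exact: (fsurj (fun j => \matrix_(p, q) (if [&& j == i, p == 0%N :> nat & q == 1%N :> nat] then 1 else 0))).
have uu i : u i * u i = 0.
  apply: finj => j; rewrite fM f0 Hu; apply/matrixP=> p q; rewrite !mxE big1 // => l _.
  rewrite !mxE; case: ifP => [/and3P[_ _ /eqP l1]|]; last by rewrite mul0r.
  by rewrite l1 !andbF mulr0.
have nzu i : (2 <= n i)%N -> u i != 0.
  move=> ni2; apply/eqP=> u0; have := Hu i i; rewrite u0 f0.
  move/matrixP/(_ (Ordinal (n0 i)) (Ordinal ni2)); rewrite !mxE !eqxx /=.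
  by move/esym/eqP; rewrite oner_eq0.
have uE i : u i * E = u i by apply: redE.
apply/eqP/cards1P; exists i0; apply/setP=> j; rewrite !inE.
apply/idP/eqP=> [j2 | -> //]; apply/eqP; apply: contraT => nij.
have [x] := primeE _ _ (uE j) (uE i0) (nzu j j2) (nzu i0 i0_2).
case/eqP; apply: finj => l; rewrite !fM f0 !Hu.
have [elj | nlj] := eqVneq l j.
  rewrite [X in _ *m X](_ : _ = 0) ?mulmx0 //; apply/matrixP=> p q; rewrite !mxE.
  by rewrite (_ : (l == i0) = false) //; apply/negbTE; rewrite elj.
rewrite [X in X *m _ *m _](_ : _ = 0) ?mul0mx //.
by apply/matrixP=> p q; rewrite !mxE ?(negPf nlj).
Qed.

(** The space [W] of matrices is made into an algebra [subvs_of BA], to which [artin_wedderburn]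
    applies; the component maps are then precomposed with the projection onto it. *)
Lemma matrix_algebra_one_component (d r : nat) (W : 'M[rat]_(r, d * d)) (E : 'M[rat]_d) :
    (0 < d)%N -> (1%:M \in W)%MS ->
    (forall x y, (x \in W)%MS -> (y \in W)%MS -> (x *m y \in W)%MS) ->
    (forall x, (x \in W)%MS -> exists2 y, (y \in W)%MS & x *m y *m x = x) ->
    (E \in W)%MS ->
    (forall a, (a \in W)%MS -> a *m a = 0 -> a *m E = a) ->
    (forall a b, (a \in W)%MS -> (b \in W)%MS -> a *m E = a -> b *m E = b ->
       a != 0 -> b != 0 -> exists2 x, (x \in W)%MS & a *m x *m b != 0) ->
    (exists a, [/\ (a \in W)%MS, a != 0 & a *m a = 0]) ->
  exists (k : nat) (n : 'I_k -> nat) (D : 'I_k -> falgType rat)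
         (f : forall i : 'I_k, 'M[rat]_d -> 'M[D i]_(n i)),
   [/\ forall i, (0 < n i)%N, forall i, division_algebra (D i),
       forall i (a : rat) (x y : 'M[rat]_d), (x \in W)%MS -> (y \in W)%MS ->
         f i (a *: x + y) = map_mx (fun d : D i => a *: d) (f i x) + f i y,
       forall i (x y : 'M[rat]_d), (x \in W)%MS -> (y \in W)%MS ->
         f i (x *m y) = f i x *m f i y
    & [/\ forall i, f i 1%:M = 1%:M,
          forall x y : 'M[rat]_d, (x \in W)%MS -> (y \in W)%MS ->
            (forall i, f i x = f i y) -> x = y,
          forall z : (forall i, 'M[D i]_(n i)),
            exists2 x, (x \in W)%MS & forall i, f i x = z i
        & #|[set i | (2 <= n i)%N]| = 1%N]].
Proof.
case: d W E => // d W E _ W1 WM Wreg WE redE primeE nilE.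
pose X := [seq vec_mx (row i W) : 'M[rat]_d.+1 | i <- enum 'I_r].
pose B : {vspace 'M[rat]_d.+1} := <<X>>%VS.
have memB (x : 'M[rat]_d.+1) : (x \in B) = (x \in W)%MS.
  apply/idP/idP=> [xB | xW].
    rewrite (coord_span (X := in_tuple X) xB) !linear_sum summx_sub //= => i _.
    rewrite !linearZ scalemx_sub //.
    have /mapP[j _ ->] : X`_i \in X by apply: mem_nth.
    by rewrite /= vec_mxK row_sub.
  have /submxP[u eu] := xW.
  rewrite -[x]mxvecK eu mulmx_sum_row linear_sum memv_suml // => i _.
  rewrite linearZ memvZ //; apply: memv_span; apply/mapP; exists i; by rewrite ?mem_enum.
have aB : is_aspace B.
  apply/andP; split; last by apply/prodvP=> x y; rewrite !memB; apply: WM.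
  by apply: has_algid1; rewrite memB.
pose BA := ASpace aB; pose A := subvs_of BA.
have alg1 : algid BA = 1 by apply/eqP; rewrite algid_eq1 memB.
have val1 : vsval (1 : A) = 1 by rewrite -[RHS]alg1.
have valP' (x : A) : (vsval x \in W)%MS by rewrite -memB; apply: subvsP.
have regA : von_neumann_regular A.
  move=> x; have [y yW xyx] := Wreg _ (valP' x); rewrite -memB in yW.
  by exists (Subvs yW : A); apply: val_inj.
have [k [n [D [f [n0 divD flin fM [f1 finj fsurj]]]]]] := artin_wedderburn regA.
have pK x : (x \in W)%MS -> vsval (vsproj BA x) = x by move=> xW; rewrite vsprojK // memB.
have pM x y : (x \in W)%MS -> (y \in W)%MS -> vsproj BA (x *m y) = vsproj BA x * vsproj BA y.
  by move=> xW yW; apply: val_inj; rewrite /= !pK ?WM.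
exists k, n, D, (fun i x => f i (vsproj BA x)); split=> //.
- by move=> i a x y xW yW; rewrite linearP flin.
- by move=> i x y xW yW; rewrite pM.
split.
- move=> i; rewrite -(f1 i); congr (f i _); apply: val_inj.
  by rewrite /= pK // val1.
- by move=> x y xW yW /finj/(congr1 vsval); rewrite !pK.
- move=> z; have [x Hx] := fsurj z; exists (vsval x) => // i; by rewrite vsvalK.
have f0 i : f i 0 = 0.
  have := flin i (-1) 0 0; rewrite scaler0 addr0 => ->.
  by apply/matrixP=> p q; rewrite !mxE scaleN1r addNr.
apply: (@one_matrix_count A k n D f (vsproj BA E)) => //.
- move=> a aa; apply: val_inj; rewrite /= pK //; apply: redE => //.
  by have := congr1 vsval aa.
- move=> a b aE bE nza nzb.
  have [|||| x xW nz] := primeE _ _ (valP' a) (valP' b).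
  + by have := congr1 vsval aE; rewrite /= pK.
  + by have := congr1 vsval bE; rewrite /= pK.
  + by apply: contraNneq nza => a0; apply/eqP/val_inj.
  + by apply: contraNneq nzb => a0; apply/eqP/val_inj.
  exists (vsproj BA x); apply: contraNneq nz => e0; apply/eqP.
  by have := congr1 vsval e0; rewrite /= pK.
have [a [aW nza aa]] := nilE; exists (vsproj BA a).
  by apply: contraNneq nza => /(congr1 vsval); rewrite pK // => ->.
by rewrite -pM // aa linear0.
Qed.

(** * The rational group ring in the regular representation *)

Local Notation reg G := (regular_repr rat G%G).
Local Notation QG G := (group_ring rat G%G).

(** The regular representation is by permutation matrices, so transposition is the involution of QG
    that inverts group elements. *)
Lemma reg_tr (gT : finGroupType) (G : {group gT}) x : x \in G -> (reg G x)^T = reg G x^-1%g.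
Proof.
move=> Gx; apply/matrixP=> i j; rewrite !mxE !eqxx /=; congr ((nat_of_bool _)%:R).
have Gi (k : 'I_#|G|) : enum_val k \in G := enum_valP k.
apply/eqP/eqP=> [-> | ->].
  by rewrite gring_indexK ?groupM ?Gi // mulgK gring_valK.
by rewrite gring_indexK ?groupM ?groupV ?Gi // mulgKV gring_valK.
Qed.

Lemma QG_mem (gT : finGroupType) (G : {group gT}) x : x \in G -> (reg G x \in QG G)%MS.
Proof. exact: envelop_mx_id. Qed.

Lemma QG_add (gT : finGroupType) (G : {group gT}) a b :
  (a \in QG G)%MS -> (b \in QG G)%MS -> (a + b \in QG G)%MS.
Proof. by move=> Ra Rb; rewrite linearD addmx_sub. Qed.

Lemma QG_scale (gT : finGroupType) (G : {group gT}) c a :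
  (a \in QG G)%MS -> (c *: a \in QG G)%MS.
Proof. by move=> Ra; rewrite linearZ scalemx_sub. Qed.

Lemma QG_sub (gT : finGroupType) (G : {group gT}) a b :
  (a \in QG G)%MS -> (b \in QG G)%MS -> (a - b \in QG G)%MS.
Proof. by move=> Ra Rb; rewrite -scaleN1r QG_add ?QG_scale. Qed.

Lemma QG_sum (gT : finGroupType) (G : {group gT}) (I : Type) (s : seq I) (P : pred I) F :
  (forall i, P i -> (F i \in QG G)%MS) -> (\sum_(i <- s | P i) F i \in QG G)%MS.
Proof. by move=> RF; rewrite linear_sum summx_sub. Qed.

Lemma QG_mul (gT : finGroupType) (G : {group gT}) a b :
  (a \in QG G)%MS -> (b \in QG G)%MS -> (a *m b \in QG G)%MS.
Proof. exact: envelop_mxM. Qed.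

Lemma QG_one (gT : finGroupType) (G : {group gT}) : (1%:M \in QG G)%MS.
Proof. exact: envelop_mx1. Qed.

Lemma QG_tr (gT : finGroupType) (G : {group gT}) a : (a \in QG G)%MS -> (a^T \in QG G)%MS.
Proof.
case/envelop_mxP=> c ->; rewrite linear_sum; apply: QG_sum => x Gx.
by rewrite linearZ /= reg_tr // QG_scale // QG_mem // groupV.
Qed.

Lemma QG_central (gT : finGroupType) (G : {group gT}) e :
  (forall x, x \in G -> reg G x *m e = e *m reg G x) ->
  forall a, (a \in QG G)%MS -> a *m e = e *m a.
Proof.
move=> ce a /envelop_mxP[c ->]; rewrite mulmx_suml mulmx_sumr; apply: eq_bigr => x Gx.
by rewrite -scalemxAl -scalemxAr ce.
Qed.

Definition coef (gT : finGroupType) (G : {group gT}) (a : 'M[rat]_#|G|) (g : gT) : rat :=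
  gring_row a 0 (gring_index G g).

Lemma coefE (gT : finGroupType) (G : {group gT}) x g :
  x \in G -> g \in G -> coef (reg G x) g = (g == x)%:R.
Proof.
move=> Gx Gg; rewrite /coef /gring_row rowK gring_indexK // mul1g mxE eqxx /=.
by rewrite (inj_in_eq (can_in_inj (@gring_indexK _ G))).
Qed.

Lemma coef_sum (gT : finGroupType) (G : {group gT}) (I : Type) (s : seq I) (P : pred I) F g :
  coef (G := G) (\sum_(i <- s | P i) F i) g = \sum_(i <- s | P i) coef (F i) g.
Proof. by rewrite /coef linear_sum summxE. Qed.

Lemma coefZ (gT : finGroupType) (G : {group gT}) c (a : 'M[rat]_#|G|) g :
  coef (c *: a) g = c * coef a g.
Proof. by rewrite /coef linearZ mxE. Qed.

Lemma coef_gset (gT : finGroupType) (G : {group gT}) (A : {set gT}) g :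
  A \subset G -> g \in G -> coef (gset_mx rat G A) g = (g \in A)%:R.
Proof.
move=> sAG Gg; rewrite /gset_mx coef_sum.
have [Ag | nAg] := boolP (g \in A).
  rewrite (bigD1 g) //= coefE // eqxx big1 ?addr0 // => x /andP[Ax ne].
  by rewrite coefE ?(subsetP sAG) // eq_sym (negPf ne).
rewrite big1 ?mulr0n // => x Ax; rewrite coefE // ?(subsetP sAG) //.
by have [e | //] := eqVneq g x; rewrite e Ax in nAg.
Qed.

(** Diagonal entries of a a^T are sums of squares of rationals. *)
Lemma mulmx_tr_eq0 m n (a : 'M[rat]_(m, n)) : a *m a^T = 0 -> a = 0.
Proof.
move=> aa; apply/matrixP=> i j; rewrite mxE; have /matrixP/(_ i i) := aa.
rewrite !mxE => /eqP; rewrite Num.Theory.psumr_eq0; last by move=> k _; rewrite mxE -expr2 Num.Theory.sqr_ge0.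
by move/allP/(_ j (mem_index_enum _)); rewrite mxE -expr2 sqrf_eq0 => /eqP.
Qed.

(** By positivity b = a a^T and b^2 have the same kernel, so b QG = b^2 QG by dimension and b = b^2
    t. Symmetry of [b] turns this into b t b = b, and positivity lifts it to a (a^T t) a = a. *)
Lemma QG_regular (gT : finGroupType) (G : {group gT}) a :
  (a \in QG G)%MS -> exists2 t, (t \in QG G)%MS & a *m t *m a = a.
Proof.
move=> Ra; pose b := a *m a^T.
have Rb : (b \in QG G)%MS by rewrite QG_mul // QG_tr.
have bT : b^T = b by rewrite /b trmx_mul trmxK.
have eb : b = a *m a^T by []. clearbody b.
have cancelb k (x : 'M_(#|G|, k)) : b *m b *m x = 0 -> b *m x = 0.
  move=> bbx; apply: trmx_inj; rewrite trmx0; apply: mulmx_tr_eq0.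
  by rewrite trmxK trmx_mul bT -mulmxA (mulmxA b b) bbx mulmx0.
pose W1 := QG G *m lin_mulmx b; pose W2 := QG G *m lin_mulmx (b *m b).
have memW (c : 'M_#|G|) x : reflect (exists2 y, (y \in QG G)%MS & x = c *m y) (x \in QG G *m lin_mulmx c)%MS.
  apply: (iffP idP) => [/submxP[u eu] | [y Ry ->]].
    exists (vec_mx (u *m QG G)); first by rewrite vec_mxK submxMl.
    by apply: (can_inj mxvecK); rewrite eu mulmxA -[u *m _]vec_mxK mul_vec_lin vec_mxK.
  by rewrite -[mxvec _](mul_vec_lin (mulmx c)) submxMr.
have sW21 : (W2 <= W1)%MS.
  apply/row_subP=> i; rewrite -[row i W2]vec_mxK; apply/memW.
  have /memW[y Ry ->] : (vec_mx (row i W2) \in W2)%MS by rewrite vec_mxK row_sub.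
  by exists (b *m y); [apply: QG_mul | rewrite mulmxA].
have sW12 : (W1 <= W2)%MS.
  have := mxrank_leqif_sup sW21; case=> _ <-.
  have sker : (kermx W2 <= kermx W1)%MS.
    apply/sub_kermxP; apply/row_matrixP=> i; rewrite row0 row_mul.
    have: row i (kermx W2) *m W2 = 0.
      by apply/sub_kermxP; apply: row_sub.
    set u := row i _; rewrite /W1 /W2 !mulmxA -[u *m _]vec_mxK !mul_vec_lin /=.
    move/(congr1 vec_mx); rewrite mxvecK linear0 => e.
    by rewrite cancelb ?linear0.
  have := mxrankS sker; rewrite !mxrank_ker eqn_leq => le12.
  rewrite (mxrankS sW21) /=; have := rank_leq_row W1; have := rank_leq_row W2.
  move: le12; move: (\rank W1) (\rank W2) => r1 r2 le12 r2le r1le.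
  by rewrite -(leq_sub2lE _ r1le) // in le12 *.
have [t Rt bt] : exists2 t, (t \in QG G)%MS & b = b *m b *m t.
  by apply/memW; apply: (submx_trans _ sW12); apply/memW; exists 1%:M; rewrite ?QG_one ?mulmx1.
have tb : t^T *m b *m b = b.
  by rewrite -[RHS]bT [in RHS]bt !trmx_mul bT mulmxA.
have btb : b *m t *m b = b.
  have -> : b *m t = t^T *m b by rewrite -{1}tb -(mulmxA t^T) -(mulmxA t^T) -bt.
  exact: tb.
exists (a^T *m t); first by rewrite QG_mul ?QG_tr.
apply/eqP; rewrite -subr_eq0; apply/eqP/mulmx_tr_eq0.
set d := _ - a; have dE : d = (b *m t - 1%:M) *m a.
  by rewrite /d mulmxBl mul1mx eb !mulmxA.
have da : d *m a^T = 0.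
  by rewrite dE -mulmxA -eb mulmxBl btb mul1mx subrr.
by rewrite [d in _ *m d^T]dE trmx_mul mulmxA da mul0mx.
Qed.

(** * Averages over subgroups *)

Definition hat (gT : finGroupType) (G N : {group gT}) : 'M[rat]_#|G| :=
  (#|N|%:R)^-1 *: gset_mx rat G N.

Lemma natN0 (gT : finGroupType) (N : {group gT}) : #|N|%:R != 0 :> rat.
Proof. by rewrite Num.Theory.pnatr_eq0 -lt0n cardG_gt0. Qed.

Lemma hat_mem (gT : finGroupType) (G N : {group gT}) : N \subset G -> (hat G N \in QG G)%MS.
Proof.
move=> sNG; apply/QG_scale/QG_sum => x Nx; apply: QG_mem; exact: (subsetP sNG).
Qed.

Lemma gset_mulr (gT : finGroupType) (G N : {group gT}) x : N \subset G -> x \in N ->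
  gset_mx rat G N *m reg G x = gset_mx rat G N.
Proof.
move=> sNG Nx; have GN := subsetP sNG.
rewrite /gset_mx mulmx_suml [RHS](reindex_inj (mulIg x)) /=.
apply: eq_big => [y | y Ny]; first by rewrite groupMr.
by rewrite repr_mxM ?GN.
Qed.

Lemma gset_mull (gT : finGroupType) (G N : {group gT}) x : N \subset G -> x \in N ->
  reg G x *m gset_mx rat G N = gset_mx rat G N.
Proof.
move=> sNG Nx; have GN := subsetP sNG.
rewrite /gset_mx mulmx_sumr [RHS](reindex_inj (mulgI x)) /=.
apply: eq_big => [y | y Ny]; first by rewrite groupMl.
by rewrite repr_mxM ?GN.
Qed.

Lemma hat_mulr (gT : finGroupType) (G N : {group gT}) x : N \subset G -> x \in N ->
  hat G N *m reg G x = hat G N.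
Proof. by move=> sNG Nx; rewrite /hat -scalemxAl gset_mulr. Qed.

Lemma hat_mull (gT : finGroupType) (G N : {group gT}) x : N \subset G -> x \in N ->
  reg G x *m hat G N = hat G N.
Proof. by move=> sNG Nx; rewrite /hat -scalemxAr gset_mull. Qed.

Lemma hat_fixl (gT : finGroupType) (G N : {group gT}) k (c : 'M_(#|G|, k)) :
  (forall x, x \in N -> reg G x *m c = c) -> hat G N *m c = c.
Proof.
move=> Nc; rewrite /hat -scalemxAl /gset_mx mulmx_suml (eq_bigr (fun=> c)) //.
by rewrite sumr_const -scaler_nat scalerA mulVf ?natN0 // scale1r.
Qed.

Lemma hat_fixr (gT : finGroupType) (G N : {group gT}) k (c : 'M_(k, #|G|)) :
  (forall x, x \in N -> c *m reg G x = c) -> c *m hat G N = c.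
Proof.
move=> Nc; rewrite /hat -scalemxAr /gset_mx mulmx_sumr (eq_bigr (fun=> c)) //.
by rewrite sumr_const -scaler_nat scalerA mulVf ?natN0 // scale1r.
Qed.

Lemma hat_idem (gT : finGroupType) (G N : {group gT}) : N \subset G ->
  hat G N *m hat G N = hat G N.
Proof. by move=> sNG; apply: hat_fixl => x; apply: hat_mull. Qed.

Lemma hat_tr (gT : finGroupType) (G N : {group gT}) : N \subset G -> (hat G N)^T = hat G N.
Proof.
move=> sNG; rewrite /hat linearZ linear_sum /=; congr (_ *: _).
rewrite /gset_mx [RHS](reindex_inj invg_inj) /=; apply: eq_big => [x | x Nx].
  by rewrite groupV.
by rewrite reg_tr // (subsetP sNG).
Qed.

Lemma hat_norm (gT : finGroupType) (G N : {group gT}) g : N \subset G -> g \in G ->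
  g \in 'N(N)%g -> reg G g *m hat G N = hat G N *m reg G g.
Proof.
move=> sNG Gg Ng; have GN := subsetP sNG.
rewrite /hat -scalemxAl -scalemxAr; congr (_ *: _).
rewrite /gset_mx mulmx_suml mulmx_sumr [LHS](reindex_inj (@conjg_inj _ g)) /=.
apply: eq_big => [y | y Ny]; first by rewrite memJ_norm.
have Ny' : (y \in N)%g by rewrite -(memJ_norm y Ng).
by rewrite -repr_mxM ?(GN _ Ny) // -repr_mxM ?(GN _ Ny') // -conjgC.
Qed.

Lemma hat_central (gT : finGroupType) (G N : {group gT}) a : (N <| G)%g ->
  (a \in QG G)%MS -> a *m hat G N = hat G N *m a.
Proof.
move=> nNG; apply: QG_central => x Gx; apply: hat_norm; rewrite ?normal_sub //.
exact: (subsetP (normal_norm nNG)).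
Qed.

Lemma hat_join (gT : finGroupType) (G N Y : {group gT}) : (N <| G)%g -> Y \subset G ->
  hat G N *m hat G Y = hat G (N <*> Y)%G.
Proof.
move=> nNG sYG; have sNG := normal_sub nNG.
have sJG : (N <*> Y)%g \subset G by rewrite join_subG sNG.
have defJ : (N <*> Y = N * Y)%g by rewrite norm_joinEr // (subset_trans sYG) ?normal_norm.
rewrite -[LHS](@hat_fixl _ G (N <*> Y)%G); last first.
  move=> x /=; rewrite defJ => /mulsgP[u v Nu Yv ->].
  have Gu := subsetP sNG u Nu; have Gv := subsetP sYG v Yv.
  rewrite repr_mxM // -mulmxA (mulmxA (reg G v)) hat_norm ?(subsetP (normal_norm nNG)) //.
  by rewrite -(mulmxA (hat G N)) hat_mull // mulmxA hat_mull.
rewrite mulmxA (@hat_fixr _ G N) => [|x Nx]; last by rewrite hat_mulr // (subsetP (joing_subl N Y)).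
by rewrite hat_fixr // => x Yx; rewrite hat_mulr // (subsetP (joing_subr N Y)).
Qed.

Lemma coef_hat (gT : finGroupType) (G N : {group gT}) g : N \subset G -> g \in G ->
  coef (hat G N) g = (#|N|%:R)^-1 * (g \in N)%:R.
Proof. by move=> sNG Gg; rewrite coefZ coef_gset. Qed.

Lemma conj_hat (gT : finGroupType) (G Y : {group gT}) g : Y \subset G -> g \in G ->
  reg G g^-1%g *m hat G Y *m reg G g = hat G (Y :^ g)%G.
Proof.
move=> sYG Gg; have GY := subsetP sYG.
rewrite /hat -scalemxAr -scalemxAl cardJg; congr (_ *: _).
rewrite /gset_mx mulmx_sumr mulmx_suml [RHS](reindex_inj (@conjg_inj _ g)) /=.
apply: eq_big => [y | y Yy]; first by rewrite memJ_conjg.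
by rewrite -!repr_mxM ?groupM ?groupV ?(GY _ Yy) // conjgE mulgA.
Qed.

Lemma hat_inj (gT : finGroupType) (G X Y : {group gT}) : X \subset G -> Y \subset G ->
  hat G X = hat G Y -> X :=: Y.
Proof.
move=> sXG sYG eXY.
have sub (A B : {group gT}) : A \subset G -> B \subset G -> hat G A = hat G B -> A \subset B.
  move=> sAG sBG e; apply/subsetP=> a Aa; have Ga := subsetP sAG a Aa.
  have := congr1 (fun m => coef m a) e; rewrite /= !coef_hat // Aa mulr1.
  case: (a \in B) => //; rewrite mulr0 => /eqP; by rewrite invr_eq0 (negPf (natN0 _)).
apply/eqP; rewrite eqEsubset; apply/andP; split.
  exact: (sub X Y).
exact: (sub Y X).
Qed.

(** \hat Y g (1 - \hat Y) has square zero. If it vanishes for all g, then \hat Y g = \hat Y g \hat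
    Y; transposing with g^-1 for g gives g \hat Y = \hat Y g \hat Y too, so \hat Y is central and
    [Y] normal. *)
Lemma QG_nilpotent_of_nonnormal (gT : finGroupType) (G Y : {group gT}) :
  Y \subset G -> ~~ (Y <| G)%g -> exists a, [/\ (a \in QG G)%MS, a != 0 & a *m a = 0].
Proof.
move=> sYG nnY; pose a g := hat G Y *m reg G g *m (1%:M - hat G Y).
have [/existsP[g /andP[Gg nz]] | ] := boolP [exists g, (g \in G) && (a g != 0)].
  exists (a g); split=> //.
    by rewrite !QG_mul ?QG_sub ?QG_one ?hat_mem ?QG_mem.
  have e0 : (1%:M - hat G Y) *m hat G Y = 0 by rewrite mulmxBl mul1mx hat_idem // subrr.
  by rewrite /a -!mulmxA (mulmxA _ (hat G Y)) e0 mul0mx !mulmx0.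
rewrite negb_exists => /forallP a0; case/negP: nnY.
have ag g : g \in G -> hat G Y *m reg G g = hat G Y *m reg G g *m hat G Y.
  move=> Gg; apply/eqP; rewrite -subr_eq0 -{1}[_ *m reg G g]mulmx1 -mulmxBr -/(a g).
  by have := a0 g; rewrite Gg negbK.
have comm g : g \in G -> hat G Y *m reg G g = reg G g *m hat G Y.
  move=> Gg; rewrite ag //; have := congr1 trmx (ag g^-1%g (groupVr Gg)).
  rewrite !trmx_mul hat_tr // reg_tr ?groupV // invgK => ->.
  by rewrite mulmxA.
rewrite /normal sYG; apply/normsP=> g Gg.
apply: (@hat_inj _ G (Y :^ g)%G Y) => //; first by rewrite /= -(conjGid Gg) conjSg.
rewrite -conj_hat // -mulmxA comm // mulmxA -repr_mxM ?groupV // mulVg repr_mx1.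
by rewrite mul1mx.
Qed.

Local Opaque hat.

(* The hypothesis makes (u + u^-1) \hat N central, so c c^T is central for    *)
(* c = a \hat N; then c c = 0 gives (c c^T)^2 = 0 and c = 0 by positivity.    *)
Lemma QG_hat_reduced (gT : finGroupType) (G N : {group gT}) a : (N <| G)%g ->
    (forall g h, g \in G -> h \in G -> exists2 n, n \in N & (g ^ h = g * n)%g \/ (g ^ h = g^-1 * n)%g) ->
  (a \in QG G)%MS -> a *m a = 0 -> a *m hat G N = 0.
Proof.
move=> nNG conjN Ra aa; have sNG := normal_sub nNG.
have Rh := hat_mem sNG; set e := hat G N in Rh *.
have ce x : x \in G -> reg G x *m e = e *m reg G x.
  by move=> Gx; apply: hat_central; rewrite ?QG_mem.
have ee : e *m e = e by apply: hat_idem.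
have ne n : n \in N -> reg G n *m e = e by apply: hat_mull.
have eT : e^T = e by apply: hat_tr.
have ca : a *m e = e *m a by apply: hat_central.
set c := a *m e; have Rc : (c \in QG G)%MS by apply: QG_mul.
have cc : c *m c = 0 by rewrite /c -mulmxA (mulmxA e) -ca -mulmxA ee mulmxA aa mul0mx.
have caT : a^T *m e = e *m a^T by apply: hat_central => //; apply: QG_tr.
clearbody e.
pose n := c *m c^T.
have nE : n = a *m a^T *m e.
  by rewrite /n /c trmx_mul eT -mulmxA (mulmxA e) ee -caT mulmxA.
have [al ea] := envelop_mxP Ra.
(* Exchanging the summation indices replaces x y^-1 by its inverse, so 2n is a combination of the
   elements (u + u^-1) e. *)
have nn : n + n = \sum_(x in G) \sum_(y in G)
   (al x * al y) *: ((reg G (x * y^-1)%g + reg G (x * y^-1)^-1%g) *m e).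
  have s1 : n = \sum_(x in G) \sum_(y in G) (al x * al y) *: (reg G (x * y^-1)%g *m e).
    have eaT : a^T = \sum_(y in G) al y *: reg G y^-1%g.
      by rewrite ea linear_sum; apply: eq_bigr => y Gy; rewrite linearZ /= reg_tr.
    rewrite nE eaT {1}ea !mulmx_suml; apply: eq_bigr => x Gx.
    rewrite mulmx_sumr mulmx_suml; apply: eq_bigr => y Gy.
    rewrite -scalemxAl -scalemxAr -!scalemxAl scalerA. by rewrite -repr_mxM ?groupV.
  have s2 : n = \sum_(x in G) \sum_(y in G) (al x * al y) *: (reg G (x * y^-1)^-1%g *m e).
    rewrite s1 exchange_big /=; apply: eq_bigr => x Gx; apply: eq_bigr => y Gy.
    by rewrite mulrC invMg invgK.
  rewrite {1}s1 s2 -big_split /=; apply: eq_bigr => x Gx; rewrite -big_split /=.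
  by apply: eq_bigr => y Gy; rewrite -scalerDr -mulmxDl.
have uc u h : u \in G -> h \in G ->
    reg G h *m ((reg G u + reg G u^-1%g) *m e) = (reg G u + reg G u^-1%g) *m e *m reg G h.
  move=> Gu Gh.
  have ch v : v \in G -> reg G v *m e *m reg G h = reg G h *m (reg G (v ^ h)%g *m e).
    by move=> Gv; rewrite -mulmxA -ce // !mulmxA -!repr_mxM ?groupJ // -conjgC.
  have [m Nm um] := conjN u h Gu Gh; have Gm := subsetP sNG m Nm.
  rewrite mulmxDl mulmxDl !ch ?groupV // -mulmxDr; congr (_ *m _).
  have um1 v : v \in G -> reg G (v * m)%g *m e = reg G v *m e.
    by move=> Gv; rewrite repr_mxM // -mulmxA ne.
  have um2 v : v \in G -> reg G (v * m)^-1%g *m e = reg G v^-1%g *m e.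
    by move=> Gv; rewrite invMg repr_mxM ?groupV // -mulmxA ce ?groupV // mulmxA ne ?groupV.
  have GVu := groupVr Gu; rewrite conjVg; case: um => ->.
    by rewrite (um1 u Gu) (um2 u Gu).
  by rewrite (um1 _ GVu) (um2 _ GVu) invgK addrC.
have nR : (n \in QG G)%MS by rewrite /n QG_mul ?QG_tr.
have ncen g : g \in G -> reg G g *m (n + n) = (n + n) *m reg G g.
  move=> Gg; rewrite nn mulmx_sumr mulmx_suml; apply: eq_bigr => x Gx.
  rewrite mulmx_sumr mulmx_suml; apply: eq_bigr => y Gy.
  by rewrite -scalemxAl -scalemxAr uc ?groupM ?groupV.
have cn : c *m n = n *m c.
  have := QG_central ncen Rc; rewrite mulmxDr mulmxDl -!mulr2n -!scaler_nat.
  by move/(scalerI _); apply.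
have nT : n^T = n by rewrite /n trmx_mul trmxK.
have cTn : c^T *m n = n *m c^T by rewrite -{1}nT -trmx_mul -cn trmx_mul nT.
apply: mulmx_tr_eq0; rewrite -/n; apply: mulmx_tr_eq0.
by rewrite nT {1}/n -mulmxA cTn mulmxA /n (mulmxA c c) cc !mul0mx.
Qed.

(** [Phi] is the cyclotomic polynomial of order p^(n+1): it vanishes at a primitive root of unity
    [w] and has the degree of the minimal polynomial of [w]. *)
Lemma prime_power_cyclotomic_irreducible p n (q : {poly rat}) : prime p ->
  let Phi := \sum_(j < p) 'X^(j * p ^ n) : {poly rat} in Phi %| q \/ coprimep Phi q.
Proof.
move=> p_pr Phi; have p_gt0 := prime_gt0 p_pr; have m_gt0 : (0 < p ^ n.+1)%N by rewrite expn_gt0 p_gt0.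
have [w prw] := C_prim_root_exists m_gt0.
have [m [em mon_m] rm] := minCpolyP w.
have szPhi : size Phi = ((p.-1) * p ^ n).+1.
  rewrite /Phi -(big_mkord xpredT (fun j => 'X^(j * p ^ n))) -{1}(prednK p_gt0) big_nat_recr //= big_mkord.
  rewrite addrC size_polyDl size_polyXn //.
  rewrite ltnS; apply: (leq_trans (size_sum _ _ _)); apply/bigmax_leqP=> i _.
  by rewrite size_polyXn ltn_pmul2r ?expn_gt0 ?p_gt0.
have szm : size m = ((p.-1) * p ^ n).+1.
  have -> : size m = size (minCpoly w) by rewrite em size_map_poly.
  by rewrite (minCpoly_cyclotomic prw) size_cyclotomic totient_pfactor.
have mPhi : m %= Phi.
  rewrite -(dvdp_size_eqp _) ?szm ?szPhi //.
  rewrite -rm /root rmorph_sum horner_sum /=.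
  have -> : \sum_(i < p) (map_poly ratr 'X^(i * p ^ n)).[w] = \sum_(i < p) (w ^+ (p ^ n)) ^+ i.
    by apply: eq_bigr => i _; rewrite rmorphXn /= map_polyX hornerXn mulnC exprM.
  have w1 : (w ^+ (p ^ n)) ^+ p = 1 by rewrite -exprM -expnSr prim_expr_order.
  have ne : w ^+ (p ^ n) != 1.
    rewrite -(prim_order_dvd prw) expnSr; apply/negP=> dv.
    have pn0 : (0 < p ^ n)%N by rewrite expn_gt0 p_gt0.
    by have := dvdn_leq pn0 dv; rewrite leqNgt ltn_Pmulr ?prime_gt1.
  have := subrX1 (w ^+ (p ^ n)) p; rewrite w1 subrr => /eqP; rewrite eq_sym mulf_eq0 subr_eq0.
  by rewrite (negPf ne).
rewrite -(eqp_dvdl _ mPhi) -(eqp_coprimepl _ mPhi).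
have [mq | nmq] := boolP (m %| q); [by left | right].
(* In m = h gcd(m, q) one factor vanishes at [w] and so is divisible by m. If it is [h], the gcd is
   constant; otherwise m divides q. *)
have g_m := dvdp_gcdl m q; have [h eh] := dvdpP _ _ g_m.
have := rm m; rewrite dvdpp {1}eh rmorphM rootM /= !rm.
case/orP=> [mh | mg]; last by rewrite (dvdp_trans mg (dvdp_gcdr _ _)) in nmq.
have m0 : m != 0 := monic_neq0 mon_m.
have := m0; rewrite {1}eh mulf_eq0 negb_or => /andP[h0 g0].
have := dvdp_leq h0 mh; rewrite {1}eh size_mul //.
rewrite /coprimep; move: g0; rewrite -size_poly_gt0; case: (size _) => // k _.
rewrite addnS /= => le; rewrite eqSS -leqn0 -(leq_add2l (size h)).
by rewrite addn0.
Qed.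

(** y = q(z) e for a polynomial q, and Phi(z) e = 0 by hypothesis. Either Phi divides q, or a Bezout
    relation inverts q modulo Phi. *)
Lemma cyclotomic_inverse (gT : finGroupType) (G : {group gT}) d (rG : mx_representation rat G d)
    z (e : 'M[rat]_d) p n : prime p -> z \in G ->
    (\sum_(j < p) rG (z ^+ (j * p ^ n))%g) *m e = 0 ->
  forall (I : finType) (P : pred I) (b : I -> rat) (i : I -> nat),
  let y := (\sum_(s | P s) b s *: rG (z ^+ (i s))%g) *m e in
  y = 0 \/ exists w, w *m y = e.
Proof.
case: d rG e => [|d] rG e p_pr Gz Phi0 I P b i y; first by left; apply: flatmx0.
 pose q : {poly rat} := \sum_(s | P s) b s *: 'X^(i s).
have hX k : horner_mx (rG z) 'X^k = rG (z ^+ k)%g by rewrite rmorphXn /= horner_mx_X repr_mxX.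
have eP : horner_mx (rG z) (\sum_(j < p) 'X^(j * p ^ n)) = \sum_(j < p) rG (z ^+ (j * p ^ n))%g.
  by rewrite rmorph_sum; apply: eq_bigr => j _; apply: hX.
have ey : y = horner_mx (rG z) q *m e.
  by rewrite /y /q linear_sum; congr (_ *m _); apply: eq_bigr => s _; rewrite linearZ /= hX.
have [/dvdpP[r er] | /Bezout_eq1_coprimepP[u eu]] := prime_power_cyclotomic_irreducible n q p_pr.
  by left; rewrite ey er rmorphM /= eP -mulmxE -mulmxA Phi0 mulmx0.
right; exists (horner_mx (rG z) u.2).
rewrite ey mulmxA mulmxE -rmorphM /=.
have := congr1 (fun r => horner_mx (rG z) r *m e) eu.
rewrite /= rmorphD rmorphM /= eP rmorph1 -!mulmxE mulmxDl -mulmxA Phi0 mulmx0 add0r => ->.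
by rewrite mul1mx.
Qed.

(** u^k = u w with [w] central, so multiplication by [w] permutes the class of [u]. The class sum is
    thus fixed by the average of <w>, which [e] annihilates. *)
Lemma QG_class_sum0 (gT : finGroupType) (G : {group gT}) (e : 'M[rat]_#|G|) u k :
    (forall x, x \in G -> reg G x *m e = e *m reg G x) ->
    u \in G -> k \in G -> [~ u, k]%g \in 'Z(G)%g -> hat G <[ [~ u, k]%g ]>%G *m e = 0 ->
  (\sum_(h in G) reg G (u ^ h)%g) *m e = 0.
Proof.
move=> ce Gu Gk; set w := [~ u, k]%g => Zw hw; set S := (\sum_(h in G) _) *m e.
have Gw : w \in G := subsetP (center_sub G) w Zw.
have cw g : g \in G -> (w * g = g * w)%g by move=> Gg; case/centerP: Zw => _ /(_ g Gg).
have sWG : <[w]>%g \subset G by rewrite cycle_subG.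
have uk : (u ^ k = u * w)%g by rewrite conjg_mulR.
have wS : reg G w *m S = S.
  rewrite /S mulmxA; congr (_ *m _); rewrite mulmx_sumr [RHS](reindex_inj (mulgI k)) /=.
  apply: eq_big => [h | h Gh]; first by rewrite groupMl.
  have wh : (w ^ h = w)%g by rewrite conjgE cw // mulKg.
  by rewrite -repr_mxM ?groupJ // conjgM uk conjMg wh cw ?groupJ.
have hS : hat G <[w]>%G *m S = S.
  apply: hat_fixl => _ /cycleP[i ->]; elim: i => [|i IHi]; first by rewrite repr_mx1 mul1mx.
  by rewrite expgS repr_mxM ?groupX // -mulmxA IHi.
have Rw : (hat G <[w]>%G \in QG G)%MS by apply: hat_mem.
have Rs : (\sum_(h in G) reg G (u ^ h)%g \in QG G)%MS.
  by apply: QG_sum => h Gh; rewrite QG_mem ?groupJ.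
have cwh x : x \in G -> reg G x *m hat G <[w]>%G = hat G <[w]>%G *m reg G x.
  move=> Gx; apply: hat_norm => //; apply: (subsetP (cent_sub _)).
  by rewrite cent_cycle; apply/cent1P; rewrite /commute cw.
by rewrite -hS /S mulmxA -(QG_central cwh Rs) -mulmxA hw mulmx0.
Qed.

(* Irreducibility of the cyclotomic polynomial makes e QZ(G) a field.  If      *)
(* a QG b = 0, averaging the conjugates of a t^-1 yields, for each t, elements *)
(* of this field that annihilate b, and they determine a when t varies.        *)
Lemma QG_center_prime (gT : finGroupType) (G : {group gT}) (e : 'M[rat]_#|G|) z p n :
    prime p -> z \in G -> (forall x, x \in G -> reg G x *m e = e *m reg G x) ->
    (forall u, u \in G -> u \notin 'Z(G)%g -> exists k,
        [/\ k \in G, [~ u, k]%g \in 'Z(G)%g & hat G <[ [~ u, k]%g ]>%G *m e = 0]) ->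
    (forall t, t \in 'Z(G)%g -> exists i, reg G t *m e = reg G (z ^+ i)%g *m e) ->
    (\sum_(j < p) reg G (z ^+ (j * p ^ n))%g) *m e = 0 ->
  forall a b, (a \in QG G)%MS -> (b \in QG G)%MS -> a *m e = a -> b *m e = b ->
    a != 0 -> b != 0 -> exists2 x, (x \in QG G)%MS & a *m x *m b != 0.
Proof.
move=> p_pr Gz ce C2 C3 Phi0 a b Ra Rb ae be a0 b0; apply: Classical_Prop.NNPP => noX.
have axb x : (x \in QG G)%MS -> a *m x *m b = 0.
  by move=> Rx; apply/eqP; apply: contraT => ne; case: noX; exists x.
have [al ea] := envelop_mxP Ra.
have sZG := center_sub G.
have ca x : (x \in QG G)%MS -> x *m e = e *m x := QG_central ce (a := x).
(* [y t] is e times the part of a t^-1 supported on the center. *)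
pose y t := (\sum_(s in 'Z(G)%g) al (s * t)%g *: reg G s) *m e.
have yb t : t \in G -> y t *m b = 0.
  (* T b = 0 because a QG b = 0. As noncentral class sums vanish on e, the sum [T] of the conjugates
     of a t^-1 becomes |G| y_t on e. *)
  move=> Gt; pose T := \sum_(h in G) reg G h^-1%g *m a *m reg G t^-1%g *m reg G h.
  have Tb : T *m b = 0.
    rewrite /T mulmx_suml big1 // => h Gh.
    rewrite -mulmxA -mulmxA -!mulmxA (mulmxA (reg G t^-1%g)) (mulmxA a) axb ?mulmx0 //.
    by rewrite QG_mul ?QG_mem ?groupV.
  have Te : T *m e = #|G|%:R *: y t.
    have -> : T = \sum_(g in G) al (g * t)%g *: \sum_(h in G) reg G (g ^ h)%g.
      rewrite /T (eq_bigr (fun h => \sum_(g in G) al (g * t)%g *: reg G (g ^ h)%g)).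
        by rewrite exchange_big; apply: eq_bigr => g Gg; rewrite scaler_sumr.
      move=> h Gh; rewrite ea mulmx_sumr !mulmx_suml [LHS](reindex_inj (mulIg t)) /=.
      apply: eq_big => [g | g Gg]; first by rewrite groupMr.
      have {}Gg : g \in G by rewrite -(groupMr _ Gt).
      rewrite -scalemxAr -!scalemxAl -!repr_mxM ?groupM ?groupV //.
      by rewrite conjgE !mulgA mulgK.
    rewrite mulmx_suml (bigID (mem 'Z(G)%g)) /= addrC big1 ?add0r; last first.
      move=> g /andP[Gg nZg]; have [k [Gk Zk hk]] := C2 g Gg nZg.
      by rewrite -scalemxAl (QG_class_sum0 ce Gg Gk) ?scaler0.
    rewrite /y mulmx_suml scaler_sumr; apply: eq_big => [g | g /andP[Gg Zg]].
      by apply/andP/idP=> [[] // | Zg]; rewrite (subsetP sZG).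
    rewrite (eq_bigr (fun=> reg G g)) => [|h Gh]; last first.
      by rewrite conjgE; case/centerP: Zg => _ /(_ h Gh) ->; rewrite mulKg.
    rewrite sumr_const -scaler_nat -!scalemxAl !scalerA mulrC //.
  have : T *m e *m b = 0 by rewrite -mulmxA -(ca b Rb) be.
  rewrite Te -scalemxAl => /eqP; rewrite scaler_eq0 (negPf (natN0 G)).
  by move/eqP.
have /fin_all_exists[i iE] : forall t : gT, exists i, t \in 'Z(G)%g -> reg G t *m e = reg G (z ^+ i)%g *m e.
  move=> t; have [Zt | nZt] := boolP (t \in 'Z(G)%g); last by exists 0%N.
  by have [i ti] := C3 t Zt; exists i.
(* An inverse of y_t would turn y_t b = 0 into b = 0. *)
have y0 t : t \in G -> y t = 0.
  move=> Gt; have ey : y t = (\sum_(s in 'Z(G)%g) al (s * t)%g *: reg G (z ^+ i s)%g) *m e.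
    rewrite /y !mulmx_suml; apply: eq_bigr => s Zs.
    by rewrite -!scalemxAl iE.
  have := cyclotomic_inverse p_pr Gz Phi0 (mem 'Z(G)%g) (fun s => al (s * t)%g) i.
  rewrite /= -ey => -[// | [w we]].
  by case/eqP: b0; rewrite -be (ca b Rb) -we -mulmxA yb ?mulmx0.
(* A pair (s, t) with s central contributes the term of s t in a, so the sum of the y_t t counts
   each term |Z(G)| times. *)
case/eqP: a0; have : \sum_(t in G) y t *m reg G t = #|'Z(G)%g|%:R *: a.
  transitivity (\sum_(s in 'Z(G)%g) a); last by rewrite sumr_const scaler_nat.
  rewrite (eq_bigr (fun t => \sum_(s in 'Z(G)%g) al (s * t)%g *: reg G (s * t)%g *m e)).
    rewrite exchange_big; apply: eq_bigr => s Zs /=; have Gs := subsetP sZG s Zs.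
    rewrite -mulmx_suml -[RHS]ae; congr (_ *m _); rewrite [RHS]ea [RHS](reindex_inj (mulgI s)) /=.
    by apply: eq_bigl => t; rewrite groupMl.
  move=> t Gt; rewrite /y !mulmx_suml; apply: eq_bigr => s Zs; have Gs := subsetP sZG s Zs.
  by rewrite -!scalemxAl -mulmxA -ce // mulmxA repr_mxM.
rewrite big1 => [/eqP | t Gt]; last by rewrite y0 ?mul0mx.
by rewrite eq_sym scaler_eq0 (negPf (natN0 _)) => /eqP.
Qed.

(** * One matrix component implies SN *)

Lemma division_mulf_neq0 (D : falgType rat) (x y : D) :
  division_algebra D -> x != 0 -> y != 0 -> x * y != 0.
Proof.
move=> divD nx; apply: contra_neq => xy0; apply: (mulrI (divD x nx)).
by rewrite mulr0.
Qed.

(** If [E] and 1 - E both had a nonzero entry, a matrix unit M joining them would make E M (1 - E)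
    nonzero, although it vanishes for a central idempotent. *)
Lemma central_idem_matrix (D : falgType rat) n (E : 'M[D]_n) : division_algebra D ->
  E *m E = E -> (forall M, M *m E = E *m M) -> E = 0 \/ E = 1%:M.
Proof.
move=> divD EE cE; have [-> | /matrix0Pn[a [b nE]]] := eqVneq E 0; [by left | right].
have [/eqP | /matrix0Pn[c [d nF]]] := eqVneq (1%:M - E) 0; first by rewrite subr_eq0 => /eqP.
have /matrixP/(_ a d) : E *m delta_mx b c *m (1%:M - E) = 0.
  by rewrite -cE -mulmxA mulmxBr mulmx1 EE subrr mulmx0.
rewrite !mxE (bigD1 c) //= big1 ?addr0 => [|j nj]; last first.
  rewrite !mxE big1 ?mul0r // => k _; rewrite !mxE (negPf nj) andbF mulr0 //.
rewrite !mxE (bigD1 b) //= big1 ?addr0 => [|j nj]; last by rewrite !mxE (negPf nj) mulr0.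
rewrite !mxE !eqxx mulr1 => /eqP; have := division_mulf_neq0 divD nE nF.
by rewrite !mxE => /negPf->.
Qed.

Lemma idem_matrix1 (D : falgType rat) n (m : 'M[D]_n) : division_algebra D ->
  n = 1%N -> m *m m = m -> m = 0 \/ m = 1%:M.
Proof.
move=> divD n1; subst n; rewrite [m]mx11_scalar; move: (m 0 0) => x.
move=> /matrixP/(_ 0 0); rewrite !mxE big_ord1 !mxE /= !mulr1n => xx.
have [-> | nx] := eqVneq x 0; [left | right]; first by rewrite raddf0.
by congr (_%:M); apply: (mulrI (divD x nx)); rewrite mulr1.
Qed.

(** The coefficients 1/|Y| and 1/|J| differ, so nothing cancels on [Y]. *)
Lemma hat_sub_coef_neq0 (gT : finGroupType) (G Y J : {group gT}) x :
    Y \proper J -> J \subset G -> x \in G ->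
  (coef (hat G Y - hat G J) x != 0) = (x \in J).
Proof.
move=> prYJ sJG Gx; have sYJ := proper_sub prYJ.
have -> : coef (hat G Y - hat G J) x = coef (hat G Y) x - coef (hat G J) x.
  by rewrite /coef linearB !mxE.
rewrite !coef_hat ?(subset_trans sYJ) //.
have [Jx | nJx] := boolP (x \in J); last first.
  by rewrite (contraNF (subsetP sYJ x)) // !mulr0 subrr eqxx.
case: (x \in Y); rewrite ?mulr1 ?mulr0.
  rewrite subr_eq0 (inj_eq invr_inj) Num.Theory.eqr_nat.
  by rewrite neq_ltn (proper_card prYJ).
by rewrite sub0r oppr_eq0 invr_eq0 natN0.
Qed.

(* If \hat N vanishes in the matrix component then \hat Y \hat N = \hat{NY}    *)
(* is central; otherwise \hat Y - \hat{NY} is, and its support is NY.          *)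
Lemma one_matrix_component_SN (gT : finGroupType) (G : {group gT}) :
  one_matrix_component G -> has_SN G.
Proof.
case=> k [n [D [f [[n0 divD lin mul one inj surj] /eqP/cards1P[i0 ei0]]]]] N Y nNG sYG.
have n1 i : i != i0 -> n i = 1%N.
  move=> ni; have: i \notin [set i0] by rewrite inE.
  by rewrite -ei0 inE -ltnNge ltnS => le1; apply/eqP; rewrite eqn_leq le1 n0.
have neg i (m : 'M[D i]_(n i)) : map_mx (fun d : D i => -1 *: d) m = - m.
  by apply/matrixP=> a b; rewrite !mxE scaleN1r.
have fB i x y : (x \in QG G)%MS -> (y \in QG G)%MS -> f i (x - y) = f i x - f i y.
  by move=> Rx Ry; rewrite addrC -scaleN1r lin // neg addrC.
(* Away from [i0] the blocks are 1 x 1, where an idempotent is 0 or 1; if it is so at [i0] as well,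
   it commutes with everything. *)
have cen c : (c \in QG G)%MS -> c *m c = c -> f i0 c = 0 \/ f i0 c = 1%:M ->
    forall g, g \in G -> reg G g *m c = c *m reg G g.
  move=> Rc cc fc g Gg; have Rg := QG_mem Gg.
  apply: inj; rewrite ?QG_mul // => i; rewrite !mul //.
  have : f i c = 0 \/ f i c = 1%:M.
    have [-> // | ni] := eqVneq i i0.
    by apply: idem_matrix1; rewrite -?mul ?cc // n1.
  by case=> ->; rewrite ?mulmx0 ?mul0mx ?mulmx1 ?mul1mx.
have sNG := normal_sub nNG; have Re := hat_mem sNG; have RY := hat_mem sYG.
have defJ : (N <*> Y = N * Y)%g by rewrite norm_joinEr // (subset_trans sYG) ?normal_norm.
have sJG : (N <*> Y)%G \subset G by rewrite join_subG sNG.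
have RJ := hat_mem sJG; have eJ := hat_join nNG sYG.
rewrite -defJ.
have ee : f i0 (hat G N) *m f i0 (hat G N) = f i0 (hat G N) by rewrite -mul // hat_idem.
(* [M] is lifted to QG with 0 in the other components. *)
have ce M : M *m f i0 (hat G N) = f i0 (hat G N) *m M.
  have [x Rx fx] := surj (dfwith (fun i => 0 : 'M[D i]_(n i)) M).
  by have := fx i0; rewrite dfwith_in => <-; rewrite -!mul // hat_central.
have [e0 | e1] := central_idem_matrix (divD i0) ee ce.
  right; rewrite /normal sJG; apply/normsP=> g Gg.
  apply: (@hat_inj _ G ((N <*> Y) :^ g)%G (N <*> Y)%G) => //=; first by rewrite -(conjGid Gg) conjSg.
  rewrite -conj_hat // -mulmxA -cen ?hat_idem //.
    by rewrite mulmxA -repr_mxM ?groupV // mulVg repr_mx1 mul1mx.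
  by left; rewrite -eJ mul // e0 mul0mx.
have [sNY | nNY] := boolP (N \subset Y); [by left | right].
have prY : Y \proper (N <*> Y)%G.
  by rewrite properE joing_subr; apply: contra nNY; apply: subset_trans; apply: joing_subl.
rewrite /normal sJG; apply/normsP=> g Gg; apply/setP=> x.
have sJgG : ((N <*> Y) :^ g)%G \subset G by rewrite -(conjGid Gg) conjSg.
have [Gx | nGx] := boolP (x \in G); last first.
  by apply/idP/idP => Jx; case/negP: nGx; [apply: (subsetP sJgG) | apply: (subsetP sJG)].
have prYg : (Y :^ g)%G \proper ((N <*> Y) :^ g)%G by rewrite properE !conjSg -properE.
apply: etrans (esym (hat_sub_coef_neq0 prYg sJgG Gx)) _.
apply: etrans _ (hat_sub_coef_neq0 prY sJG Gx).
congr (coef _ x != 0); rewrite -!conj_hat // -mulmxBl -mulmxBr -mulmxA -cen.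
- by rewrite mulmxA -repr_mxM ?groupV // mulVg repr_mx1 mul1mx.
- exact: QG_sub.
- have YJ : hat G Y *m hat G (N <*> Y)%G = hat G (N <*> Y)%G.
    by apply: hat_fixl => y Yy; rewrite hat_mull // (subsetP (joing_subr N Y)).
  have JY : hat G (N <*> Y)%G *m hat G Y = hat G (N <*> Y)%G.
    by apply: hat_fixr => y Yy; rewrite hat_mulr // (subsetP (joing_subr N Y)).
  by rewrite mulmxBl !mulmxBr YJ JY !hat_idem // subrr subr0.
- by left; rewrite fB // -eJ mul // e1 mul1mx subrr.
by [].
Qed.

(** * Sufficient conditions for one matrix component *)

Lemma one_matrix_component_criterion (gT : finGroupType) (G X : {group gT}) (e : 'M[rat]_#|G|) :
    X \subset G -> ~~ (X <| G)%g -> (e \in QG G)%MS ->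
    (forall a, (a \in QG G)%MS -> a *m a = 0 -> a *m e = a) ->
    (forall a b, (a \in QG G)%MS -> (b \in QG G)%MS -> a *m e = a -> b *m e = b ->
       a != 0 -> b != 0 -> exists2 x, (x \in QG G)%MS & a *m x *m b != 0) ->
  one_matrix_component G.
Proof.
move=> sXG nnX Re redE primeE.
have [k [n [D [f [n0 divD lin mul [one inj surj count]]]]]] :=
  matrix_algebra_one_component (cardG_gt0 G) (QG_one G) (@QG_mul _ G) (@QG_regular _ G)
    Re redE primeE (QG_nilpotent_of_nonnormal sXG nnX).
by exists k, n, D, f; split.
Qed.

(** The sum is invariant under [w], hence under averaging over <w>. For w = z^(p^n) it is the
    cyclotomic polynomial of order p^(n+1) at z. *)
Lemma root_sum_hat (gT : finGroupType) (G : {group gT}) w p : w \in G -> (w ^+ p = 1)%g ->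
  (\sum_(j < p) reg G (w ^+ j)%g) *m (1%:M - hat G <[w]>%G) = 0.
Proof.
move=> Gw wp; set T := \sum_(j < p) _.
suff Th : T *m hat G <[w]>%G = T by rewrite mulmxBr mulmx1 Th subrr.
have Tw : T *m reg G w = T.
  rewrite /T mulmx_suml (eq_bigr (fun j : 'I_p => reg G (w ^+ j.+1)%g)) => [|j _]; last first.
    by rewrite -repr_mxM ?groupX // expgSr.
  case: p wp {T} => [|p] wp; first by rewrite !big_ord0.
  by rewrite big_ord_recr big_ord_recl /= wp expg0 addrC.
apply: hat_fixr => _ /cycleP[i ->]; elim: i => [|i IHi]; first by rewrite repr_mx1 mulmx1.
by rewrite expgS repr_mxM ?groupX // mulmxA Tw.
Qed.

(** By [quot_ok], elements of square zero vanish on \hat N1 and \hat N2, so they lie in e QG. For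
    primeness, the commutator condition makes noncentral class sums vanish on e, [z] generates e
    QZ(G), and N1 = <z^(p^n)> makes the cyclotomic polynomial at [z] vanish on e. *)
Lemma two_central_one_matrix_component (gT : finGroupType) (G N1 N2 X : {group gT}) z p n :
    let e := (1%:M - hat G N1) *m (1%:M - hat G N2) in
    let quot_ok (N : {group gT}) := forall g h, g \in G -> h \in G ->
      exists2 m, m \in N & (g ^ h = g * m)%g \/ (g ^ h = g^-1 * m)%g in
    X \subset G -> ~~ (X <| G)%g -> N1 \subset 'Z(G)%g -> N2 \subset 'Z(G)%g ->
    quot_ok N1 -> quot_ok N2 ->
    (forall u, u \in G -> u \notin 'Z(G)%g -> exists k,
       [/\ k \in G, [~ u, k]%g \in 'Z(G)%g
         & (N1 \subset <[ [~ u, k] ]>%g) || (N2 \subset <[ [~ u, k] ]>%g)]) ->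
    prime p -> z \in 'Z(G)%g -> (z ^+ (p ^ n.+1) = 1)%g -> N1 :=: <[z ^+ (p ^ n)]>%g ->
    (forall t, t \in 'Z(G)%g -> exists i, reg G t *m e = reg G (z ^+ i)%g *m e) ->
  one_matrix_component G.
Proof.
move=> e quot_ok sXG nnX sN1Z sN2Z quo1 quo2 C2 p_pr Zz zp eN1 C3.
have sZG := center_sub G; have Gz := subsetP sZG z Zz.
have nN1G : (N1 <| G)%g by rewrite sub_center_normal.
have nN2G : (N2 <| G)%g by rewrite sub_center_normal.
have sN1G := normal_sub nN1G; have sN2G := normal_sub nN2G.
have Rd (N : {group gT}) : N \subset G -> (1%:M - hat G N \in QG G)%MS.
  by move=> sNG; rewrite QG_sub ?QG_one ?hat_mem.
have cd (N : {group gT}) x : (N <| G)%g -> (x \in QG G)%MS -> x *m (1%:M - hat G N) = (1%:M - hat G N) *m x.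
  by move=> nNG Rx; rewrite mulmxBr mulmxBl mulmx1 mul1mx hat_central.
have e_comm : e = (1%:M - hat G N2) *m (1%:M - hat G N1) by rewrite /e cd ?Rd.
have hd (N K : {group gT}) : K \subset G -> N \subset K -> hat G K *m (1%:M - hat G N) = 0.
  move=> sKG sNK; rewrite mulmxBr mulmx1 hat_fixr ?subrr // => x Nx.
  by rewrite hat_mulr // (subsetP sNK).
apply: (one_matrix_component_criterion (e := e) sXG nnX).
- by rewrite QG_mul ?Rd.
- move=> a Ra aa.
  have aN (N : {group gT}) : (N <| G)%g -> quot_ok N -> a *m (1%:M - hat G N) = a.
    by move=> nNG quoN; rewrite mulmxBr mulmx1 (QG_hat_reduced nNG) // subr0.
  by rewrite /e mulmxA !aN.
apply: (QG_center_prime p_pr Gz (n := n)) => //.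
- by move=> x Gx; have Rx := QG_mem Gx; rewrite /e mulmxA (cd N1 _ nN1G Rx) -(mulmxA _ (reg G x)) (cd N2 _ nN2G Rx) mulmxA.
- move=> u Gu nZu; have [k [Gk Zk sNk]] := C2 u Gu nZu; exists k; split=> //.
  have sWG : <[ [~ u, k] ]>%G \subset G by rewrite cycle_subG (subsetP sZG).
  case/orP: sNk => sN; first by rewrite /e mulmxA hd ?mul0mx.
  by rewrite e_comm mulmxA hd ?mul0mx.
rewrite (eq_bigr (fun j : 'I_p => reg G ((z ^+ (p ^ n)) ^+ j)%g)) => [|j _]; last first.
  by rewrite mulnC expgM.
rewrite /e; have -> : hat G N1 = hat G <[z ^+ (p ^ n)]>%G by congr (hat G _); apply: group_inj.
by rewrite mulmxA root_sum_hat ?mul0mx ?groupX // -expgM -expnSr.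
Qed.

(** Take N1 = N2 = S and a generator [z] of the center. G / S is abelian, so g^h = g [g, h] with
    [g, h] in [S], and a nontrivial commutator generates [S]. *)
Lemma monolith_one_matrix_component (gT : finGroupType) (G S X : {group gT}) p :
    prime p -> (p.-group G)%g -> monolith p G S -> G^`(1)%g \subset S -> cyclic 'Z(G)%g ->
    X \subset G -> ~~ (X <| G)%g ->
  one_matrix_component G.
Proof.
move=> p_pr pG [nSG oS sSZ _] sG'S cycZ sXG nnX.
have [z defZ] := cyclicP cycZ.
have Zz : z \in 'Z(G)%g by rewrite defZ cycle_id.
have pZ : (p.-group 'Z(G))%g := pgroupS (center_sub G) pG.
have [[|n] oz] : exists n, (#[z]%g = p ^ n)%N.
- by have [n e] := p_natP pZ; exists n; rewrite orderE -defZ.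
- have := subset_leq_card sSZ; rewrite oS defZ -orderE oz expn0 leqNgt prime_gt1 //.
have Wp : (#[z ^+ (p ^ n)]%g = p)%N.
  by rewrite orderXdiv oz ?dvdn_exp2l // expnS mulnK // expn_gt0 prime_gt0.
have eS : S :=: <[z ^+ (p ^ n)]>%g.
  apply/eqP; rewrite (eq_subG_cyclic cycZ) // ?oS -?orderE ?Wp //.
  by rewrite cycle_subG groupX.
have commS g h : g \in G -> h \in G -> [~ g, h]%g \in S.
  by move=> Gg Gh; rewrite (subsetP sG'S) // mem_commg.
apply: (@two_central_one_matrix_component _ G S S X z p n) => //.
- by move=> g h Gg Gh; exists [~ g, h]%g; [apply: commS | left; rewrite conjg_mulR].
- by move=> g h Gg Gh; exists [~ g, h]%g; [apply: commS | left; rewrite conjg_mulR].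
- move=> u Gu nZu.
  have [k Gk nt] : exists2 k, k \in G & [~ u, k]%g != 1%g.
    apply: Classical_Prop.NNPP => no; case/negP: nZu; apply/centerP; split=> // k Gk.
    apply/commgP; apply: contraT => nt; case: no; exists k => //.
  exists k; rewrite orbb (subsetP sSZ) ?commS //; split=> //.
  have Sw := commS u k Gu Gk.
  suff -> : S :=: <[ [~ u, k] ]>%g by [].
  apply/eqP; rewrite eq_sym eqEcard cycle_subG Sw -orderE oS.
  have wp : ([~ u, k] ^+ p = 1)%g by rewrite -oS expg_cardG.
  by rewrite (nt_prime_order p_pr wp nt) leqnn.
- by rewrite -oz expg_order.
move=> t; rewrite defZ => /cycleP[i ->]; by exists i.
Qed.

(** Take N1 = <c> and N2 = <zc>. On e both c and zc act as -1, hence z as 1, so the center acts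
    through powers of [c], with p = 2 and n = 0. *)
Lemma Q8Q8_one_matrix_component (gT : finGroupType) (G X : {group gT}) z c :
    Q8Q8_like G z c -> X \subset G -> ~~ (X <| G)%g ->
  one_matrix_component G.
Proof.
case=> Zz Zc z2 c2 [_ _ genZ C2 [cl2 quo1 quo2]] sXG nnX.
have sZG := center_sub G; have Gz := subsetP sZG z Zz; have Gc := subsetP sZG c Zc.
have zc : commute z c by case/centerP: Zz => _ /(_ c Gc).
have zc2 : ((z * c) ^+ 2 = 1)%g by rewrite expgMn // z2 c2 mulg1.
have quo_ok w : (forall m f, m \in G -> f \in G -> [~ m, f] \in <[w]> \/ m ^+ 2 * [~ m, f] \in <[w]>)%g ->
  forall g h, g \in G -> h \in G -> exists2 m, m \in <[w]>%g & (g ^ h = g * m)%g \/ (g ^ h = g^-1 * m)%g.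
  move=> quo g h Gg Gh; have [Wc | Wc] := quo g h Gg Gh.
    by exists [~ g, h]%g => //; left; rewrite conjg_mulR.
  by exists (g ^+ 2 * [~ g, h])%g => //; right; rewrite conjg_mulR expgS expg1 -mulgA mulKg.
apply: (@two_central_one_matrix_component _ G <[c]>%G <[z * c]>%G X c 2 0) => //.
- by rewrite cycle_subG.
- by rewrite cycle_subG groupM.
- exact: quo_ok.
- exact: quo_ok.
- move=> u Gu nZu; have [f Gf cf] := C2 u Gu nZu; exists f; split=> //; first exact: cl2.
  by case: cf => ->; rewrite subxx ?orbT.
set e := _ *m _.
have neg w : w \in G -> (w ^+ 2 = 1)%g -> (1%:M - hat G <[w]>%G) *m e = e -> reg G w *m e = - e.
  move=> Gw w2 we; have := root_sum_hat Gw w2; rewrite !big_ord_recl big_ord0 addr0 /= repr_mx1 expg1.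
  move/(congr1 (mulmx^~ e)); rewrite /= -mulmxA we mul0mx mulmxDl mul1mx.
  by move/eqP; rewrite addrC addr_eq0 => /eqP.
have didem w : w \in G -> (1%:M - hat G <[w]>%G) *m (1%:M - hat G <[w]>%G) = 1%:M - hat G <[w]>%G.
  by move=> Gw; rewrite mulmxBr mulmx1 mulmxBl mul1mx hat_idem ?cycle_subG // subrr subr0.
have ce : reg G c *m e = - e by apply: neg => //; rewrite /e mulmxA didem.
have zce : reg G (z * c)%g *m e = - e.
  apply: neg; rewrite ?groupM //.
  have nG : (<[z * c]>%G <| G)%g by rewrite sub_center_normal // cycle_subG groupM.
  have Rd : (1%:M - hat G <[c]>%G \in QG G)%MS by rewrite QG_sub ?QG_one ?hat_mem ?cycle_subG.
  rewrite /e mulmxA; rewrite [X in X *m _](_ : _ = (1%:M - hat G <[c]>%G) *m (1%:M - hat G <[z * c]>%G)).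
    by rewrite -mulmxA didem ?groupM.
  by rewrite [RHS]mulmxBr [LHS]mulmxBl mulmx1 mul1mx hat_central.
have ze : reg G z *m e = e.
  have -> : z = (z * c * c)%g by rewrite -mulgA (_ : (c * c = 1)%g) ?mulg1 // -expg2.
  by rewrite repr_mxM ?groupM // -mulmxA ce mulmxN zce opprK.
move=> t Zt; have [a [b ->]] := genZ t Zt; exists (nat_of_bool b).
rewrite repr_mxM ?groupX // -mulmxA; case: a; rewrite ?expg0 ?expg1 ?repr_mx1 ?mul1mx //.
by case: b; rewrite ?expg0 ?expg1 ?repr_mx1 ?mul1mx // ce mulmxN ze.
Qed.

(** * The classification *)

Local Close Scope ring_scope.

(** [P] contains its centralizer, so a normal subgroup meeting [P] trivially centralizes [P], lies
    in it and is trivial; by irreducibility every other one contains [P]. A subgroup X above [P] is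
    P(H :&: X), with H :&: X normal in the Dedekind group [H]. *)
Lemma faithful_irreducible_sdprod_SN (gT : finGroupType) (G P H : {group gT}) :
    P ><| H = G -> abelian P -> dedekind H ->
    acts_irreducibly H P 'J -> [faithful H, on P | 'J] ->
  has_SN G.
Proof.
move=> defG abP dH irrP faithP.
have [nPG sHG defPH nPH tiPH] := sdprod_context defG; have sPG := normal_sub nPG.
have CGP : 'C_G(P) \subset P.
  rewrite -defPH -group_modl //; move: faithP; rewrite /faithful astabJ => /trivgP->.
  by rewrite mulg1.
apply: (@SN_of_unique_min _ G P) => [N nNG ntN | X sPX sXG].
  have /mingroupP[_ minP] := irrP; have [NP1 | ntNP] := eqVneq (N :&: P) 1; last first.
    have <- : N :&: P = P.
      apply: (minP (N :&: P)%G); last exact: subsetIr.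
      rewrite /= ntNP astabsJ normsI //.
      exact: subset_trans sHG (normal_norm nNG).
    exact: subsetIl.
  case/negP: ntN; rewrite -subG1 -NP1 subsetI subxx; apply: subset_trans CGP.
  rewrite subsetI (normal_sub nNG); apply/commG1P/trivgP; rewrite -NP1.
  rewrite subsetI commg_subl commg_subr (subset_trans sPG (normal_norm nNG)).
  exact: subset_trans (normal_sub nNG) (normal_norm nPG).
rewrite /normal sXG -{1}defPH mul_subG ?(subset_trans sPX) ?normG //.
have -> : X :=: P * (H :&: X).
  by rewrite group_modl // defPH; apply/esym/setIidPr.
by rewrite normsM // normal_norm // (dH (H :&: X)%G) ?subsetIl.
Qed.

Lemma unique_minnormal_SN (gT : finGroupType) (G S : {group gT}) :
  unique_minnormal G S -> dedekind (G / S)%G -> has_SN G.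
Proof.
case=> sSG minS uniS dG; have [/andP[_ nSG] _] := mingroupP minS.
have nsSG : S <| G by rewrite /normal sSG.
apply: (@SN_of_unique_min _ G S); last exact/dedekind_quoP.
move=> N nNG ntN; have [T minT sTN] := minnormal_exists ntN (normal_norm nNG).
by rewrite -(uniS T) // (subset_trans sTN) ?normal_sub.
Qed.

Theorem theorem3 (gT : finGroupType) (G : {group gT}) :
  has_SN G <->
  [\/ has_SSN G,
      exists (p : nat) (P H : {group gT}),
        [/\ prime p,
            [/\ P ><| H = G, p.-Sylow(G) P, p.-abelem P & p^'.-Hall(G) H],
            dedekind H,
            (forall (q : nat) (Q : {group gT}), prime q -> q.-Sylow(H) Q ->
               cyclic Q \/ generalized_quaternion Q)
          & acts_irreducibly H P 'J /\ [faithful H, on P | 'J]],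
      exists S : {group gT},
        [/\ unique_minnormal G S, ~~ solvable S & dedekind (G / S)%G]
    | one_matrix_component G].
Proof.
split=> [SNG | [SSN | | | ]]; last first.
- exact: one_matrix_component_SN.
- by case=> S [minS _]; apply: unique_minnormal_SN.
- case=> p [P [H [_ [defG _ abP _] dH _ [irrP faithP]]]].
  exact: faithful_irreducible_sdprod_SN defG (abelem_abelian abP) dH irrP faithP.
- exact: SSN.
have [nilG | /(SN_nonnilpotent SNG)[? | ? | ?]] := boolP (nilpotent G); last first.
- by constructor 3.
- by constructor 2.
- by constructor 1.
have [/existsP[X /andP[sXG nnX]] | dG] := boolP [exists X : {group gT}, (X \subset G) && ~~ (X <| G)].
  have [p p_pr pG] := SN_nilpotent_pgroup SNG nilG sXG nnX.
  have [? | [S [monS sG'S cycZ]] | [z [c [_ zc]]]] := SN_pgroup p_pr pG SNG sXG nnX.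
  - by constructor 1.
  - by constructor 4; apply: monolith_one_matrix_component p_pr pG monS sG'S cycZ sXG nnX.
  by constructor 4; apply: Q8Q8_one_matrix_component zc sXG nnX.
constructor 1; apply: dedekind_SSN => X sXG.
by move: dG; rewrite negb_exists => /forallP/(_ X); rewrite sXG negbK.
Qed.
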